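(* Let $(M,L)$ be a Finsler manifold admitting a concurrent $\pi$-vector field $\overline{\zeta}$, and let $(M,\widetilde{L})$ be the Finsler manifold obtained from it by the energy $\beta$-change $\widetilde{L}^{2}=L^{2}+B^{2}$, where $B:=g(\overline{\zeta},\overline{\eta})$. Put $p^{2}:=g(\overline{\zeta},\overline{\zeta})$. Then the associated Chern connections $D^{\diamond}$ and $\widetilde{D^{\diamond}}$ are related, for all vector fields $X,Y$ on $\mathcal{T}M$, by $$\widetilde{D^{\diamond}}_{X}\rho Y=D^{\diamond}_{X}\rho Y-\frac{g(\rho X,\rho Y)}{1+p^{2}}\,\overline{\zeta}.$$ In particular, for all $\overline{X},\overline{Y}\in\mathfrak{X}(\pi(M))$: (a) $\widetilde{D^{\diamond}}_{\gamma\overline{X}}\overline{Y}=D^{\diamond}_{\gamma\overline{X}}\overline{Y}$; (b) $\widetilde{D^{\diamond}}_{\widetilde{\beta}\overline{X}}\overline{Y}=D^{\diamond}_{\beta\overline{X}}\overline{Y}-U^{\diamond}(\overline{X},\overline{Y})$, where $U^{\diamond}(\overline{X},\overline{Y})=\dfrac{g(\overline{X},\overline{Y})}{1+p^{2}}\,\overline{\zeta}-\dfrac{g(\overline{X},\overline{\eta})}{1+p^{2}}\,D^{\diamond}_{\gamma\overline{\zeta}}\overline{Y}$.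
   Context: $M$ is a real paracompact smooth manifold of finite dimension $n$; all objects are $C^\infty$. $\pi:\mathcal{T}M\to M$ is the bundle of nonzero tangent vectors, $\pi^{-1}(TM)\to\mathcal{T}M$ the pullback of $TM$ by $\pi$. Sections of $\pi^{-1}(TM)$ are called $\pi$-vector fields, are written with bars, and form the module $\mathfrak{X}(\pi(M))$. The fundamental $\pi$-vector field is $\overline{\eta}(u)=(u,u)$. $\rho:T(\mathcal{T}M)\to\pi^{-1}(TM)$ is $\rho=(\pi_{\mathcal{T}M},d\pi)$, and $\gamma:\pi^{-1}(TM)\to T(\mathcal{T}M)$ is the vertical lift $\gamma(u,v)=j_u(v)$, with $j_u:T_{\pi(u)}M\to T_u(T_{\pi(u)}M)$ the natural isomorphism. $(M,L)$ is a Finsler manifold with Finsler metric $g$ on $\pi^{-1}(TM)$ (locally $g_{ij}=\frac12\partial^2L^2/\partial y^i\partial y^j$). For a linear connection $D$ on $\pi^{-1}(TM)$ its connection map is $K(X)=D_X\overline{\eta}$; $D$ is regular if $T_u(\mathcal{T}M)=V_u(\mathcal{T}M)\oplus\ker K_u$ for all $u$ ($V$ the vertical bundle), and then its horizontal map is $\beta:=(\rho|_{\ker K})^{-1}$. With torsion $\mathbf{T}(X,Y)=D_X\rho Y-D_Y\rho X-\rho[X,Y]$, put $Q(\overline{X},\overline{Y})=\mathbf{T}(\beta\overline{X},\beta\overline{Y})$ and $T(\overline{X},\overline{Y})=\mathbf{T}(\gamma\overline{X},\beta\overline{Y})$. The Cartan connection $\nabla$ is the unique regular connection on $\pi^{-1}(TM)$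 with $\nabla g=0$, $Q=0$ and $g(T(\overline{X},\overline{Y}),\overline{Z})=g(T(\overline{X},\overline{Z}),\overline{Y})$. A $\pi$-vector field $\overline{\zeta}$ is concurrent if $\nabla_{\beta\overline{X}}\overline{\zeta}=-\overline{X}$ and $\nabla_{\gamma\overline{X}}\overline{\zeta}=0$ for all $\overline{X}$. The Chern (Rund) connection $D^{\diamond}$ of $(M,L)$ is given by $D^{\diamond}_X\overline{Y}=\nabla_X\overline{Y}-T(KX,\overline{Y})$, with $K,T$ the connection map and $(h)hv$-torsion of $\nabla$; it has the same horizontal map $\beta$ as $\nabla$. $\widetilde{D^{\diamond}}$ and $\widetilde{\beta}$ are the corresponding objects for $\widetilde{L}$. *)

(* Defs.v *)
From HB Require Import structures.
From mathcomp Require Import all_boot all_order all_algebra.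
From mathcomp Require Import all_classical all_reals all_analysis.

Set Implicit Arguments.
Unset Strict Implicit.
Unset Printing Implicit Defensive.

Import Order.TTheory GRing.Theory Num.Theory.
Import numFieldNormedType.Exports.

Local Open Scope classical_set_scope.
Local Open Scope ring_scope.

(* Used only for finite-dimensional [V] and [W] and open [A]: [f] is infinitely
   (Frechet) differentiable at every point of [A]. *)
Definition smooth_on (R : realType) (V W : normedModType R) (A : set V)
    (f : V -> W) : Prop :=
  forall (vs : seq V) (x : V), A x ->
    differentiable (foldr (fun v (h : V -> W) => 'D_v h) f vs) x.

(* Every open cover has a locally finite open refinement. *)
Definition paracompact_space (T : topologicalType) : Prop :=
  forall C : set (set T),
    C `<=` open -> \bigcup_(A in C) A = setT ->
    exists C' : set (set T),
      [/\ C' `<=` open,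
          \bigcup_(A in C') A = setT,
          forall A, C' A -> exists2 B, C B & A `<=` B &
          forall p : T, exists2 N : set T, nbhs p N &
            finite_set [set A | C' A /\ A `&` N !=set0]].

(* A homeomorphism from an open set of [T] onto an open set of R^n; [co] and
   [inv] are total functions, unconstrained outside these two sets. *)
Record chart (R : realType) (n : nat) (T : topologicalType) := Chart {
  dom : set T;
  co : T -> 'rV[R]_n;
  inv : 'rV[R]_n -> T;
  dom_open : open dom;
  ran_open : open (co @` dom);
  coK : forall p, dom p -> inv (co p) = p;
  co_cont : {within dom, continuous co};
  inv_cont : {within co @` dom, continuous inv} }.

Record manifold (R : realType) (n : nat) := Manifold {
  carrier :> topologicalType;
  atlas : set (chart R n carrier);
  manifold_hausdorff : hausdorff_space carrier;
  manifold_paracompact : paracompact_space carrier;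
  atlas_cover : forall p : carrier, exists2 c, atlas c & dom c p;
  atlas_compat : forall c d, atlas c -> atlas d ->
    smooth_on (co c @` (dom c `&` dom d)) (co d \o inv c) }.

(* Every point [p] is assigned, once and for all, a chart [chart_at p] of the
    atlas around it, and T_p M is identified with R^n through this chart: a
    tangent vector at [p] is represented by its components there.  Smoothness
    of fields is always tested on components in the charts of the atlas. *)

Section TangentBundle.
Variables (R : realType) (n : nat) (M : manifold R n).

Definition chart_at (p : M) : chart R n M := s2val (cid2 (atlas_cover p)).

(* TM; the pair (p, y) is the tangent vector at p with components y. *)
Definition TM : Type := (M * 'rV[R]_n)%type.

(* The nonzero tangent vectors.  Functions and fields below are total on TM,
   but only their values on [slit] matter. *)
Definition slit : set TM := [set u | u.2 != 0].

(* The components, in the chart [c], of the tangent vector [v] at [p]. *)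
Definition components (c : chart R n M) (p : M) (v : 'rV[R]_n) : 'rV[R]_n :=
  'd (co c \o inv (chart_at p)) (co (chart_at p) p) v.

(* The chart (x, y) of TM induced by a chart [c] of M, and its inverse. *)
Definition tco (c : chart R n M) (u : TM) : 'rV[R]_n * 'rV[R]_n :=
  (co c u.1, components c u.1 u.2).

Definition tinv (c : chart R n M) (z : 'rV[R]_n * 'rV[R]_n) : TM :=
  let x : 'rV[R]_n := z.1 in let p := inv c x in
  (p, 'd (co (chart_at p) \o inv c) x z.2).

Definition tran (c : chart R n M) : set ('rV[R]_n * 'rV[R]_n) :=
  [set z | (co c @` dom c) z.1 /\ z.2 != 0].

(* T_u(TM), again identified with R^n x R^n, through the chart of TM induced by
   [chart_at u.1]. *)
Definition TTM : Type := ('rV[R]_n * 'rV[R]_n)%type.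

(* The derivative w(F) of a function F at [u] along w in T_u(TM). *)
Definition tder (W : normedModType R) (u : TM) (w : TTM) (F : TM -> W) : W :=
  'd (F \o tinv (chart_at u.1)) (tco (chart_at u.1) u) w.

Definition smooth_fun (F : TM -> R) : Prop :=
  forall c, atlas c -> smooth_on (tran c) (F \o tinv c).

(* pi-vector fields: a section of pi^{-1}(TM) maps u to a vector at u.1. *)
Definition smooth_section (Y : TM -> 'rV[R]_n) : Prop :=
  forall c, atlas c ->
    smooth_on (tran c) ((fun u : TM => components c u.1 (Y u)) \o tinv c).

Definition smooth_vfield (X : TM -> TTM) : Prop :=
  forall c, atlas c ->
    smooth_on (tran c) ((fun u : TM => tder u (X u) (tco c)) \o tinv c).

(* In any chart z of TM, the components of [X, Y] are X(Y(z)) - Y(X(z)). *)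
Definition bracket (X Y : TM -> TTM) (u : TM) : TTM :=
  let z := tco (chart_at u.1) in
  tder u (X u) (fun u' => tder u' (Y u') z)
  - tder u (Y u) (fun u' => tder u' (X u') z).

(* The fundamental pi-vector field. *)
Definition fund (u : TM) : 'rV[R]_n := u.2.

(* The projection pi reads (x, y) |-> x in the induced charts, so that its
   differential is the first projection. *)
Definition rho (w : TTM) : 'rV[R]_n := w.1.

(* The velocity of the curve t |-> u + t v in the fibre, which reads
   t |-> (x, y + t v). *)
Definition gamma (v : 'rV[R]_n) : TTM := (0, v).

(* For a linear connection on pi^{-1}(TM), [D u w Y] is the covariant
   derivative of the section Y at u along the vector w in T_u(TM). *)

Definition cov_deriv := TM -> TTM -> (TM -> 'rV[R]_n) -> 'rV[R]_n.

Definition is_connection (D : cov_deriv) : Prop :=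
  [/\ forall u (a : R) (w w' : TTM) Y, slit u -> smooth_section Y ->
        D u (a *: w + w') Y = a *: D u w Y + D u w' Y,
      forall u w Y Z, slit u -> smooth_section Y -> smooth_section Z ->
        D u w (fun u' => Y u' + Z u') = D u w Y + D u w Z,
      forall u w f Y, slit u -> smooth_fun f -> smooth_section Y ->
        D u w (fun u' => f u' *: Y u') = tder u w f *: Y u + f u *: D u w Y &
      forall X Y, smooth_vfield X -> smooth_section Y ->
        smooth_section (fun u => D u (X u) Y)].

Section Connection.
Variable D : cov_deriv.

Definition conn_map (u : TM) (w : TTM) : 'rV[R]_n := D u w fund.

(* T_u(TM) is the direct sum of the vertical space ker rho and of ker K_u. *)
Definition regular : Prop :=
  forall u, slit u ->
    (forall w : TTM, exists v h : TTM,
       [/\ rho v = 0, conn_map u h = 0 & w = v + h]) /\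
    (forall w : TTM, rho w = 0 -> conn_map u w = 0 -> w = 0).

(* The inverse of the restriction of rho to ker K_u. *)
Definition hor_map (u : TM) (v : 'rV[R]_n) : TTM :=
  xget 0 [set w : TTM | conn_map u w = 0 /\ rho w = v].

Definition torsion (X Y : TM -> TTM) (u : TM) : 'rV[R]_n :=
  D u (X u) (rho \o Y) - D u (Y u) (rho \o X) - rho (bracket X Y u).

Definition lift_h (X : TM -> 'rV[R]_n) (u : TM) : TTM := hor_map u (X u).
Definition lift_v (X : TM -> 'rV[R]_n) (u : TM) : TTM := gamma (X u).

Definition torsion_hh (X Y : TM -> 'rV[R]_n) : TM -> 'rV[R]_n :=
  torsion (lift_h X) (lift_h Y).
Definition torsion_hv (X Y : TM -> 'rV[R]_n) : TM -> 'rV[R]_n :=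
  torsion (lift_v X) (lift_h Y).

End Connection.

Section Finsler.
Variable L : TM -> R.

(* g_u(v, w) = g_ij v^i w^j, where g_ij = 1/2 d^2 (L^2) / dy^i dy^j at u. *)
Definition fmetric (u : TM) (v w : 'rV[R]_n) : R :=
  2^-1 * 'D_v ('D_w (fun y : 'rV[R]_n => L (u.1, y) ^+ 2)) u.2.

(* Only the values of L on nonzero vectors are considered: by homogeneity, its
   extension by 0 to the zero section is automatically continuous. *)
Definition finsler : Prop :=
  [/\ smooth_fun L,
      forall u, slit u -> 0 < L u,
      forall p y (t : R), y != 0 -> 0 < t -> L (p, t *: y) = t * L (p, y) &
      forall u v, slit u -> v != 0 -> 0 < fmetric u v v].

Definition metrical (D : cov_deriv) : Prop :=
  forall u w Y Z, slit u -> smooth_section Y -> smooth_section Z ->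
    tder u w (fun u' => fmetric u' (Y u') (Z u')) =
    fmetric u (D u w Y) (Z u) + fmetric u (Y u) (D u w Z).

Definition is_cartan (D : cov_deriv) : Prop :=
  [/\ is_connection D,
      regular D,
      metrical D,
      forall X Y u, slit u -> smooth_section X -> smooth_section Y ->
        torsion_hh D X Y u = 0 &
      forall X Y Z u, slit u ->
        smooth_section X -> smooth_section Y -> smooth_section Z ->
        fmetric u (torsion_hv D X Y u) (Z u) =
        fmetric u (torsion_hv D X Z u) (Y u)].

End Finsler.

(* [D] is meant to be the Cartan connection. *)
Definition concurrent (D : cov_deriv) (zeta : TM -> 'rV[R]_n) : Prop :=
  smooth_section zeta /\
  forall X u, slit u -> smooth_section X ->
    D u (lift_h D X u) zeta = - X u /\ D u (lift_v X u) zeta = 0.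

(* The Chern connection, for [D] the Cartan connection. *)
Definition chern (D : cov_deriv) (X : TM -> TTM) (Y : TM -> 'rV[R]_n)
    (u : TM) : 'rV[R]_n :=
  D u (X u) Y - torsion_hv D (fun u' => conn_map D u' (X u')) Y u.

End TangentBundle.

(* Main.v *)
Require Import Defs.
From HB Require Import structures.
From mathcomp Require Import all_boot all_order all_algebra.
From mathcomp Require Import all_classical all_reals all_analysis.
From mathcomp Require Import lra ring.

Set Implicit Arguments.
Unset Strict Implicit.
Unset Printing Implicit Defensive.

Import Order.TTheory GRing.Theory Num.Theory.
Import numFieldNormedType.Exports.

Local Open Scope classical_set_scope.
Local Open Scope ring_scope.

(** Write a connection D as flat_deriv + christoffel: flat_deriv differentiates
    components in the chart attached to the base point, and christoffel is the
    remainder, the Christoffel symbols of a textbook.  The bracket of two fields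
    has the components of an iterated derivative (rho_bracket), so the torsions
    become statements about christoffel alone: T(X, Y) is christoffel evaluated
    on the vertical vector gamma X (torsion_hvE), and Q = 0 says that
    hor_christoffel, its restriction to horizontal vectors, is symmetric
    (torsion_hhE, hor_christoffel_sym).

    For the Cartan connection, compatibility with g along the fibres and the
    symmetry of T give 2 g(T(v, Y), Z) = C(v, Y, Z), where C is the derivative of
    g along the fibre (cartan_tensorE).  As a third derivative of L^2 / 2 the
    tensor C is totally symmetric, because derivatives commute (derive_comm), and
    it kills the fundamental field by homogeneity.  Hence K(gamma v) = v,
    beta v = (v, - hor_christoffel v eta), and subtracting T(K X, Y) from
    nabla_X Y removes exactly the vertical part of christoffel:
      D'_X Y = flat_deriv X Y + hor_christoffel (rho X) Y
    for the Chern connection D' (chernE).  Everything thus reduces to comparing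
    hor_christoffel for L and for L~ (hor_christoffel_change).

    A concurrent field satisfies nabla_w zeta = - rho w, so
    d(p^2)(w) = - 2 g(rho w, zeta) (tder_p2).  The function p^2 is therefore
    constant on the fibres; so are its derivatives in the base directions, that
    is, the numbers g(a, zeta) for fixed components a (zeta_mixed).
    Differentiating g(a, zeta) along the fibre gives C(b, a, zeta) / 2, and C
    kills zeta (cartan_tensor_zeta).  Consequently zeta itself does not depend on
    y, the derivative of B along the fibres is g(zeta, .), and the new metric is
    g~ = g + g(zeta, .) g(zeta, .) (changed_metric).

    Let S be the difference of the two hor_christoffel plus g / (1 + p^2) zeta.
    It is symmetric, and the two metric conditions combine to
      g~(S(v, Y), Z) + g~(Y, S(v, Z)) = - C(S(v, eta), Y, Z)
    (koszul_difference, S_metric).  The right-hand side is there because the two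
    horizontal lifts differ.  It does not prevent the argument that proves
    uniqueness of the Levi-Civita connection: one first finds S(eta, eta) = 0,
    then S(v, eta) = 0, after which the identity is the classical one
    (torsion_free_metric_unique).  So S = 0, which is the first relation.  In (a)
    both sides are flat_deriv (gamma X) Y, since rho (gamma X) = 0; in (b) the
    extra term is the derivative along beta~ X - beta X =
    g(X, eta) / (1 + p^2) gamma zeta.

    Two points of analysis underlie this.  The conditions on a connection speak of
    global smooth sections, so pointwise conclusions require a section through any
    given vector (section_through), built with bump functions.  And the formula
    for rho [X, beta Y] requires beta Y to be differentiable, although beta is
    only defined pointwise, as the inverse of rho on ker K; in a local frame
    Cramer's rule expresses it through smooth functions (lift_h_coords,
    lift_h_diff). *)

(** * Calculus of smooth maps on open sets *)

Section LocalCalculus.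
Context {R : realType}.
Implicit Types U V W : normedModType R.

Lemma near_eq_diff V W (f g : V -> W) x :
  (\near x, f x = g x) -> differentiable f x ->
  differentiable g x /\ 'd g x = 'd f x :> (V -> W).
Proof.
move=> fg df; have dfc := diff_continuous df.
have gE : g \o shift x = cst (g x) + 'd f x +o_ 0 id.
  apply/eqaddoP => _ /posnumP[e].
  have /eqaddoP /(_ e%:num) /(_ [gt0 of e%:num]) := diff_locally df.
  have fgh : \forall h \near 0, f (h + x) = g (h + x).
    by move: (fg); rewrite (near_shift 0 x) /= subr0.
  move: fgh => /[swap]; apply: filterS2 => h /= /[swap] fgh.
  by rewrite !fctE /= fgh (nbhs_singleton fg).
have dg := diff_unique dfc gE.
by split; [apply/diff_locallyP; rewrite dg|exact: dg].
Qed.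

Lemma smooth_onS V W (A : set V) (f : V -> W) :
  smooth_on A f <->
  (forall x, A x -> differentiable f x) /\ forall v, smooth_on A ('D_v f).
Proof.
split=> [fs|[fd fs]].
  split=> [x Ax|v vs x Ax]; first exact: (fs [::]).
  by have := fs (rcons vs v) x Ax; rewrite foldr_rcons.
elim/last_ind => [|vs v _] x Ax /=; first exact: fd.
by rewrite foldr_rcons; exact: fs.
Qed.

(** The derivatives of a sum, product or composite are sums of products of
    derivatives of lower order, so closure properties go by induction on the order
    of differentiability; smooth_on itself offers nothing to induct on. *)
Fixpoint diffk (k : nat) V W (A : set V) (f : V -> W) : Prop :=
  (forall x, A x -> differentiable f x) /\
  if k is k'.+1 then forall v, diffk k' A ('D_v f) else True.

Lemma smooth_onP V W (A : set V) (f : V -> W) :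
  smooth_on A f <-> forall k, diffk k A f.
Proof.
split=> [fs k|fk vs].
  elim: k f fs => [|k IH] f /smooth_onS[fd fs]; split=> // v; exact: IH.
elim/last_ind: vs f fk => [|vs v IH] f fk x Ax /=; first by case: (fk 0%N) => + _; exact.
by rewrite foldr_rcons; apply: IH => // k; case: (fk k.+1) => _; exact.
Qed.

Lemma diffkW k V W (A : set V) (f : V -> W) : diffk k.+1 A f -> diffk k A f.
Proof.
elim: k f => [|k IH] f [fd fs]; split=> // v; exact: IH.
Qed.

Lemma diffk_diff k V W (A : set V) (f : V -> W) x :
  diffk k A f -> A x -> differentiable f x.
Proof. by case: k => [|k] [+ _]; exact. Qed.

Lemma smooth_diff V W (A : set V) (f : V -> W) x :
  smooth_on A f -> A x -> differentiable f x.
Proof. by move=> fs; exact: (fs [::]). Qed.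

Lemma smooth_derive V W (A : set V) (f : V -> W) v :
  smooth_on A f -> smooth_on A ('D_v f).
Proof. by case/smooth_onS. Qed.

Lemma smooth_sub V W (A B : set V) (f : V -> W) :
  B `<=` A -> smooth_on A f -> smooth_on B f.
Proof. by move=> BA fs vs x /BA; exact: fs. Qed.

Section OnOpen.
Context {V : normedModType R} (A : set V).
Hypothesis oA : open A.

Lemma open_near x (P : V -> Prop) : A x -> (forall y, A y -> P y) -> \near x, P x.
Proof. by move=> Ax AP; apply: (filterS AP); exact: open_nbhs_nbhs. Qed.

Lemma diffk_ext k W (f g : V -> W) :
  (forall x, A x -> f x = g x) -> diffk k A f -> diffk k A g.
Proof.
elim: k f g => [|k IH] f g fg [fd fs].
  split=> // x Ax.
  by case: (@near_eq_diff _ _ f g x) => //; [exact: open_near|exact: fd].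
split=> [x Ax|v].
  by case: (@near_eq_diff _ _ f g x) => //; [exact: open_near|exact: fd].
apply: IH (fs v) => x Ax; apply: near_eq_derive; exact: open_near.
Qed.

Lemma smooth_ext W (f g : V -> W) :
  (forall x, A x -> f x = g x) -> smooth_on A f -> smooth_on A g.
Proof. by move=> fg /smooth_onP fs; apply/smooth_onP => k; exact: diffk_ext (fs k). Qed.

Lemma diffk_cst k W (a : W) : diffk k A (fun _ => a).
Proof.
elim: k a => [|k IH] a; first by split=> // x _; exact: differentiable_cst.
split=> [x _|v]; first exact: differentiable_cst.
rewrite (_ : 'D_v _ = fun _ => 0); first exact: IH.
by apply/funext => x; rewrite derive_cst.
Qed.

Lemma diffk_lin_comp k W U (l : {linear W -> U}) (f : V -> W) :
  continuous l -> diffk k A f -> diffk k A (l \o f).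
Proof.
move=> lc.
have ld w : differentiable l w by exact: linear_differentiable.
elim: k f => [|k IH] f fk.
  by split=> // x Ax; apply: differentiable_comp => //; exact: diffk_diff fk Ax.
split=> [x Ax|v].
  by apply: differentiable_comp => //; exact: diffk_diff fk Ax.
have fd x (Ax : A x) := diffk_diff fk Ax.
case: fk => _ /(_ v)/IH; apply: diffk_ext => x Ax /=.
rewrite [RHS]deriveE; last by apply: differentiable_comp => //; exact: fd.
rewrite diff_comp //; last exact: fd.
by rewrite /= diff_lin // deriveE //; exact: fd.
Qed.

Lemma diffkD k W (f g : V -> W) :
  diffk k A f -> diffk k A g -> diffk k A (fun x => f x + g x).
Proof.
elim: k f g => [|k IH] f g fk gk.
  by split=> // x Ax; apply: differentiableD; [exact: diffk_diff fk Ax|exact: diffk_diff gk Ax].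
split=> [x Ax|v].
  by apply: differentiableD; [exact: diffk_diff fk Ax|exact: diffk_diff gk Ax].
have := IH _ _ (fk.2 v) (gk.2 v); apply: diffk_ext => x Ax.
by rewrite -deriveD //; apply: diff_derivable; [exact: diffk_diff fk Ax|exact: diffk_diff gk Ax].
Qed.

(** The map is scaling, which is bilinear and continuous, after the pair (f, g). *)
Lemma is_diff_smul W (f : V -> R) (g : V -> W) x :
  differentiable f x -> differentiable g x ->
  differentiable (fun y => f y *: g y) x /\
  'd (fun y => f y *: g y) x = (fun v => 'd f x v *: g x + f x *: 'd g x v) :> (V -> W).
Proof.
move=> df dg.
have sbil : bilinear_for (GRing.Scale.Law.clone _ _ *:%R _)
    (GRing.Scale.Law.clone _ _ *:%R _) ( *:%R : R -> W -> W).
  by split=> [u'|u] a y z /=; rewrite ?scalerDl ?scalerDr !scalerA // mulrC.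
pose sM := bilinear_isBilinear.Build R R W W _ _ ( *:%R : R -> W -> W) sbil.
pose sL : {bilinear R -> W -> W} := HB.pack ( *:%R : R -> W -> W) sM.
have sc : continuous (fun p : R * W => sL p.1 p.2) by exact: scale_continuous.
have pd := differentiable_pair df dg.
have sd p : differentiable (fun p : R * W => sL p.1 p.2) p by exact: differentiable_bilin.
split; first exact: (differentiable_comp pd (sd (f x, g x))).
have := diff_comp pd (sd (f x, g x)).
rewrite (_ : (fun p => sL p.1 p.2) \o _ = fun y => f y *: g y) // => ->.
rewrite diff_bilin //; apply/funext => v /=.
by rewrite diff_pair //= addrC.
Qed.

Lemma diffk_smul k W (f : V -> R) (g : V -> W) :
  diffk k A f -> diffk k A g -> diffk k A (fun x => f x *: g x).
Proof.
elim: k f g => [|k IH] f g fk gk.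
  by split=> // x Ax; case: (is_diff_smul (diffk_diff fk Ax) (diffk_diff gk Ax)).
split=> [x Ax|v].
  by case: (is_diff_smul (diffk_diff fk Ax) (diffk_diff gk Ax)).
have := diffkD (IH _ _ (fk.2 v) (diffkW gk)) (IH _ _ (diffkW fk) (gk.2 v)).
apply: diffk_ext => x Ax.
have [h1 h2] := is_diff_smul (diffk_diff fk Ax) (diffk_diff gk Ax).
by rewrite [RHS]deriveE // h2 !deriveE //; [exact: diffk_diff gk Ax|exact: diffk_diff fk Ax].
Qed.

Lemma diffk_sum k W m (f : 'I_m -> V -> W) :
  (forall i, diffk k A (f i)) -> diffk k A (fun x => \sum_i f i x).
Proof.
move=> fk; elim: m f fk => [|m IH] f fk.
  apply: diffk_ext (diffk_cst k 0) => x _; by rewrite big_ord0.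
apply: diffk_ext (diffkD (fk ord0) (IH _ (fun i => fk (lift ord0 i)))) => x _.
by rewrite big_ord_recl.
Qed.

End OnOpen.

(** A basis with its coordinate forms.  The chain rule reads
    D_v (f o g) = sum_i l_i (D_v g) (D_(e_i) f o g), which keeps the derivatives of
    a composite within sums of products of composites. *)
Definition fin_dim V : Prop := exists m (e : 'I_m -> V) (l : 'I_m -> {linear V -> R}),
  (forall i, continuous (l i)) /\ forall v, v = \sum_i l i v *: e i.

Lemma diffk_comp k U V W (A : set U) (B : set V) (g : U -> V) (f : V -> W) :
  open A -> fin_dim V -> (forall x, A x -> B (g x)) ->
  diffk k A g -> diffk k B f -> diffk k A (f \o g).
Proof.
move=> oA [m [e [l [lc le]]]] AB; elim: k f => [|k IH] f gk fk.
  by split=> // x Ax; apply: differentiable_comp; [exact: diffk_diff gk Ax|exact: diffk_diff fk (AB _ Ax)].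
split=> [x Ax|v].
  by apply: differentiable_comp; [exact: diffk_diff gk Ax|exact: diffk_diff fk (AB _ Ax)].
have H i : diffk k A (fun x => l i ('D_v g x) *: 'D_(e i) f (g x)).
  apply: diffk_smul => //; first by apply: diffk_lin_comp => //; exact: gk.2.
  by apply: (IH ('D_(e i) f)); [exact: diffkW gk|exact: fk.2].
apply: diffk_ext (diffk_sum oA H) => // x Ax.
have dg := diffk_diff gk Ax; have df := diffk_diff fk (AB _ Ax).
rewrite [RHS]deriveE; last exact: differentiable_comp.
rewrite diff_comp // /comp -(deriveE v dg) [in RHS](le ('D_v g x)) linear_sum.
by apply: eq_bigr => i _; rewrite linearZ /= (deriveE (e i) df).
Qed.

End LocalCalculus.

(** * Smooth maps between finite-dimensional spaces *)

Section SmoothMaps.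
Context {R : realType}.
Implicit Types U V W : normedModType R.

Lemma smooth_cst V W (A : set V) (a : W) : smooth_on A (fun _ => a).
Proof. by apply/smooth_onP => k; exact: diffk_cst. Qed.

Lemma smooth_linear V W (A : set V) (l : {linear V -> W}) :
  continuous l -> smooth_on A l.
Proof.
move=> lc; apply/smooth_onS; split=> [x _|v]; first exact: linear_differentiable.
rewrite (_ : 'D_v l = fun _ => l v); first exact: smooth_cst.
by apply/funext => x; rewrite deriveE; [rewrite diff_lin|exact: linear_differentiable].
Qed.

Lemma smoothD V W (A : set V) (f g : V -> W) : open A ->
  smooth_on A f -> smooth_on A g -> smooth_on A (fun x => f x + g x).
Proof.
by move=> oA /smooth_onP fs /smooth_onP gs; apply/smooth_onP => k; exact: diffkD.
Qed.

Lemma smooth_smul V W (A : set V) (f : V -> R) (g : V -> W) : open A ->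
  smooth_on A f -> smooth_on A g -> smooth_on A (fun x => f x *: g x).
Proof.
by move=> oA /smooth_onP fs /smooth_onP gs; apply/smooth_onP => k; exact: diffk_smul.
Qed.

Lemma smooth_sum V W (A : set V) m (f : 'I_m -> V -> W) : open A ->
  (forall i, smooth_on A (f i)) -> smooth_on A (fun x => \sum_i f i x).
Proof.
move=> oA fs; apply/smooth_onP => k; apply: diffk_sum => // i.
exact: (smooth_onP _ _).1 (fs i) k.
Qed.

Lemma smooth_lin_comp U V W (A : set U) (l : {linear V -> W}) (f : U -> V) :
  open A -> continuous l -> smooth_on A f -> smooth_on A (l \o f).
Proof.
by move=> oA lc /smooth_onP fs; apply/smooth_onP => k; exact: diffk_lin_comp.
Qed.

Lemma smooth_comp U V W (A : set U) (B : set V) (g : U -> V) (f : V -> W) :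
  open A -> fin_dim V -> (forall x, A x -> B (g x)) ->
  smooth_on A g -> smooth_on B f -> smooth_on A (f \o g).
Proof.
move=> oA Vf AB /smooth_onP gs /smooth_onP fs; apply/smooth_onP => k.
exact: (diffk_comp oA Vf AB).
Qed.

Lemma fst_cont V W : continuous (fst : V * W -> V).
Proof. by move=> x; exact: cvg_fst. Qed.

Lemma snd_cont V W : continuous (snd : V * W -> W).
Proof. by move=> x; exact: cvg_snd. Qed.

Definition inj1 V W (x : V) : V * W := (x, 0).
Definition inj2 V W (x : W) : V * W := (0, x).

Lemma inj1_linear V W : linear (@inj1 V W).
Proof. by move=> a x y; congr pair => /=; rewrite scaler0 addr0. Qed.

Lemma inj2_linear V W : linear (@inj2 V W).
Proof. by move=> a x y; congr pair => /=; rewrite scaler0 addr0. Qed.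

HB.instance Definition _ V W :=
  GRing.isLinear.Build R V (V * W)%type _ (@inj1 V W) (@inj1_linear V W).
HB.instance Definition _ V W :=
  GRing.isLinear.Build R W (V * W)%type _ (@inj2 V W) (@inj2_linear V W).

Lemma inj1_cont V W : continuous (@inj1 V W).
Proof. by move=> x; apply: cvg_pair => //; exact: cvg_cst. Qed.

Lemma inj2_cont V W : continuous (@inj2 V W).
Proof. by move=> x; apply: cvg_pair => //; exact: cvg_cst. Qed.

Lemma smooth_pair U V W (A : set U) (f : U -> V) (g : U -> W) : open A ->
  smooth_on A f -> smooth_on A g -> smooth_on A (fun x => (f x, g x)).
Proof.
move=> oA fs gs.
have := smoothD oA (smooth_lin_comp oA (@inj1_cont V W) fs)
                   (smooth_lin_comp oA (@inj2_cont V W) gs).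
by apply: smooth_ext => // x _; congr pair => /=; rewrite ?addr0 ?add0r.
Qed.

Lemma smooth_fst_comp U V W (A : set U) (f : U -> V * W) : open A ->
  smooth_on A f -> smooth_on A (fun x => (f x).1).
Proof. by move=> oA; exact: (@smooth_lin_comp _ _ _ A fst f oA (@fst_cont V W)). Qed.

Definition rvcoord n (i : 'I_n) (x : 'rV[R]_n) : R := x ord0 i.

Lemma rvcoord_linear n (i : 'I_n) : linear_for *%R (@rvcoord n i).
Proof. by move=> a x y; rewrite /rvcoord !mxE. Qed.

HB.instance Definition _ n (i : 'I_n) :=
  GRing.isLinear.Build R 'rV[R]_n R _ (@rvcoord n i) (@rvcoord_linear n i).

Lemma rvcoord_cont n (i : 'I_n) : continuous (@rvcoord n i).
Proof. exact: coord_continuous. Qed.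

Lemma fin_dimR : fin_dim R.
Proof.
exists 1%N, (fun _ => 1), (fun _ => idfun); split=> [_ x|v]; first exact: cvg_id.
by rewrite big_ord1 /= [RHS]mulr1.
Qed.

Lemma fin_dim_rV n : fin_dim 'rV[R]_n.
Proof.
exists n, (fun i => delta_mx 0 i), (fun i => @rvcoord n i); split.
  by move=> i; exact: rvcoord_cont.
by move=> v; exact: row_sum_delta.
Qed.

Lemma fin_dim_prod V W : fin_dim V -> fin_dim W -> fin_dim (V * W)%type.
Proof.
move=> [m [e [l [lc lE]]]] [k [d [j [jc jE]]]].
exists (m + k)%N, (fun i => match fintype.split i with
  inl i => (e i, 0 : W) | inr i => (0 : V, d i) end).
exists (fun i => match fintype.split i return {linear (V * W)%type -> R} with
  inl i => (l i \o fst)%FUN | inr i => (j i \o snd)%FUN end).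
split=> [i|v].
  case: (fintype.split i) => a x; apply: continuous_comp; [exact: fst_cont|exact: lc|exact: snd_cont|exact: jc].
rewrite big_split_ord /=.
under eq_bigr do rewrite (unsplitK (inl _)) /=.
under [X in _ + X]eq_bigr do rewrite (unsplitK (inr _)) /=.
rewrite [v in LHS]surjective_pairing [X in (X, _)]lE [X in (_, X)]jE.
have -> : \sum_(i < m) l i v.1 *: (e i, 0 : W) = inj1 W (\sum_i l i v.1 *: e i).
  by rewrite linear_sum; apply: eq_bigr => i _; rewrite linearZ.
have -> : \sum_(i < k) j i v.2 *: (0 : V, d i) = inj2 V (\sum_i j i v.2 *: d i).
  by rewrite linear_sum; apply: eq_bigr => i _; rewrite linearZ.
by congr pair; rewrite /= ?addr0 ?add0r.
Qed.

End SmoothMaps.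

(** * Symmetry of second derivatives *)

Section SecondDifferences.
Context {R : realType} {V : normedModType R}.
Implicit Types f : V -> R.

Lemma line_mvt f (x a : V) (s : R) :
  0 < s -> (forall t, 0 <= t -> t <= s -> differentiable f (x + t *: a)) ->
  exists t, [/\ 0 < t, t < s & f (x + s *: a) - f x = s * 'D_a f (x + t *: a)].
Proof.
move=> s0 df.
pose h (t : R) := f (x + t *: a).
have dh t : 0 <= t -> t <= s -> is_derive t 1 h ('D_a f (x + t *: a)).
  move=> t0 ts.
  have dl : is_diff t (fun t : R => x + t *: a) (fun r => r *: a).
    apply: is_diff_eq; by apply/funext => r; rewrite add0r.
  have dft := df t t0 ts.
  have dht : differentiable h t by exact: (@differentiable_comp _ _ _ _ (fun t : R => x + t *: a) f).
  apply: DeriveDef; first exact: diff_derivable.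
  rewrite deriveE // [LHS](_ : _ = ('d f (x + t *: a) \o 'd (fun t : R => x + t *: a) t) 1).
    by rewrite diff_val /= scale1r deriveE.
  by rewrite -diff_comp.
have [||t] := @MVT R h (fun t => 'D_a f (x + t *: a)) 0 s s0.
- by move=> t; rewrite in_itv /= => /andP[/ltW t0 /ltW ts]; exact: dh.
- apply: continuous_in_subspaceT => t; rewrite inE /= in_itv /= => /andP[t0 ts].
  have [dht _] := dh t t0 ts.
  by apply: differentiable_continuous; apply/derivable1_diffP.
rewrite in_itv /= => /andP[t0 ts] E; exists t; split=> //.
by move: E; rewrite /h scale0r addr0 subr0 mulrC.
Qed.

(** The function y |-> f (y + s b) - f y has, by the mean value theorem, an
    increment over s a equal to s times D_a f (. + s b) - D_a f (.) at an
    intermediate point, and the differentiability of D_a f at x evaluates this up to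
    o(s).  Differentiability of D_a f at the single point x is enough, as in the
    theorem of Young. *)
Lemma second_difference f (x a b : V) :
  (\near x, differentiable f x) -> differentiable ('D_a f) x ->
  forall e : R, 0 < e -> exists2 d : R, 0 < d & forall s, 0 < s -> s < d ->
  `|f (x + s *: a + s *: b) - f (x + s *: a) - f (x + s *: b) + f x
    - s ^+ 2 * 'D_b ('D_a f) x| <= e * s ^+ 2.
Proof.
move=> ndf dF e e0.
(* The increments t a and t a + s b, with t at most s, all have norm below s N. *)
pose N := `|a| + `|b| + 1.
have N0 : 0 < N by rewrite /N -addrA ltr_wpDl // ltr_wpDl.
pose eps := e / (2 * N).
have eps0 : 0 < eps by rewrite divr_gt0 // mulr_gt0.
have /eqaddoP /(_ eps eps0) := diff_locally dF.
move=> /nbhs_norm0P[d1 /= d10 H1].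
have /nbhs_normP[d2 /= d20 H2] := ndf.
exists (Num.min d1 d2 / N); first by rewrite divr_gt0 // lt_min d10.
move=> s s0; rewrite ltr_pdivlMr // lt_min => /andP[sN1 sN2].
have bnd t : 0 <= t -> t <= s -> `|t *: a| <= s * `|a|.
  by move=> t0 ts; rewrite normrZ ger0_norm // ler_wpM2r.
have bnd2 t : 0 <= t -> t <= s -> `|t *: a + s *: b| <= s * (`|a| + `|b|).
  move=> t0 ts; apply: le_trans (ler_normD _ _) _; rewrite mulrDr lerD // ?bnd //.
  by rewrite normrZ gtr0_norm.
have lt1 y : y <= s * (`|a| + `|b|) -> y < s * N.
  by move=> h; apply: le_lt_trans h _; rewrite ltr_pM2l // /N ltrDl.
have lt2 t : 0 <= t -> t <= s -> `|t *: a| < s * N.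
  move=> t0 ts; apply: lt1; apply: le_trans (bnd t t0 ts) _.
  by rewrite ler_pM2l // lerDl.
have lt3 t : 0 <= t -> t <= s -> `|t *: a + s *: b| < s * N.
  by move=> t0 ts; apply: lt1; exact: bnd2.
have nd h : `|h| < s * N -> differentiable f (x + h).
  by move=> hs; apply: H2 => /=; rewrite opprD addrA subrr sub0r normrN (lt_trans hs).
pose k y := f (y + s *: b) - f y.
have dk t : 0 <= t -> t <= s ->
    is_diff (x + t *: a) k
    (('d f (x + t *: a + s *: b) : V -> R) - ('d f (x + t *: a) : V -> R)).
  move=> t0 ts.
  have d3 := nd _ (lt2 t t0 ts); have d4 := nd _ (lt3 t t0 ts).
  rewrite addrA in d4.
  have dsh : is_diff (x + t *: a) (fun y => y + s *: b) id.
    by apply: is_diff_eq; apply/funext => r /=; rewrite addr0.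
  have d5 : differentiable (f \o (fun y => y + s *: b)) (x + t *: a).
    exact: (@differentiable_comp _ _ _ _ (fun y => y + s *: b) f).
  apply: DiffDef; first exact: (@differentiableB _ _ _ (f \o (fun y => y + s *: b)) f).
  rewrite [LHS](diffB d5 d3).
  have [sh1 sh2] := dsh.
  by rewrite (diff_comp sh1 d4) sh2.
have [t t0 ts|t [t0 ts E]] := @line_mvt k x a s s0.
  by have [] := dk t t0 ts.
have [dkt dktE] := dk t (ltW t0) (ltW ts).
have {}E : f (x + s *: a + s *: b) - f (x + s *: a) - f (x + s *: b) + f x =
    s * ('D_a f (x + t *: a + s *: b) - 'D_a f (x + t *: a)).
  rewrite [RHS](_ : _ = k (x + s *: a) - k x); first by rewrite /k; ring.
  rewrite E (deriveE a dkt) dktE /=.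
  rewrite !deriveE //; [exact: nd (lt2 t (ltW t0) (ltW ts))|].
  by rewrite -addrA; exact: nd (lt3 t (ltW t0) (ltW ts)).
rewrite E.
set F := 'D_a f in H1 dF *.
have HR h : `|h| < d1 -> `|F (x + h) - (F x + 'd F x h)| <= eps * `|h|.
  by move=> /H1; rewrite /= !fctE /= [h + x]addrC.
have R1 := HR _ (lt_trans (lt3 t (ltW t0) (ltW ts)) sN1).
have R2 := HR _ (lt_trans (lt2 t (ltW t0) (ltW ts)) sN1).
have dl : 'd F x (t *: a + s *: b) = 'd F x (t *: a) + s * 'd F x b.
  by rewrite linearD [X in _ + X]linearZ.
rewrite dl addrA in R1.
rewrite (deriveE b dF).
have B1 := bnd2 t (ltW t0) (ltW ts); have B2 := bnd t (ltW t0) (ltW ts).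
have B3 : eps * `|t *: a + s *: b| <= eps * (s * N).
  by rewrite ler_pM2l // ltW //; exact: lt1.
have B4 : eps * `|t *: a| <= eps * (s * N).
  by rewrite ler_pM2l // ltW //; exact: lt2 (ltW t0) (ltW ts).
have epsN : eps * (s * N) = e / 2 * s.
  by rewrite /eps; field; rewrite gt_eqF.
rewrite epsN in B3 B4.
have {}R1 := le_trans R1 B3; have {}R2 := le_trans R2 B4.
have key (X Y Z da db : R) : `|X - (Z + (da + s * db))| <= e / 2 * s ->
    `|Y - (Z + da)| <= e / 2 * s -> `|s * (X - Y) - s ^+ 2 * db| <= e * s ^+ 2.
  move=> R3 R4; have -> : s * (X - Y) - s ^+ 2 * db =
    s * ((X - (Z + (da + s * db))) - (Y - (Z + da))) by ring.
  rewrite normrM (gtr0_norm s0) expr2 mulrA [e * s]mulrC -mulrA ler_pM2l //.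
  apply: le_trans (ler_normB _ _) _.
  have -> : e * s = e / 2 * s + e / 2 * s by field.
  exact: lerD.
exact: key R1 R2.
Qed.

Let half_gap (e P Q T X A B r : R) : `|P - Q - T + X - r * A| <= e / 2 * r ->
  `|P - T - Q + X - r * B| <= e / 2 * r -> `|r * (A - B)| <= r * e.
Proof.
have -> : r * (A - B) = (P - T - Q + X - r * B) - (P - Q - T + X - r * A) by ring.
move=> h1 h2; apply: le_trans (ler_normB _ _) _.
have -> : r * e = e / 2 * r + e / 2 * r by field.
exact: lerD.
Qed.

(** The second difference is symmetric in a and b, and divided by s^2 it
    approaches both iterated derivatives. *)
Theorem derive_comm f (x a b : V) :
  (\near x, differentiable f x) ->
  differentiable ('D_a f) x -> differentiable ('D_b f) x ->
  'D_b ('D_a f) x = 'D_a ('D_b f) x.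
Proof.
move=> df da db; apply/eqP; rewrite -subr_eq0 -normr_le0; apply/ler_addgt0Pr => e e0.
have e2 : 0 < e / 2 by rewrite divr_gt0.
have [d d0 H] := second_difference b df da e2.
have [d' d'0 H'] := second_difference a df db e2.
pose s := Num.min d d' / 2.
have m0 : 0 < Num.min d d' by rewrite lt_min d0.
have s0 : 0 < s by rewrite divr_gt0.
have sm : s < Num.min d d' by rewrite /s ltr_pdivrMr // ltr_pMr // ltr1n.
move: sm; rewrite lt_min => /andP[sd sd'].
have {}H := H s s0 sd; have {}H' := H' s s0 sd'.
rewrite add0r; have ss : 0 < s ^+ 2 by rewrite exprn_gt0.
rewrite -(ler_pM2l ss) -[s ^+ 2 in leLHS](gtr0_norm ss) -normrM.
rewrite [x + s *: b + s *: a]addrAC in H'.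
exact: half_gap H H'.
Qed.

End SecondDifferences.

(** * Bump functions *)

Section Bump.
Context {R : realType}.

Lemma pow_expN_le (m : nat) (x : R) : 0 < x ->
  x ^+ m * expR (- x) <= m%:R ^+ m.
Proof.
move=> x0; rewrite expRN ler_pdivrMr ?expR_gt0 //.
case: m => [|m]; first by rewrite !expr0 mul1r ltW // -expR0 ltr_expR.
(* Compare x with m exp (x / m), which follows from 1 + y <= exp y. *)
have -> : expR x = expR (x / m.+1%:R) ^+ m.+1.
  by rewrite -expRM_natl -mulr_natl mulrC divfK // pnatr_eq0.
rewrite -exprMn; apply: lerXn2r; rewrite ?nnegrE ?(ltW x0) ?mulr_ge0 ?expR_ge0 //.
rewrite -ler_pdivrMl // mulrC; apply: le_trans (expR_ge1Dx _).
by rewrite lerDr.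
Qed.

(** The functions t^-m exp (-1/t), extended by 0: differentiating one of them
    gives a combination of two others, so that this family, unlike exp (-1/t)
    alone, supports an induction on the order of differentiability. *)
Definition flat (m : nat) (t : R) : R :=
  if 0 < t then (t^-1) ^+ m * expR (- t^-1) else 0.

(** Dividing by t, flat m is differentiable at 0 with derivative 0, for every m. *)
Lemma flat_quad m t : `|flat m t| <= (m + 2)%:R ^+ (m + 2) * t ^+ 2.
Proof.
rewrite /flat; case: ifPn => [t0|_]; last first.
  by rewrite normr0; apply: mulr_ge0; [exact: exprn_ge0|exact: sqr_ge0].
rewrite ger0_norm; last by rewrite mulr_ge0 ?expR_ge0 // exprn_ge0 // invr_ge0 ltW.
rewrite -ler_pdivrMr ?exprn_gt0 // mulrAC -exprVn -exprD.
by apply: pow_expN_le; rewrite invr_gt0.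
Qed.

Lemma diff_of_quadratic_bound (f : R -> R) (C : R) : f 0 = 0 -> (forall t, `|f t| <= C * t ^+ 2) ->
  differentiable f 0 /\ 'd f 0 = (fun _ => 0) :> (R -> R).
Proof.
move=> f0 fC.
have fE : f \o shift 0 = cst (f 0) + (\0 : R -> R) +o_ 0 id.
  apply/eqaddoP => e e0; near=> h.
  rewrite !fctE /= addr0 f0 !addr0 subr0; apply: le_trans (fC h) _.
  rewrite -real_normK ?num_real // expr2 mulrA ler_wpM2r //.
  have C0 : 0 < `|C| + 1 by rewrite ltr_wpDl.
  apply: (@le_trans _ _ ((`|C| + 1) * `|h|)).
    by rewrite ler_wpM2r // (le_trans (ler_norm _)) // lerDl.
  rewrite -ler_pdivlMl //; near: h.
  have d0 : 0 < (`|C| + 1)^-1 * e by rewrite mulr_gt0 // invr_gt0.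
  by apply: filterS (nbhs0_lt d0) => y; exact: ltW.
have d0 := @diff_unique _ _ _ f (\0 : {linear R -> R}) 0 (@cst_continuous _ _ _) fE.
by split => //; apply/diff_locallyP; rewrite d0; split => //; exact: cst_continuous.
Unshelve. all: by end_near. Qed.

Lemma flat_diff m t : differentiable (flat m) t /\
  'D_1 (flat m) t = flat m.+2 t - m%:R * flat m.+1 t.
Proof.
have [t0|t0|->] := ltgtP t 0.
- have nE : \near t, 0 = flat m t.
    near=> s; rewrite /flat ltNge ltW //=; near: s; exact: lt_nbhsl.
  have [d1 d2] := near_eq_diff nE (differentiable_cst 0 t).
  split=> //; rewrite deriveE // d2 diff_cst /flat ltNge ltW //=.
  by rewrite mulr0 subr0.
- have nE : \near t, (t^-1) ^+ m * expR (- t^-1) = flat m t.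
    near=> s; rewrite /flat ifT //; near: s; exact: lt_nbhsr.
  have di : is_derive t 1 (fun s : R => s^-1) (- t ^- 2).
    have := @is_deriveV R id t 1 1 (lt0r_neq0 t0) (is_derive_id _ _).
    by rewrite [_ *: 1]mulr1.
  have dp : is_derive (t^-1) 1 (fun s : R => s ^+ m) (m%:R * t^-1 ^+ m.-1).
    apply: DeriveDef; first exact: exprn_derivable.
    by rewrite exp_derive [_ *: 1]mulr1.
  have dq := is_derive1_comp dp di.
  have dN : is_derive t 1 (fun s : R => - s^-1) (- - t ^- 2) by exact: is_deriveN.
  have de := @is_derive1_comp R expR (fun s : R => - s^-1) t _ _ (is_derive_expR (- t^-1)) dN.
  have {dq de} [dm1 dm2] := is_deriveM dq de.
  have dm3 := (derivable1_diffP _ _).1 dm1.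
  have [d1 d2] := near_eq_diff nE dm3.
  split; first exact: d1.
  rewrite deriveE // d2 -deriveE // dm2 /flat t0 -!exprVn /GRing.scale /=.
  by case: m {dp dm1 dm2 dm3 d1 d2 nE} => [|m] /=; rewrite ?expr0 ?exprS; ring.
have f0 : flat m 0 = 0 by rewrite /flat ltxx.
have [d1 d2] := diff_of_quadratic_bound f0 (flat_quad m).
split=> //; rewrite deriveE // d2 /flat ltxx; by rewrite mulr0 subr0.
Unshelve. all: by end_near. Qed.

Lemma flat_smooth m (A : set R) : open A -> smooth_on A (flat m).
Proof.
move=> oA; apply/smooth_onP => k; elim: k m => [|k IH] m.
  by split=> // x _; case: (flat_diff m x).
split=> [x _|v]; first by case: (flat_diff m x).
have H1 := diffkD oA (IH m.+2) (diffk_smul oA (diffk_cst A k (- m%:R : R)) (IH m.+1)).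
apply: diffk_ext (diffk_smul oA (diffk_cst A k (v : R)) H1) => // x _.
have [d1 d2] := flat_diff m x.
rewrite [RHS]deriveE // -[v in RHS]mulr1 [RHS]linearZ -deriveE // d2.
by congr (_ * (_ + _)); exact: mulNr.
Qed.

(** The sum of squares is a polynomial, unlike the norm of row vectors, which
    is the maximum of the entries; bump_fun_ball compares the two. *)
Definition bump_fun n (a : 'rV[R]_n) (r : R) (x : 'rV[R]_n) : R :=
  flat 0 (r ^+ 2 - \sum_i (x ord0 i - a ord0 i) ^+ 2).

Lemma bump_fun_smooth n (a : 'rV[R]_n) r (A : set 'rV[R]_n) : open A -> smooth_on A (bump_fun a r).
Proof.
move=> oA; rewrite /bump_fun -/(flat 0 \o _).
apply: (@smooth_comp _ _ _ _ _ setT) => //; first exact: fin_dimR.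
  have sc i : smooth_on A (fun x : 'rV[R]_n => rvcoord i x + (- a ord0 i)).
    apply: smoothD => //; last exact: smooth_cst.
    by apply: smooth_linear; exact: rvcoord_cont.
  have := smoothD oA (@smooth_cst _ _ _ A (r ^+ 2 : R)) (smooth_smul oA (@smooth_cst _ _ _ A (-1 : R))
     (smooth_sum oA (fun i => smooth_smul oA (sc i) (sc i)))).
  apply: smooth_ext => // x _; congr (_ + _); rewrite [_ *: _]mulN1r.
  by congr (- _); apply: eq_bigr => i _.
by apply: flat_smooth; exact: openT.
Qed.

Lemma bump_fun_center n (a : 'rV[R]_n) r : 0 < r -> 0 < bump_fun a r a.
Proof.
move=> r0; rewrite /bump_fun big1; last by move=> i _; rewrite subrr expr0n.
by rewrite subr0 /flat exprn_gt0 // expr0 mul1r expR_gt0.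
Qed.

Lemma bump_fun_ball n (a : 'rV[R]_n) r x : 0 < r -> bump_fun a r x != 0 -> `|a - x| < r.
Proof.
move=> r0; rewrite /bump_fun /flat; case: ifPn => [h _|_]; last by rewrite eqxx.
rewrite [X in X < _]/Num.Def.normr /= mx_normrE; apply/bigmax_ltP; split=> //= -[i j] _ /=.
rewrite ord1 !mxE -(ltr_pXn2r (n := 2)) ?nnegrE ?(ltW r0) //.
rewrite real_normK ?num_real // -sqrrN opprB.
move: h; rewrite subr_gt0; apply: le_lt_trans.
by rewrite (bigD1 j) //= lerDl sumr_ge0 // => k _; exact: sqr_ge0.
Qed.

End Bump.

(** * Differentials of composites and of maps on products *)

Section DiffTools.
Context {R : realType}.
Implicit Types U V W : normedModType R.

(** The composite may agree with a known map only near the point: transition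
    maps compose to transition maps on overlaps only. *)
Lemma diff_near_comp U V W (f : U -> V) (g : V -> W) (h : U -> W) x v :
  differentiable f x -> differentiable g (f x) -> differentiable h x ->
  (\near x, h x = g (f x)) -> 'd g (f x) ('d f x v) = 'd h x v.
Proof.
move=> df dg dh nE; have [_ hE] := near_eq_diff (g := g \o f) nE dh.
have E := diff_comp df dg; rewrite hE in E.
exact: (esym (congr1 (fun k : U -> W => k v) E)).
Qed.

Lemma diff_compE U V W (f : U -> V) (g : V -> W) x v :
  differentiable f x -> differentiable g (f x) ->
  'd (g \o f) x v = 'd g (f x) ('d f x v).
Proof. by move=> df dg; exact: (congr1 (fun k : U -> W => k v) (diff_comp df dg)). Qed.

Lemma diff_near_id U (f : U -> U) x v :
  (\near x, f x = x) -> 'd f x v = v.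
Proof.
move=> nE; have nE' : \near x, id x = f x by apply: filterS nE => y ->.
by have [_ ->] := near_eq_diff nE' (ex_diff (f := id)); rewrite diff_val.
Qed.

Lemma diff_fst_comp U V W (F : U -> V * W) (z w : U) :
  differentiable F z -> 'd (fun z => (F z).1) z w = ('d F z w).1.
Proof.
move=> dF.
have df : differentiable (fst : V * W -> V) (F z) by apply: linear_differentiable; exact: fst_cont.
have := diff_comp dF df; rewrite [fst \o F](_ : _ = fun z => (F z).1) // => ->.
by rewrite /= (diff_lin _ (@fst_cont R V W)).
Qed.

Lemma diff_fst_fun U V W (f : U -> V) (z w : (U * W)%type) :
  differentiable f (z.1 : U) ->
  'd (fun z : (U * W)%type => f z.1) z w = 'd f (z.1 : U) w.1.
Proof.
move=> df.
have d1 : differentiable (fst : U * W -> U) z by apply: linear_differentiable; exact: fst_cont.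
by have := diff_comp d1 df; rewrite /comp => ->; rewrite (diff_lin _ (@fst_cont R U W)).
Qed.

Lemma diff_vert U V W (F : (U * W)%type -> V) (x : U) (y v : W) :
  differentiable F (x, y) ->
  differentiable (fun y => F (x, y)) y /\ 'd F (x, y) (0, v) = 'd (fun y => F (x, y)) y v.
Proof.
move=> dF.
have [d1 d2] : is_diff y (fun y : W => (x, y)) (fun y => (0 : U, y)).
  by apply: is_diff_eq.
split; first exact: (differentiable_comp d1 dF).
by have := diff_comp d1 dF; rewrite d2 /comp => ->.
Qed.

Lemma diff_cst_lin_pair U V W (a : V) (l : {linear U -> W}) (y v : U) : continuous l ->
  'd (fun y => (a, l y)) y v = (0, l v).
Proof.
move=> lc; have dl : differentiable l y by exact: linear_differentiable.
have dc : differentiable (fun _ : U => a) y by exact: differentiable_cst.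
by have := diff_pair dc dl => ->; rewrite (diff_cst a) (diff_lin _ lc).
Qed.

End DiffTools.

(** * Transition maps of the manifold and of its tangent bundle *)

Section Charts.
(* Restores inv as the inverse of a chart. *)
Import Defs.
Context {R : realType} {n : nat} {M : manifold R n}.
Implicit Types (c d e : chart R n M) (p : M) (u : TM M).

(** Coordinate changes x |-> x' and their Jacobians; below, Trans and dTrans are
    those of the induced charts (x, y) of the tangent bundle. *)
Definition trans c d : 'rV[R]_n -> 'rV[R]_n := co d \o inv c.
Definition dtrans c d (x : 'rV[R]_n) : 'rV[R]_n -> 'rV[R]_n := 'd (trans c d) x.
Definition overlap c d : set 'rV[R]_n := co c @` (dom c `&` dom d).

Lemma chart_at_atlas p : atlas (chart_at p).
Proof. exact: (s2valP (cid2 (atlas_cover p))). Qed.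

Lemma chart_at_dom p : dom (chart_at p) p.
Proof. exact: (s2valP' (cid2 (atlas_cover p))). Qed.

Lemma inv_dom c x : (co c @` dom c) x -> dom c (inv c x).
Proof. by move=> [p cp <-]; rewrite coK. Qed.

Lemma co_inv c x : (co c @` dom c) x -> co c (inv c x) = x.
Proof. by move=> [p cp <-]; rewrite coK. Qed.

Lemma overlapP c d x : overlap c d x <-> (co c @` dom c) x /\ dom d (inv c x).
Proof.
split=> [[p [cp dp] <-]|[cx dx]]; first by rewrite coK //; split=> //; exists p.
by exists (inv c x); [split=> //; exact: inv_dom|exact: co_inv].
Qed.

Lemma inv_cont_at c x : (co c @` dom c) x -> continuous_at (x : 'rV[R]_n) (inv c).
Proof.
move=> cx; have := @inv_cont _ _ _ c.
rewrite continuous_open_subspace; last exact: ran_open.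
by apply; rewrite inE.
Qed.

Lemma overlap_open c d : open (overlap c d).
Proof.
rewrite openE => x /overlapP[cx dx]; rewrite /interior /=.
have h1 : \forall y \near x, (co c @` dom c) y.
  by apply: open_nbhs_nbhs; split=> //; exact: ran_open.
have h2 : \forall y \near x, dom d (inv c y).
  apply: (inv_cont_at cx); apply: open_nbhs_nbhs; split=> //; exact: dom_open.
by near=> y; apply/overlapP; split; near: y.
Unshelve. all: by end_near. Qed.

Lemma overlap_co c d p : dom c p -> dom d p -> overlap c d (co c p).
Proof. by move=> cp dp; exists p. Qed.

Lemma trans_smooth c d : atlas c -> atlas d -> smooth_on (overlap c d) (trans c d).
Proof. exact: atlas_compat. Qed.

Lemma inv_trans c d x : overlap c d x -> inv d (trans c d x) = inv c x.
Proof. by move=> /overlapP[cx dx]; rewrite /trans /= coK. Qed.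

Lemma trans_diff c d x : atlas c -> atlas d -> overlap c d x ->
  differentiable (trans c d) x.
Proof. by move=> ca da; apply: smooth_diff; exact: trans_smooth. Qed.

Lemma near_overlap c d x : overlap c d x -> \forall y \near x, overlap c d y.
Proof. by move=> cdx; apply: open_nbhs_nbhs; split=> //; exact: overlap_open. Qed.

Lemma trans_comp c d e x : overlap c d x -> trans d e (trans c d x) = trans c e x.
Proof. by move=> cdx; rewrite {1}/trans /= inv_trans. Qed.

(** The cocycle rule for Jacobians.  The components of tangent vectors
    transform by them, so the independence of a construction from the chart comes
    down to this rule and to diff_Trans_comp. *)
Lemma diff_trans_comp c d e x v : atlas c -> atlas d -> atlas e ->
  overlap c d x -> overlap c e x ->
  dtrans d e (trans c d x) (dtrans c d x v) = dtrans c e x v.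
Proof.
move=> ca da ea cdx cex.
have dex : overlap d e (trans c d x).
  apply: overlap_co; [exact: ((overlapP c d x).1 cdx).2|exact: ((overlapP c e x).1 cex).2].
rewrite /dtrans; apply: diff_near_comp (trans_diff ca da cdx) (trans_diff da ea dex) (trans_diff ca ea cex) _.
by near=> y; rewrite trans_comp //; near: y; exact: near_overlap.
Unshelve. all: by end_near. Qed.

Lemma trans_id c x : (co c @` dom c) x -> trans c c x = x.
Proof. exact: co_inv. Qed.

Lemma diff_trans_id c x v : (co c @` dom c) x -> dtrans c c x v = v.
Proof.
move=> cx; rewrite /dtrans.
apply: diff_near_id; near=> y; rewrite trans_id //.
near: y; apply: open_nbhs_nbhs; split=> //; exact: ran_open.
Unshelve. all: by end_near. Qed.

Definition Trans c d (z : 'rV[R]_n * 'rV[R]_n) : 'rV[R]_n * 'rV[R]_n :=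
  (trans c d z.1, dtrans c d z.1 z.2).
Definition dTrans c d (z : 'rV[R]_n * 'rV[R]_n) :
  'rV[R]_n * 'rV[R]_n -> 'rV[R]_n * 'rV[R]_n := 'd (Trans c d) z.
Definition Overlap c d : set ('rV[R]_n * 'rV[R]_n) := [set z | overlap c d z.1].

Lemma Overlap_open c d : open (Overlap c d).
Proof.
apply: (open_comp (f := fst)); last exact: overlap_open.
by move=> z _; exact: fst_cont.
Qed.

(** The second component is sum_i y^i d_i (trans c d), whose coefficients are
    again smooth. *)
Lemma Trans_smooth c d : atlas c -> atlas d -> smooth_on (Overlap c d) (Trans c d).
Proof.
move=> ca da; have oA := @Overlap_open c d; have oB := @overlap_open c d.
have fs : smooth_on (Overlap c d) (fst : 'rV[R]_n * 'rV[R]_n -> 'rV[R]_n).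
  by apply: smooth_linear; exact: fst_cont.
have ts := trans_smooth ca da.
apply: smooth_pair => //.
  by apply: (@smooth_comp _ _ _ _ _ (overlap c d) fst) => //; exact: fin_dim_rV.
have H i : smooth_on (Overlap c d)
    (fun z => rvcoord i z.2 *: 'D_(delta_mx 0 i) (trans c d) z.1).
  apply: smooth_smul => //.
    apply: (@smooth_lin_comp _ _ _ _ _ (rvcoord i) snd) => //; first exact: rvcoord_cont.
    by apply: smooth_linear; exact: snd_cont.
  apply: (@smooth_comp _ _ _ _ _ (overlap c d) fst ('D_(delta_mx 0 i) (trans c d))) => //.
    exact: fin_dim_rV.
  exact: smooth_derive.
have := smooth_sum oA H; apply: smooth_ext => // z cdz.
rewrite /dtrans [in RHS](row_sum_delta z.2) linear_sum; apply: eq_bigr => i _.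
by rewrite linearZ /= deriveE //; exact: trans_diff.
Qed.

Lemma Trans_diff c d z : atlas c -> atlas d -> Overlap c d z ->
  differentiable (Trans c d) z.
Proof. by move=> ca da; apply: smooth_diff; exact: Trans_smooth. Qed.

Lemma near_Overlap c d z : Overlap c d z -> \forall y \near z, Overlap c d y.
Proof. by move=> cdz; apply: open_nbhs_nbhs; split=> //; exact: Overlap_open. Qed.

Lemma Trans_comp c d e z : atlas c -> atlas d -> atlas e ->
  Overlap c d z -> Overlap c e z -> Trans d e (Trans c d z) = Trans c e z.
Proof.
move=> ca da ea cdz cez.
exact: (congr2 pair (trans_comp e cdz) (diff_trans_comp z.2 ca da ea cdz cez)).
Qed.

Lemma Trans_overlap c d e z : Overlap c d z -> Overlap c e z -> Overlap d e (Trans c d z).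
Proof.
move=> /overlapP[cz dz] /overlapP[_ ez]; exact: overlap_co.
Qed.

Lemma diff_Trans_comp c d e z w : atlas c -> atlas d -> atlas e ->
  Overlap c d z -> Overlap c e z ->
  dTrans d e (Trans c d z) (dTrans c d z w) = dTrans c e z w.
Proof.
move=> ca da ea cdz cez.
rewrite /dTrans; apply: diff_near_comp (Trans_diff ca da cdz)
  (Trans_diff da ea (Trans_overlap cdz cez)) (Trans_diff ca ea cez) _.
by near=> y; rewrite Trans_comp //; near: y; exact: near_Overlap.
Unshelve. all: by end_near. Qed.

Lemma Trans_id c z : (co c @` dom c) z.1 -> Trans c c z = z.
Proof. by case: z => x y cx; rewrite /Trans /= trans_id // diff_trans_id. Qed.

Lemma Overlap_id c z : (co c @` dom c) z.1 -> Overlap c c z.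
Proof. by move=> cz; apply/overlapP; split=> //; exact: inv_dom. Qed.

Lemma diff_Trans_id c z w : (co c @` dom c) z.1 -> dTrans c c z w = w.
Proof.
move=> cz; rewrite /dTrans.
apply: diff_near_id; near=> y; rewrite Trans_id //.
have : Overlap c c y by near: y; apply: near_Overlap; exact: Overlap_id.
by case/overlapP.
Unshelve. all: by end_near. Qed.

(** Tangent vectors of the tangent bundle change charts through the first
    component as their projections do: rho does not depend on the chart. *)
Lemma diff_Trans1 c d z w : atlas c -> atlas d -> Overlap c d z ->
  (dTrans c d z w).1 = dtrans c d z.1 w.1.
Proof.
move=> ca da cdz; rewrite /dTrans -(diff_fst_comp w (Trans_diff ca da cdz)).
exact: (diff_fst_fun (f := trans c d) (z := z) w (trans_diff ca da cdz)).
Qed.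

(** A vertical vector stays vertical in another chart, and its component changes
    as that of a tangent vector of the base: gamma does not depend on the chart. *)
Lemma diff_TransV c d z v : atlas c -> atlas d -> Overlap c d z ->
  dTrans c d z (0, v) = (0, dtrans c d z.1 v).
Proof.
rewrite /dTrans /dtrans.
move=> ca da cdz; have dT := Trans_diff ca da cdz.
case: z cdz dT => x y /= cdx dT; have [_ ->] := diff_vert v dT; rewrite /Trans /=.
have lc : continuous ('d (trans c d) x) by exact: diff_continuous (trans_diff ca da cdx).
exact: diff_cst_lin_pair lc.
Qed.

Lemma tco_tinv c d z : atlas c -> atlas d -> Overlap c d z -> tco d (tinv c z) = Trans c d z.
Proof.
move=> ca da cdz; rewrite /tco /tinv /Trans /=; congr pair.
rewrite -[LHS]/(dtrans _ _ _ (dtrans _ _ _ _)).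
have [cz dz] := (overlapP c d z.1).1 cdz.
have cez : overlap c (chart_at (inv c z.1)) z.1.
  by apply/overlapP; split=> //; exact: chart_at_dom.
rewrite -[co (chart_at _) _]/(trans c (chart_at (inv c z.1)) z.1).
by apply: diff_trans_comp => //; exact: chart_at_atlas.
Qed.

Lemma tinv_tco c u : atlas c -> dom c u.1 -> tinv c (tco c u) = u.
Proof.
case: u => p y /= ca cp.
have ep := chart_at_dom p; have ea := chart_at_atlas p.
have o1 : overlap (chart_at p) c (co (chart_at p) p) by exact: overlap_co.
have o2 : overlap (chart_at p) (chart_at p) (co (chart_at p) p) by exact: overlap_co.
have E : trans (chart_at p) c (co (chart_at p) p) = co c p by rewrite /trans /= coK.
have := diff_trans_comp y ea ca ea o1 o2.
rewrite E diff_trans_id; last by exists p.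
by rewrite /tinv /tco /= coK // => h; congr pair.
Qed.

Lemma tco_Overlap c d u : dom c u.1 -> dom d u.1 -> Overlap c d (tco c u).
Proof. by move=> cu du; exact: overlap_co. Qed.

Lemma tco_Trans c d u : atlas c -> atlas d -> dom c u.1 -> dom d u.1 ->
  tco d u = Trans c d (tco c u).
Proof.
by move=> ca da cu du; rewrite -tco_tinv ?tinv_tco //; exact: tco_Overlap.
Qed.

Lemma tinv_Trans c d z : atlas c -> atlas d -> Overlap c d z ->
  tinv d (Trans c d z) = tinv c z.
Proof.
by move=> ca da cdz; rewrite -tco_tinv // tinv_tco //; exact: ((overlapP c d z.1).1 cdz).2.
Qed.

Lemma tco_chart_at u : tco (chart_at u.1) u = (co (chart_at u.1) u.1, u.2).
Proof.
rewrite /tco; congr pair; rewrite -[LHS]/(dtrans _ _ _ _) diff_trans_id //.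
by exists u.1 => //; exact: chart_at_dom.
Qed.

Lemma components_chart_at p v : components (chart_at p) p v = v.
Proof.
rewrite -[LHS]/(dtrans _ _ _ _) diff_trans_id //.
by exists p => //; exact: chart_at_dom.
Qed.

End Charts.

(** * Derivatives on the tangent bundle, and cut-offs *)

Section TangentCalculus.
Import Defs.
Context {R : realType} {n : nat} {M : manifold R n}.
Implicit Types (c d e : chart R n M) (p : M) (u : TM M) (w : TTM R n).
Local Notation V := 'rV[R]_n.

Lemma diff_trans_inj c d x v : atlas c -> atlas d -> overlap c d x ->
  dtrans c d x v = 0 -> v = 0.
Proof.
move=> ca da cdx v0; have [cx _] := (overlapP c d x).1 cdx.
have ccx : overlap c c x by apply/overlapP; split=> //; exact: inv_dom.
have := diff_trans_comp v ca da ca cdx ccx.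
by rewrite v0 diff_trans_id // {1}/dtrans linear0 => <-.
Qed.

Lemma components_inj c p v : atlas c -> dom c p -> components c p v = 0 -> v = 0.
Proof.
move=> ca cp; apply: diff_trans_inj => //; first exact: chart_at_atlas.
by apply: overlap_co => //; exact: chart_at_dom.
Qed.

Lemma components0 c p : components c p 0 = 0.
Proof. exact: linear0. Qed.

Lemma components_surj c p v : atlas c -> dom c p -> exists v', components c p v' = v.
Proof.
move=> ca cp; set e := chart_at p.
have ec : overlap c e (co c p) by apply: overlap_co => //; exact: chart_at_dom.
have cc : overlap c c (co c p) by exact: overlap_co.
exists (dtrans c e (co c p) v); rewrite -[LHS]/(dtrans _ _ _ _).
have := diff_trans_comp v ca (chart_at_atlas p) ca ec cc.
by rewrite diff_trans_id; [rewrite {1}/trans /= coK|exists p].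
Qed.

Lemma tran_open c : open (tran c).
Proof.
have -> : tran c = fst @^-1` (co c @` dom c) `&` (snd @^-1` (~` [set 0])).
  apply/seteqP; split=> z [/= cz z0]; split => //=; exact/eqP.
apply: openI; apply: open_comp.
- by move=> z _; exact: fst_cont.
- exact: ran_open.
- by move=> z _; exact: snd_cont.
- apply: closed_openC; exact: (accessible_closed_set1 (hausdorff_accessible (@norm_hausdorff _ _))).
Qed.

Lemma slit_tinv c z : atlas c -> tran c z -> slit (tinv c z).
Proof.
move=> ca [cz z0]; apply: contra z0 => /eqP /= /(diff_trans_inj ca (chart_at_atlas _)) -> //.
by apply/overlapP; split=> //; exact: chart_at_dom.
Qed.

Lemma tran_tco c u : atlas c -> dom c u.1 -> slit u -> tran c (tco c u).
Proof.
move=> ca cu u0; split; first by exists u.1.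
by apply: contra u0 => /eqP /(components_inj ca cu) ->.
Qed.

Lemma dom_tinv c z : tran c z -> dom c (tinv c z).1.
Proof. by case=> cz _; exact: inv_dom. Qed.

Lemma tran_Overlap_id c z : tran c z -> Overlap c c z.
Proof. by case=> cz _; apply/overlapP; split=> //; exact: inv_dom. Qed.

Lemma tcoK c z : atlas c -> tran c z -> tco c (tinv c z) = z.
Proof.
move=> ca cz; rewrite tco_tinv //; first by rewrite Trans_id //; case: cz.
exact: tran_Overlap_id.
Qed.

Lemma near_tran c z : tran c z -> \forall y \near z, tran c y.
Proof. by move=> cz; apply: open_nbhs_nbhs; split=> //; exact: tran_open. Qed.

Lemma Overlap_chart_at u d : dom d u.1 -> Overlap (chart_at u.1) d (tco (chart_at u.1) u).
Proof. by move=> du; apply: tco_Overlap => //; exact: chart_at_dom. Qed.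

Lemma tder_tco u w d : atlas d -> dom d u.1 ->
  tder u w (tco d) = dTrans (chart_at u.1) d (tco (chart_at u.1) u) w.
Proof.
move=> da du; have o := Overlap_chart_at du; have ca := chart_at_atlas u.1.
have nE : \forall z \near tco (chart_at u.1) u,
    Trans (chart_at u.1) d z = (tco d \o tinv (chart_at u.1)) z.
  by near=> z; rewrite /= tco_tinv //; near: z; exact: near_Overlap.
have [_ E] := near_eq_diff nE (Trans_diff ca da o).
exact: (congr1 (fun k : V * V -> V * V => k w) E).
Unshelve. all: by end_near. Qed.

Lemma tder_tco1 u w d : atlas d -> dom d u.1 -> (tder u w (tco d)).1 = components d u.1 w.1.
Proof.
move=> da du; rewrite tder_tco //.
exact: (diff_Trans1 w (chart_at_atlas u.1) da (Overlap_chart_at du)).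
Qed.

Lemma tder_tcoV u v d : atlas d -> dom d u.1 ->
  tder u (gamma v) (tco d) = (0, components d u.1 v).
Proof.
move=> da du; rewrite tder_tco //.
exact: (diff_TransV v (chart_at_atlas u.1) da (Overlap_chart_at du)).
Qed.

(** The derivative of a function along a vector may be computed in any chart
    around the point. *)
Lemma tder_chart (W : normedModType R) (F : TM M -> W) u w d : atlas d -> dom d u.1 ->
  differentiable (F \o tinv d) (tco d u) ->
  differentiable (F \o tinv (chart_at u.1)) (tco (chart_at u.1) u) /\
  tder u w F = 'd (F \o tinv d) (tco d u) (tder u w (tco d)).
Proof.
move=> da du dF; have o := Overlap_chart_at du; have ca := chart_at_atlas u.1.
have tE : tco d u = Trans (chart_at u.1) d (tco (chart_at u.1) u).
  by apply: tco_Trans => //; exact: chart_at_dom.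
rewrite tE in dF *.
have dT := Trans_diff ca da o.
have nE : \forall z \near tco (chart_at u.1) u,
    ((F \o tinv d) \o Trans (chart_at u.1) d) z = (F \o tinv (chart_at u.1)) z.
  by near=> z; rewrite /= tinv_Trans //; near: z; exact: near_Overlap.
have dc := differentiable_comp dT dF.
have [dF' E] := near_eq_diff nE dc; split; first exact: dF'.
have nE' : \forall z \near tco (chart_at u.1) u,
    (F \o tinv (chart_at u.1)) z = (F \o tinv d) (Trans (chart_at u.1) d z).
  exact: filterS (fun z oz => congr1 F (esym (tinv_Trans ca da oz))) (near_Overlap o).
have h := diff_near_comp w dT dF dF' nE'; have h0 := tder_tco w da du.
exact: (etrans (esym h) (congr1 (fun w' => 'd (F \o tinv d)
  (Trans (chart_at u.1) d (tco (chart_at u.1) u)) w') (esym h0))).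
Unshelve. all: by end_near. Qed.

Lemma tderZ (W : normedModType R) (F : TM M -> W) u (a : R) w :
  tder u (a *: w) F = a *: tder u w F.
Proof. exact: linearZ. Qed.

Lemma smooth_local (U W : normedModType R) (A : set U) (f : U -> W) :
  (forall x, A x -> exists2 B : set U, B x & smooth_on B f) -> smooth_on A f.
Proof. by move=> loc vs x /loc[B Bx fs]; exact: fs. Qed.

Lemma closed_ball_in_chart c p : dom c p -> exists2 r : R, 0 < r &
  forall x, `|co c p - x| <= r -> (co c @` dom c) x.
Proof.
move=> cp.
have /nbhs_normP[r /= r0 H] : nbhs (co c p) (co c @` dom c).
  by apply: open_nbhs_nbhs; split; [exact: ran_open|exists p].
exists (r / 2); first by rewrite divr_gt0.
move=> x xr; apply: H => /=; apply: le_lt_trans xr _.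
by rewrite ltr_pdivrMr // ltr_pMr // ltr1n.
Qed.

(** The closed ball on which the bump function lives is compact, so its image is
    compact, and closed because the manifold is Hausdorff; a point outside the chart
    thus has a neighbourhood that misses it. *)
Lemma cutoff_far c (x0 : 'rV[R]_n) r p : 0 < r ->
  (forall x, `|x0 - x| <= r -> (co c @` dom c) x) -> ~ dom c p ->
  \forall q \near p, dom c q -> bump_fun x0 r (co c q) = 0.
Proof.
move=> r0 rc pc.
pose K := inv c @` [set x | `|x0 - x| <= r].
have Kc : compact K.
  apply: continuous_compact.
    apply: continuous_in_subspaceT => x; rewrite inE => /= xr.
    by apply: inv_cont_at; exact: rc.
  apply: bounded_closed_compact.
    exists (`|x0| + r); split; first by rewrite num_real.
    move=> m mr x /= xr; apply: le_trans (ltW mr).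
    rewrite -[x](subrK x0) addrC; apply: le_trans (ler_normD _ _) _.
    by rewrite lerD2l distrC.
  rewrite (_ : mkset _ = (fun x => `|x0 - x|) @^-1` [set y : R | y <= r]) //.
  apply: closed_comp; last exact: closed_le.
  move=> x _; apply: continuous_comp; last exact: norm_continuous.
  by apply: (@continuousB _ _ _ (cst x0) id); [exact: cst_continuous|exact: cvg_id].
have Kcl := compact_closed (@manifold_hausdorff _ _ M) Kc.
have pK : (~` K) p.
  by move=> [x /= xr xp]; apply: pc; rewrite -xp; apply: inv_dom; exact: rc.
have : nbhs p (~` K) by apply: open_nbhs_nbhs; split=> //; exact: closed_openC.
apply: filterS => q qK cq; apply/eqP/negPn/negP => b0; apply: qK.
by exists (co c q); [exact: ltW (bump_fun_ball r0 b0)|exact: coK].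
Qed.

(** Near a point of the chart c the function is a product of smooth functions; near
    any other point it vanishes identically by cutoff_far. *)
Lemma smooth_cutoff c d (x0 : 'rV[R]_n) r (W : normedModType R) (F : TM M -> W)
    (K : V * V -> W) : atlas c -> atlas d -> 0 < r ->
  (forall x, `|x0 - x| <= r -> (co c @` dom c) x) ->
  smooth_on (tran d `&` Overlap d c) K ->
  (forall z, tran d z -> dom c (inv d z.1) ->
     F (tinv d z) = bump_fun x0 r (co c (inv d z.1)) *: K z) ->
  (forall z, tran d z -> ~ dom c (inv d z.1) -> F (tinv d z) = 0) ->
  smooth_on (tran d) (F \o tinv d).
Proof.
move=> ca da r0 rc Ks FE FE0; apply: smooth_local => z dz.
have [cz|cz] := pselect (dom c (inv d z.1)).
  exists (tran d `&` Overlap d c); first by split=> //; apply/overlapP; split=> //; case: dz.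
  have oB : open (tran d `&` Overlap d c) by apply: openI; [exact: tran_open|exact: Overlap_open].
  have bs : smooth_on (tran d `&` Overlap d c) (fun z => bump_fun x0 r (trans d c z.1)).
    apply: (@smooth_comp _ _ _ _ _ setT (fun z => trans d c z.1) (bump_fun x0 r)) => //.
    - exact: fin_dim_rV.
    - apply: (@smooth_comp _ _ _ _ _ (overlap d c) fst (trans d c)) => //.
      + exact: fin_dim_rV.
      + by move=> y [].
      + by apply: smooth_linear; exact: fst_cont.
      + exact: trans_smooth.
    - by apply: bump_fun_smooth; exact: openT.
  apply: smooth_ext (smooth_smul oB bs Ks) => // y [dy /overlapP[_ cy]].
  by rewrite /= FE.
have far := cutoff_far r0 rc cz.
pose P y := tran d y /\ (dom c (inv d y.1) -> bump_fun x0 r (co c (inv d y.1)) = 0).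
have nP : nbhs z P.
  apply: filterI; first exact: near_tran.
  have iz : {for z, continuous (inv d \o fst)}.
    apply: continuous_comp; first exact: fst_cont.
    by apply: inv_cont_at; case: dz.
  exact: iz far.
exists P^°; first exact: nbhs_singleton (nbhs_interior nP).
apply: (@smooth_ext _ _ P^° _ _ (fun _ => 0)); last exact: smooth_cst.
  exact: open_interior.
move=> y /interior_subset [dy b0].
have [cy|cy] := pselect (dom c (inv d y.1)); last by rewrite /= FE0.
by rewrite /= FE // b0 // scale0r.
Qed.

End TangentCalculus.

(** * Local frames and global sections *)

Section Frames.
Import Defs.
Context {R : realType} {n : nat} {M : manifold R n}.
Implicit Types (c d e : chart R n M) (p : M) (u : TM M) (w : TTM R n).
Local Notation V := 'rV[R]_n.

(** A constant coordinate field of the chart c, cut off; its components are those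
    in the chart attached to u. *)
Definition bump_field c (x0 : 'rV[R]_n) (r : R) (a : TTM R n) u : TTM R n :=
  if `[< dom c u.1 >] then
    bump_fun x0 r (co c u.1) *: dTrans c (chart_at u.1) (tco c u) a
  else 0.

Lemma tder_bump_field c d x0 r a u : atlas c -> atlas d -> dom d u.1 -> dom c u.1 ->
  tder u (bump_field c x0 r a u) (tco d) = bump_fun x0 r (co c u.1) *: dTrans c d (tco c u) a.
Proof.
move=> ca da du cu; rewrite /bump_field asboolT //.
rewrite tderZ; congr (_ *: _).
have ea := chart_at_atlas u.1; have eu := chart_at_dom u.1.
have h := tder_tco (dTrans c (chart_at u.1) (tco c u) a) da du.
apply: etrans h _; rewrite (tco_Trans ca ea cu eu).
by apply: diff_Trans_comp => //; exact: tco_Overlap.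
Qed.

Lemma tder_bump_field0 c d x0 r a u : ~ dom c u.1 ->
  tder u (bump_field c x0 r a u) (tco d) = 0.
Proof. by move=> cu; rewrite /bump_field asboolF //; exact: linear0. Qed.

Lemma bump_field_smooth c x0 r a : atlas c -> 0 < r ->
  (forall x, `|x0 - x| <= r -> (co c @` dom c) x) ->
  smooth_vfield (bump_field c x0 r a).
Proof.
move=> ca r0 rc d da.
apply: (smooth_cutoff (c := c) (x0 := x0) (r := r)
   (K := fun z => dTrans c d (Trans d c z) a)) => //.
- have oB : open (tran d `&` Overlap d c) by apply: openI; [exact: tran_open|exact: Overlap_open].
  apply: (@smooth_ext _ _ (tran d `&` Overlap d c) oB _ ('D_a (Trans c d) \o Trans d c)).
    move=> z [dz dcz]; rewrite /= deriveE //; apply: Trans_diff => //.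
    by apply: Trans_overlap => //; exact: tran_Overlap_id.
  apply: (@smooth_comp _ _ _ _ _ (Overlap c d)) => //.
  - exact: fin_dim_prod (fin_dim_rV _) (fin_dim_rV _).
  - by move=> z [dz dcz]; apply: Trans_overlap => //; exact: tran_Overlap_id.
  - by apply: smooth_sub (Trans_smooth da ca) => z [].
  - by apply: smooth_derive; exact: Trans_smooth.
- move=> z dz cz; apply: etrans (tder_bump_field x0 r a ca da (dom_tinv dz) cz) _.
  have o : Overlap d c z by apply/overlapP; split; [case: dz|].
  exact: (congr1 (fun y => _ *: dTrans c d y a) (tco_tinv da ca o)).
- by move=> z dz cz; exact: (@tder_bump_field0 c d x0 r a (tinv d z) cz).
Qed.

(** Global fields that form, up to the common factor b, the coordinate frame of the
    chart c.  The factor vanishes away from p, which makes the fields extend by 0. *)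
Lemma local_frame c p : atlas c -> dom c p ->
  exists (b : 'rV[R]_n -> R) (P : TTM R n -> TM M -> TTM R n),
  [/\ 0 < b (co c p), smooth_on setT b, forall a, smooth_vfield (P a) &
      forall a u, dom c u.1 -> tder u (P a u) (tco c) = b (co c u.1) *: a].
Proof.
move=> ca cp; have [r r0 rc] := closed_ball_in_chart cp.
exists (bump_fun (co c p) r), (bump_field c (co c p) r); split.
- exact: bump_fun_center.
- by apply: bump_fun_smooth; exact: openT.
- by move=> a; exact: bump_field_smooth.
- move=> a u cu; apply: etrans (tder_bump_field _ _ _ ca ca cu cu) _.
  by rewrite diff_Trans_id //; exists u.1.
Qed.

Lemma smooth_rho (X : TM M -> TTM R n) : smooth_vfield X -> smooth_section (@rho R n \o X).
Proof.
move=> Xs c ca; have := smooth_fst_comp (tran_open (c := c)) (Xs c ca).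
apply: smooth_ext; first exact: tran_open.
by move=> z cz /=; rewrite tder_tco1 //; exact: dom_tinv.
Qed.

Lemma smooth_lift_v (Y : TM M -> 'rV[R]_n) : smooth_section Y -> smooth_vfield (lift_v Y).
Proof.
move=> Ys c ca; have := smooth_pair (tran_open (c := c)) (@smooth_cst _ _ _ _ (0 : 'rV[R]_n)) (Ys c ca).
apply: smooth_ext; first exact: tran_open.
by move=> z cz /=; rewrite /lift_v tder_tcoV //; exact: dom_tinv.
Qed.

Lemma smooth_section0 : smooth_section (fun _ : TM M => 0 : 'rV[R]_n).
Proof.
move=> c ca; apply: (@smooth_ext _ _ _ _ _ (fun _ => 0)); first exact: tran_open.
  by move=> z _ /=; rewrite components0.
exact: smooth_cst.
Qed.

Lemma smooth_fund : smooth_section (@fund R n M).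
Proof.
move=> c ca; apply: (@smooth_ext _ _ _ _ _ snd); first exact: tran_open.
  by move=> z cz; have /(congr1 snd) /= := tcoK ca cz.
by apply: smooth_linear; exact: snd_cont.
Qed.

Lemma smooth_section_ext (Y Z : TM M -> 'rV[R]_n) :
  (forall u, slit u -> Y u = Z u) -> smooth_section Y -> smooth_section Z.
Proof.
move=> YZ Ys c ca; apply: smooth_ext (Ys c ca); first exact: tran_open.
by move=> z cz /=; rewrite YZ //; exact: slit_tinv.
Qed.

(** Every vector at a point is the value of a smooth section, so identities
    quantified over sections yield identities between vectors. *)
Lemma section_through u v : exists2 Y : TM M -> 'rV[R]_n, smooth_section Y & Y u = v.
Proof.
have ca := chart_at_atlas u.1; have cu := chart_at_dom u.1.
have [b [P [b0 _ Ps PE]]] := local_frame ca cu.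
exists (@rho R n \o P ((b (co (chart_at u.1) u.1))^-1 *: v, 0)); first exact: smooth_rho.
have h1 := PE ((b (co (chart_at u.1) u.1))^-1 *: v, 0) u cu.
have := tder_tco1 (P ((b (co (chart_at u.1) u.1))^-1 *: v, 0) u) ca cu.
rewrite h1 components_chart_at /= => h2; apply: etrans (esym h2) _.
by rewrite scalerA mulfV ?scale1r // gt_eqF.
Qed.

(** A smooth function for the atlas of the slit bundle, as it is constant
    there.  Multiplying a section by it forgets the values on the zero section. *)
Definition slit_ind u : R := if u.2 == 0 then 0 else 1.

Lemma slit_ind_smooth : smooth_fun slit_ind.
Proof.
move=> c ca; apply: (@smooth_ext _ _ _ _ _ (fun _ => 1 : R)); first exact: tran_open.
  by move=> z cz; rewrite /= /slit_ind (negPf (slit_tinv ca cz)).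
exact: smooth_cst.
Qed.

Lemma tder_slit_cst (W : normedModType R) (F : TM M -> W) u w (a : W) : slit u ->
  (forall u', slit u' -> F u' = a) -> tder u w F = 0.
Proof.
move=> u0 Fa; have ca := chart_at_atlas u.1.
have nE : \forall z \near tco (chart_at u.1) u, a = (F \o tinv (chart_at u.1)) z.
  have := near_tran (tran_tco ca (chart_at_dom u.1) u0).
  by apply: filterS => z cz; rewrite /= Fa //; exact: slit_tinv.
have [_ E] := near_eq_diff nE (differentiable_cst a _).
have := congr1 (fun k : V * V -> W => k w) E; rewrite diff_cst; exact.
Qed.

End Frames.

(** * Linear connections and their horizontal maps *)

Section ConnectionBasics.
Import Defs.
Context {R : realType} {n : nat} {M : manifold R n}.
Implicit Types (u : TM M) (w : TTM R n) (Y Z : TM M -> 'rV[R]_n).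
Variable D : cov_deriv M.
Hypothesis Dc : is_connection D.

Lemma cov_lin u a w w' Y : slit u -> smooth_section Y ->
  D u (a *: w + w') Y = a *: D u w Y + D u w' Y.
Proof. by case: Dc => + _ _ _; exact. Qed.

Lemma cov0l u Y : slit u -> smooth_section Y -> D u 0 Y = 0.
Proof.
move=> u0 Ys; have := cov_lin 1 0 0 u0 Ys; rewrite scaler0 addr0 scale1r => /eqP.
by rewrite -[X in X == _]addr0 (inj_eq (addrI _)) eq_sym => /eqP.
Qed.

Lemma covDl u w w' Y : slit u -> smooth_section Y -> D u (w + w') Y = D u w Y + D u w' Y.
Proof. by move=> u0 Ys; have := cov_lin 1 w w' u0 Ys; rewrite !scale1r. Qed.

Lemma covZl u a w Y : slit u -> smooth_section Y -> D u (a *: w) Y = a *: D u w Y.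
Proof. by move=> u0 Ys; rewrite -[a *: w]addr0 cov_lin // cov0l // addr0. Qed.

Lemma covNl u w Y : slit u -> smooth_section Y -> D u (- w) Y = - D u w Y.
Proof. by move=> u0 Ys; rewrite -scaleN1r covZl // scaleN1r. Qed.

Lemma cov_suml u m (w : 'I_m -> TTM R n) Y : slit u -> smooth_section Y ->
  D u (\sum_i w i) Y = \sum_i D u (w i) Y.
Proof.
move=> u0 Ys; elim: m w => [|m IH] w; first by rewrite !big_ord0 cov0l.
by rewrite !big_ord_recl covDl // IH.
Qed.

(** By the Leibniz rule Y and slit_ind Y have the same derivative, and
    slit_ind Y = slit_ind Z everywhere. *)
Lemma cov_slit u w Y Z : slit u -> smooth_section Y -> smooth_section Z ->
  (forall u, slit u -> Y u = Z u) -> D u w Y = D u w Z.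
Proof.
move=> u0 Ys Zs YZ; case: Dc => _ _ leib _.
have key X : smooth_section X -> D u w X = D u w (fun u => slit_ind u *: X u).
  move=> Xs; rewrite leib //; last exact: slit_ind_smooth.
  rewrite (@tder_slit_cst _ _ _ _ _ _ _ (1 : R)) //; last by move=> u' /negPf; rewrite /slit_ind => ->.
  by rewrite scale0r add0r /slit_ind (negPf u0) scale1r.
rewrite (key Y Ys) (key Z Zs); congr (D u w _); apply/funext => u'.
by rewrite /slit_ind; case: ifPn => [_|/YZ ->]; rewrite ?scale0r.
Qed.

Lemma cov_zero u w : slit u -> D u w (fun _ => 0) = 0.
Proof.
move=> u0; case: Dc => _ addi _ _.
have := addi u w _ _ u0 smooth_section0 smooth_section0.
rewrite (_ : (fun _ => 0 + 0) = (fun _ => 0)); last by apply/funext => x; exact: addr0.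
by move=> /eqP; rewrite -[X in X == _]addr0 (inj_eq (addrI _)) eq_sym => /eqP.
Qed.

Lemma cov_smooth (X : TM M -> TTM R n) Y : smooth_vfield X -> smooth_section Y ->
  smooth_section (fun u => D u (X u) Y).
Proof. by case: Dc => _ _ _; exact. Qed.

Hypothesis Dr : regular D.

Lemma hor_map_spec u v : slit u -> conn_map D u (hor_map D u v) = 0 /\ rho (hor_map D u v) = v.
Proof.
move=> u0; have [dec _] := Dr u0; have [a [h [a0 h0 E]]] := dec (v, 0).
rewrite /hor_map; case: xgetP => [w _ //|no].
case: (no h); split=> //; have := congr1 fst E => /= ->.
by rewrite -[a.1]/(rho a) a0 add0r.
Qed.

Lemma hor_map_unique u w v : slit u -> conn_map D u w = 0 -> rho w = v -> hor_map D u v = w.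
Proof.
move=> u0 w0 wv; have [h0 hv] := hor_map_spec v u0.
have [_ inj] := Dr u0; apply/eqP; rewrite -subr_eq0; apply/eqP; apply: inj.
  by rewrite /rho /= -/(rho _) hv -wv subrr.
rewrite /conn_map covDl ?covNl //; try exact: smooth_fund.
by rewrite -/(conn_map D u _) h0 -/(conn_map D u _) w0 subrr.
Qed.

End ConnectionBasics.

(** * Differentiability of determinants and of inverse matrices *)

Section DiffAlgebra.
Context {R : realType} {U : normedModType R}.
Variable z : U.

Lemma diff_bigsum (I : Type) (r : seq I) (P : pred I) (F : I -> U -> R) :
  (forall i, differentiable (F i) z) ->
  differentiable (fun y => \sum_(i <- r | P i) F i y) z.
Proof.
move=> dF; elim: r => [|i r IH].
  rewrite (_ : (fun _ => _) = fun _ => 0); first exact: differentiable_cst.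
  by apply/funext => y; rewrite big_nil.
rewrite (_ : (fun _ => _) = fun y => (if P i then F i y else 0) + \sum_(j <- r | P j) F j y).
  by case: (P i); apply: differentiableD => //; exact: differentiable_cst.
by apply/funext => y; rewrite big_cons; case: (P i); rewrite ?add0r.
Qed.

Lemma diff_bigprod (I : Type) (r : seq I) (P : pred I) (F : I -> U -> R) :
  (forall i, differentiable (F i) z) ->
  differentiable (fun y => \prod_(i <- r | P i) F i y) z.
Proof.
move=> dF; elim: r => [|i r IH].
  rewrite (_ : (fun _ => _) = fun _ => 1); first exact: differentiable_cst.
  by apply/funext => y; rewrite big_nil.
rewrite (_ : (fun _ => _) = fun y => (if P i then F i y else 1) * \prod_(j <- r | P j) F j y).
  by case: (P i); apply: differentiableM => //; exact: differentiable_cst.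
by apply/funext => y; rewrite big_cons; case: (P i); rewrite ?mul1r.
Qed.

Lemma diff_det m (A : U -> 'M[R]_m) :
  (forall i j, differentiable (fun y => A y i j) z) ->
  differentiable (fun y => \det (A y)) z.
Proof.
move=> dA; rewrite /determinant; apply: diff_bigsum => s.
apply: (@differentiableM _ _ (fun _ => (-1) ^+ perm.odd_perm s)); first exact: differentiable_cst.
by apply: diff_bigprod => i; exact: dA.
Qed.

(** By Cramer's rule, the entries are quotients of determinants. *)
Lemma diff_invmx m (A : U -> 'M[R]_m) :
  (forall i j, differentiable (fun y => A y i j) z) -> A z \in unitmx ->
  (\forall y \near z, A y \in unitmx) ->
  forall i j, differentiable (fun y => invmx (A y) i j) z.
Proof.
move=> dA uA nA i j.
have dd := diff_det dA.
have d0 : \det (A z) != 0 by rewrite -unitfE -unitmxE.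
have dc : differentiable (fun y => cofactor (A y) j i) z.
  apply: (@differentiableM _ _ (fun _ => (-1) ^+ (j + i))); first exact: differentiable_cst.
  apply: diff_det => k l.
  rewrite (_ : (fun _ => _) = fun y => A y (lift j k) (lift i l)); first exact: dA.
  by apply/funext => y; rewrite !mxE.
have nE : \forall y \near z, (\det (A y))^-1 * cofactor (A y) j i = invmx (A y) i j.
  by apply: filterS nA => y uy; rewrite /invmx uy !mxE.
by have [] := near_eq_diff nE (differentiableM (differentiableV dd d0) dc).
Qed.

Lemma diff_row m (f : U -> 'rV[R]_m) :
  (forall j, differentiable (fun y => f y ord0 j) z) -> differentiable f z.
Proof.
move=> df; rewrite (_ : f = \sum_(j < m) (fun y => f y ord0 j *: delta_mx 0 j)).
  apply: differentiable_sum => j.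
  by have [] := is_diff_smul (df j) (differentiable_cst (delta_mx 0 j : 'rV[R]_m) z).
by apply/funext => y; rewrite fct_sumE; exact: row_sum_delta.
Qed.

Lemma diff_coord m (f : U -> 'rV[R]_m) j :
  differentiable f z -> differentiable (fun y => f y ord0 j) z.
Proof.
move=> df; apply: (@differentiable_comp _ _ _ _ f (@rvcoord _ _ j)) => //.
by apply: linear_differentiable; exact: rvcoord_cont.
Qed.

End DiffAlgebra.

(** * Differentiability of the horizontal lift *)

Section HorizontalLift.
Import Defs.
Context {R : realType} {n : nat} {M : manifold R n}.
Implicit Types (u : TM M) (w : TTM R n) (Y Z : TM M -> 'rV[R]_n).
Variable D : cov_deriv M.
Hypothesis Dc : is_connection D.
Hypothesis Dr : regular D.

Lemma components_sum (c : chart R n M) p m (a : 'I_m -> R) (v : 'I_m -> 'rV[R]_n) :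
  components c p (\sum_i a i *: v i) = \sum_i a i *: components c p (v i) :> 'rV[R]_n.
Proof. by rewrite /components linear_sum; apply: eq_bigr => i _; rewrite linearZ. Qed.

Lemma tder_sum (W : normedModType R) (F : TM M -> W) u m (a : 'I_m -> R) (w : 'I_m -> TTM R n) :
  tder u (\sum_i a i *: w i) F = \sum_i a i *: tder u (w i) F.
Proof. by rewrite /tder linear_sum; apply: eq_bigr => i _; rewrite linearZ. Qed.

(** On ker K the vertical components of a vector are determined by its horizontal
    ones: with the values k_i and the rows of A of the connection map on the
    horizontal and vertical frame fields, K = 0 is a linear system with matrix A, and
    A is invertible because D is regular. *)
Lemma lift_h_coords (c : chart R n M) p : atlas c -> dom c p ->
  exists (b : 'rV[R]_n -> R) (A : 'rV[R]_n * 'rV[R]_n -> 'M[R]_n)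
    (k : 'I_n -> 'rV[R]_n * 'rV[R]_n -> 'rV[R]_n),
  [/\ 0 < b (co c p), smooth_on setT b,
      (forall z, tran c z -> forall i j, differentiable (fun y => A y i j) z) /\
      (forall z, tran c z -> forall i, differentiable (k i) z),
      forall z, tran c z -> b z.1 != 0 -> A z \in unitmx &
      forall z Y, tran c z -> b z.1 != 0 ->
        let y := components c (tinv c z).1 (Y (tinv c z)) in
        tder (tinv c z) (lift_h D Y (tinv c z)) (tco c) =
        (y, - ((\sum_i y ord0 i *: k i z) *m invmx (A z)))].
Proof.
move=> ca cp; have [b [P [b0 bs Ps PE]]] := local_frame ca cp.
pose E i := P (delta_mx 0 i, 0); pose E' i := P (0, delta_mx 0 i).
pose K (X : TM M -> TTM R n) z : 'rV[R]_n :=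
  components c (tinv c z).1 (D (tinv c z) (X (tinv c z)) (@fund R n M)).
have Kd X z : smooth_vfield X -> tran c z -> differentiable (K X) z.
  move=> Xs cz; have := cov_smooth Dc Xs (@smooth_fund R n M) ca.
  by move=> /smooth_diff; exact.
pose A z := \matrix_i K (E' i) z.
exists b, A, (fun i => K (E i)).
have PEt a z : tran c z -> tder (tinv c z) (P a (tinv c z)) (tco c) = b z.1 *: a.
  move=> cz; apply: etrans (PE a _ (dom_tinv cz)) _; congr (b _ *: _).
  by rewrite /= co_inv //; case: cz.
have unit z : tran c z -> b z.1 != 0 -> A z \in unitmx.
  move=> cz bz; rewrite -row_free_unit; apply/inj_row_free => v vA.
  have sz := slit_tinv ca cz.
  pose w := \sum_i v ord0 i *: E' i (tinv c z).
  have wt : tder (tinv c z) w (tco c) = (0, b z.1 *: v).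
    apply: etrans (tder_sum _ _ _ _) _.
    transitivity (\sum_i v ord0 i *: (b z.1 *: inj2 'rV[R]_n (delta_mx 0 i : 'rV[R]_n))).
      by apply: eq_bigr => i _; rewrite /E' PEt.
    transitivity (inj2 'rV[R]_n (b z.1 *: v)); last by [].
    rewrite [in RHS](row_sum_delta v) scaler_sumr linear_sum; apply: eq_bigr => i _.
    by congr pair; [rewrite /= !scaler0|rewrite /= !scalerA mulrC].
  have w1 : rho w = 0.
    apply: (components_inj ca (dom_tinv cz)); rewrite -(tder_tco1 w ca (dom_tinv cz)).
    by rewrite wt.
  have wK : conn_map D (tinv c z) w = 0.
    apply: (components_inj ca (dom_tinv cz)).
    rewrite /conn_map cov_suml //; last exact: smooth_fund.
    rewrite (eq_bigr (fun i => v ord0 i *: D (tinv c z) (E' i (tinv c z)) (@fund R n M))); last first.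
      by move=> i _; rewrite covZl //; exact: smooth_fund.
    rewrite components_sum -[RHS]vA; apply/rowP => j; rewrite summxE !mxE.
    by apply: eq_bigr => i _; rewrite !mxE.
  have [_ inj] := Dr sz; have w0 := inj w w1 wK.
  move: wt; rewrite w0 => wt.
  have : b z.1 *: v = 0.
    have := congr1 snd wt => /= <-; rewrite (_ : tder _ 0 _ = 0) //; exact: linear0.
  by move/eqP; rewrite scaler_eq0 (negPf bz) /= => /eqP.
split=> //.
- split=> z cz.
    move=> i j; have := diff_coord j (Kd _ _ (Ps (0, delta_mx 0 i)) cz).
    rewrite (_ : (fun y => A y i j) = fun y => K (E' i) y ord0 j); first exact.
    by apply/funext => y; rewrite mxE.
  by move=> i; apply: Kd => //; exact: Ps.
move=> z Y cz bz y; have sz := slit_tinv ca cz; have Az := unit z cz bz.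
pose r : 'rV[R]_n := \sum_i y ord0 i *: K (E i) z.
pose t := r *m invmx (A z).
(* The vertical coefficients - t solve the linear system K w = 0. *)
pose w := \sum_i ((b z.1)^-1 * y ord0 i) *: E i (tinv c z) +
          \sum_i (- ((b z.1)^-1 * t ord0 i)) *: E' i (tinv c z).
have wt : tder (tinv c z) w (tco c) = (y, - t).
  apply: etrans (linearD _ _ _) _.
  transitivity (inj1 'rV[R]_n y + inj2 'rV[R]_n (- t)); last first.
    by congr pair => /=; rewrite ?addr0 ?add0r.
  congr (_ + _); apply: etrans (tder_sum _ _ _ _) _.
    rewrite [in RHS](row_sum_delta y) linear_sum; apply: eq_bigr => i _.
    rewrite /E PEt // scalerA mulrAC mulVf // mul1r linearZ.
    by congr (_ *: _).
  rewrite [in RHS](row_sum_delta t) -sumrN linear_sum; apply: eq_bigr => i _.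
  rewrite /E' PEt // scalerA mulNr mulrAC mulVf // mul1r -scaleNr linearZ.
  by congr (_ *: _).
have w1 : rho w = Y (tinv c z).
  apply/eqP; rewrite -subr_eq0; apply/eqP.
  apply: (components_inj ca (dom_tinv cz)); rewrite /components linearB /=.
  rewrite -/(components _ _ _) -/(components _ _ _).
  by rewrite -(tder_tco1 w ca (dom_tinv cz)) wt /= subrr.
have wK : conn_map D (tinv c z) w = 0.
  apply: (components_inj ca (dom_tinv cz)).
  have fs := @smooth_fund R n M.
  rewrite /conn_map covDl // !cov_suml //.
  rewrite (eq_bigr (fun i => ((b z.1)^-1 * y ord0 i) *: D (tinv c z) (E i (tinv c z)) (@fund R n M))); last first.
    by move=> i _; rewrite covZl.
  rewrite [X in _ + X](eq_bigr (fun i => (- ((b z.1)^-1 * t ord0 i)) *: D (tinv c z) (E' i (tinv c z)) (@fund R n M))); last first.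
    by move=> i _; rewrite covZl.
  rewrite /components linearD /= -!/(components _ _ _) !components_sum.
  transitivity ((b z.1)^-1 *: (r - t *m A z)).
    rewrite scalerBr; congr (_ + _).
      by rewrite scaler_sumr; apply: eq_bigr => i _; rewrite scalerA.
    rewrite -scalerN -mulNmx mulmx_sum_row scaler_sumr; apply: eq_bigr => i _.
    by rewrite scalerA rowK; congr (_ *: _); rewrite [in RHS]mxE mulrN.
  by rewrite mulmxKV // subrr scaler0.
by rewrite /lift_h (hor_map_unique Dc Dr sz wK w1).
Qed.

(** The coordinates found in lift_h_coords are quotients of differentiable
    functions, with a denominator that does not vanish near the point. *)
Lemma lift_h_diff Y u : slit u -> smooth_section Y ->
  differentiable ((fun u' => tder u' (lift_h D Y u') (tco (chart_at u.1))) \o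
     tinv (chart_at u.1)) (tco (chart_at u.1) u).
Proof.
move=> u0 Ys; set c := chart_at u.1.
have ca : atlas c by exact: chart_at_atlas.
have cu : dom c u.1 by exact: chart_at_dom.
have [b [A [k [b0 bs [dA dk] Au E]]]] := lift_h_coords ca cu.
set z := tco c u.
have cz : tran c z by exact: tran_tco.
have bc : {for z, continuous (fun z : 'rV[R]_n * 'rV[R]_n => b z.1)}.
  apply: continuous_comp; first exact: fst_cont.
  by apply: differentiable_continuous; exact: smooth_diff bs _.
have nb : \forall y \near z, tran c y /\ b y.1 != 0.
  apply: filterI; first exact: near_tran.
  have : nbhs (b z.1) [set x | x != 0].
    have : nbhs (b z.1) [set x | 0 < x] by exact: lt_nbhsr.
    by apply: filterS => x /= x0; rewrite gt_eqF.
  exact: bc.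
pose y x := components c (tinv c x).1 (Y (tinv c x)).
have dy : differentiable y z by have := Ys c ca => /smooth_diff; exact.
pose r x : 'rV[R]_n := \sum_i y x ord0 i *: k i x.
have dr j : differentiable (fun x => r x ord0 j) z.
  rewrite (_ : (fun _ => _) = fun x => \sum_i y x ord0 i * k i x ord0 j); last first.
    by apply/funext => x; rewrite summxE; apply: eq_bigr => i _; rewrite mxE.
  apply: diff_bigsum => i.
  by apply: (@differentiableM _ _ (fun x => y x ord0 i)); apply: diff_coord => //; exact: dk.
have zb : b z.1 != 0 by rewrite gt_eqF.
have nA : \forall x \near z, A x \in unitmx.
  by apply: filterS nb => x [cx bx]; exact: Au.
have di := diff_invmx (dA z cz) (Au z cz zb) nA.
have dt : differentiable (fun x => - (r x *m invmx (A x))) z.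
  apply: diff_row => j.
  rewrite (_ : (fun _ => _) = fun x => - \sum_i r x ord0 i * invmx (A x) i j); last first.
    by apply/funext => x; rewrite !mxE.
  apply: differentiableN; apply: diff_bigsum => i.
  by apply: (@differentiableM _ _ (fun x => r x ord0 i)).
have nE : \forall x \near z, (y x, - (r x *m invmx (A x))) =
    ((fun u' => tder u' (lift_h D Y u') (tco c)) \o tinv c) x.
  by apply: filterS nb => x [cx bx]; exact: esym (E x Y cx bx).
by have [] := near_eq_diff nE (differentiable_pair dy dt).
Qed.

End HorizontalLift.

(** * The flat derivative and the torsions *)

Section FlatDerivative.
Import Defs.
Context {R : realType} {n : nat} {M : manifold R n}.
Implicit Types (u : TM M) (w : TTM R n) (X Y Z : TM M -> 'rV[R]_n).

(** The components of a section in the chart attached to the base point of u, kept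
    fixed while the argument moves. *)
Definition home_components u Y : 'rV[R]_n * 'rV[R]_n -> 'rV[R]_n :=
  (fun u' => components (chart_at u.1) u'.1 (Y u')) \o tinv (chart_at u.1).

(** The derivative of Y along w for the connection that is trivial in the chart
    attached to u. *)
Definition flat_deriv u w Y : 'rV[R]_n := 'd (home_components u Y) (tco (chart_at u.1) u) w.

Lemma home_tran u : slit u -> tran (chart_at u.1) (tco (chart_at u.1) u).
Proof. by move=> u0; apply: tran_tco; [exact: chart_at_atlas|exact: chart_at_dom|]. Qed.

Lemma home_components_diff u Y : slit u -> smooth_section Y ->
  differentiable (home_components u Y) (tco (chart_at u.1) u).
Proof.
move=> u0 Ys; have := Ys _ (chart_at_atlas u.1) => /smooth_diff; apply; exact: home_tran.
Qed.

Lemma flat_deriv_lin u a w w' Y : flat_deriv u (a *: w + w') Y = a *: flat_deriv u w Y + flat_deriv u w' Y.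
Proof. exact: linearP. Qed.

Lemma flat_derivD u w w' Y : flat_deriv u (w + w') Y = flat_deriv u w Y + flat_deriv u w' Y.
Proof. exact: linearD. Qed.

Lemma near_slit u (P : 'rV[R]_n * 'rV[R]_n -> Prop) : slit u ->
  (forall z, tran (chart_at u.1) z -> P z) -> \forall z \near tco (chart_at u.1) u, P z.
Proof. by move=> u0 H; apply: filterS (near_tran (home_tran u0)) => z; exact: H. Qed.

Lemma flat_deriv_slit u w Y Z : slit u -> smooth_section Y ->
  (forall u', slit u' -> Y u' = Z u') -> flat_deriv u w Y = flat_deriv u w Z.
Proof.
move=> u0 Ys YZ.
have nE : \forall z \near tco (chart_at u.1) u, home_components u Y z = home_components u Z z.
  apply: near_slit => // z cz; rewrite /home_components /= YZ //.
  by apply: slit_tinv => //; exact: chart_at_atlas.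
have [_ E] := near_eq_diff nE (home_components_diff u0 Ys).
exact: (congr1 (fun k : _ -> _ => k w) (esym E)).
Qed.

Lemma flat_deriv_zero u w : slit u -> flat_deriv u w (fun _ => 0) = 0.
Proof.
move=> u0; rewrite /flat_deriv (_ : home_components u (fun _ => 0) = cst 0); first by rewrite diff_cst.
by apply/funext => z; rewrite /home_components /= components0.
Qed.

Lemma flat_deriv_fund u w : slit u -> flat_deriv u w (@fund R n M) = w.2.
Proof.
move=> u0; have ca := chart_at_atlas u.1.
have ds : differentiable (snd : 'rV[R]_n * 'rV[R]_n -> 'rV[R]_n) (tco (chart_at u.1) u).
  by apply: linear_differentiable; exact: snd_cont.
have nE : \forall z \near tco (chart_at u.1) u, z.2 = home_components u (@fund R n M) z.
  by apply: near_slit => // z cz; have /(congr1 snd) := tcoK ca cz.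
have [_ E] := near_eq_diff nE ds.
rewrite /flat_deriv; have := congr1 (fun k : _ -> _ => k w) E => /= ->.
by rewrite (diff_lin _ (@snd_cont R _ _)).
Qed.

(** The regularity under which the bracket can be computed.  It is weaker than
    smoothness of the field, since it has to be established for horizontal lifts. *)
Definition home_diff u (X : TM M -> TTM R n) : Prop :=
  differentiable ((fun u' => tder u' (X u') (tco (chart_at u.1))) \o tinv (chart_at u.1))
     (tco (chart_at u.1) u).

Lemma smooth_home_diff u (X : TM M -> TTM R n) : slit u -> smooth_vfield X -> home_diff u X.
Proof. by move=> u0 /(_ _ (chart_at_atlas u.1)) /smooth_diff; apply; exact: home_tran. Qed.

Lemma tder_tder1 u w (Y : TM M -> TTM R n) : slit u -> home_diff u Y ->
  (tder u w (fun u' => tder u' (Y u') (tco (chart_at u.1)))).1 = flat_deriv u w (@rho R n \o Y).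
Proof.
move=> u0 dY; have ca := chart_at_atlas u.1.
have h := diff_fst_comp w dY; apply: etrans (esym h) _.
have dfst x : differentiable (fst : 'rV[R]_n * 'rV[R]_n -> 'rV[R]_n) x.
  by apply: linear_differentiable; exact: fst_cont.
have df := differentiable_comp dY (dfst _).
have nE : \forall z \near tco (chart_at u.1) u,
   (((fun u' => tder u' (Y u') (tco (chart_at u.1))) \o tinv (chart_at u.1)) z).1
   = home_components u (@rho R n \o Y) z.
  apply: near_slit => // z cz; rewrite /home_components /=.
  by apply: tder_tco1 => //; exact: dom_tinv.
have [_ E] := near_eq_diff nE df.
exact: (congr1 (fun k : _ -> _ => k w) (esym E)).
Qed.

(** The base components of a field in the fixed chart are the components of its
    projection by rho, so the flat connection has zero torsion. *)
Lemma rho_bracket u (X Y : TM M -> TTM R n) : slit u -> home_diff u X -> home_diff u Y ->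
  rho (bracket X Y u) = flat_deriv u (X u) (@rho R n \o Y) - flat_deriv u (Y u) (@rho R n \o X).
Proof.
move=> u0 dX dY.
exact: (congr2 (fun a b => a - b) (tder_tder1 (X u) u0 dY) (tder_tder1 (Y u) u0 dX)).
Qed.

Variable D : cov_deriv M.
Hypothesis Dc : is_connection D.
Hypothesis Dr : regular D.

Lemma rho_lift_h Y u : slit u -> (@rho R n \o lift_h D Y) u = Y u.
Proof. by move=> u0; exact: (hor_map_spec Dr (Y u) u0).2. Qed.

Lemma rho_lift_v Y : (@rho R n \o lift_v Y) = fun _ : TM M => 0.
Proof. by []. Qed.

Lemma smooth_rho_lift_h Y : smooth_section Y -> smooth_section (@rho R n \o lift_h D Y).
Proof. by apply: smooth_section_ext => u u0; rewrite rho_lift_h. Qed.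

Lemma cov_rho_lift_h u w Y : slit u -> smooth_section Y ->
  D u w (@rho R n \o lift_h D Y) = D u w Y.
Proof.
move=> u0 Ys; apply: (cov_slit Dc) => //; first exact: smooth_rho_lift_h.
by move=> u' u'0; exact: rho_lift_h.
Qed.

Lemma flat_deriv_rho_lift_h u w Y : slit u -> smooth_section Y ->
  flat_deriv u w (@rho R n \o lift_h D Y) = flat_deriv u w Y.
Proof.
move=> u0 Ys; apply/esym; apply: flat_deriv_slit => // u' u'0; by rewrite rho_lift_h.
Qed.

(** As rho (gamma X) = 0, two of the four terms vanish. *)
Lemma torsion_hvE X Y u : slit u -> smooth_section X -> smooth_section Y ->
  torsion_hv D X Y u = D u (gamma (X u)) Y - flat_deriv u (gamma (X u)) Y.
Proof.
move=> u0 Xs Ys.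
have dX := smooth_home_diff u0 (smooth_lift_v Xs).
have dY : home_diff u (lift_h D Y) by exact: lift_h_diff.
rewrite /torsion_hv /torsion (rho_bracket u0 dX dY) rho_lift_v cov_zero // flat_deriv_zero //.
by rewrite cov_rho_lift_h // flat_deriv_rho_lift_h // !subr0.
Qed.

Lemma torsion_hhE X Y u : slit u -> smooth_section X -> smooth_section Y ->
  torsion_hh D X Y u = (D u (lift_h D X u) Y - flat_deriv u (lift_h D X u) Y)
    - (D u (lift_h D Y u) X - flat_deriv u (lift_h D Y u) X).
Proof.
move=> u0 Xs Ys.
have dX : home_diff u (lift_h D X) by exact: lift_h_diff.
have dY : home_diff u (lift_h D Y) by exact: lift_h_diff.
rewrite /torsion_hh /torsion (rho_bracket u0 dX dY).
rewrite (cov_rho_lift_h (lift_h D X u) u0 Ys) (cov_rho_lift_h (lift_h D Y u) u0 Xs).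
rewrite (flat_deriv_rho_lift_h (lift_h D X u) u0 Ys) (flat_deriv_rho_lift_h (lift_h D Y u) u0 Xs).
have key (a b c d : 'rV[R]_n) : a - b - (c - d) = (a - c) - (b - d).
  by rewrite !opprB [d - c]addrC addrACA [- b + d]addrC.
exact: key.
Qed.

End FlatDerivative.

(** * Second derivatives as a bilinear form *)

Section SecondDerivatives.
Context {R : realType} {U : normedModType R} {n : nat}.
Variables (A : set U) (f : U -> R) (l : {linear 'rV[R]_n -> U}).
Hypotheses (oA : open A) (fs : smooth_on A f).
Implicit Types (x v : U) (a b : 'rV[R]_n).

(** The argument l selects the directions of differentiation: the identity gives
    the second derivatives on a fibre, the inclusion inj2 of the fibre directions gives
    those of a function on a chart of the tangent bundle. *)
Definition hess x a b : R := 'D_(l a) ('D_(l b) f) x.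

Lemma derive_smooth_lin (g : U -> R) x v (k : R) v' : smooth_on A g -> A x ->
  'D_(k *: v + v') g x = k * 'D_v g x + 'D_v' g x.
Proof.
move=> gs Ax; have dg := smooth_diff gs Ax.
by rewrite !deriveE // linearP.
Qed.

Lemma derive_smooth_sum (g : U -> R) x a : smooth_on A g -> A x ->
  'D_(l a) g x = \sum_i a ord0 i * 'D_(l (delta_mx 0 i)) g x.
Proof.
move=> gs Ax; have dg := smooth_diff gs Ax.
rewrite deriveE // [in LHS](row_sum_delta a) !linear_sum; apply: eq_bigr => i _.
by rewrite !linearZ deriveE.
Qed.

Lemma hess_sum x a b : A x ->
  hess x a b = \sum_i \sum_j a ord0 i * b ord0 j * hess x (delta_mx 0 i) (delta_mx 0 j).
Proof.
move=> Ax; rewrite /hess (derive_smooth_sum a (smooth_derive _ fs) Ax).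
apply: eq_bigr => i _.
have -> : 'D_(l (delta_mx 0 i)) ('D_(l b) f) x =
    'D_(l (delta_mx 0 i)) (fun y => \sum_j b ord0 j *: 'D_(l (delta_mx 0 j)) f y) x.
  apply: near_eq_derive; apply: (open_near oA Ax) => y Ay.
  exact: derive_smooth_sum.
have -> : (fun y => \sum_j b ord0 j *: 'D_(l (delta_mx 0 j)) f y) =
    \sum_j (b ord0 j \*: 'D_(l (delta_mx 0 j)) f).
  by apply/funext => y; rewrite fct_sumE.
have dj j : derivable ('D_(l (delta_mx 0 j)) f) x (l (delta_mx 0 i)).
  by apply: diff_derivable; exact: smooth_diff (smooth_derive _ fs) Ax.
rewrite derive_sum; last by move=> j; exact: derivableZ.
rewrite mulr_sumr; apply: eq_bigr => j _.
by rewrite deriveZ // mulrA.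
Qed.

Lemma hess_smooth a b : smooth_on A (fun x => hess x a b).
Proof. exact: smooth_derive (smooth_derive _ fs). Qed.

Lemma hess_sym x a b : A x -> hess x a b = hess x b a.
Proof.
move=> Ax; apply: derive_comm.
- by apply: (open_near oA Ax) => y Ay; exact: smooth_diff fs Ay.
- exact: smooth_diff (smooth_derive _ fs) Ax.
- exact: smooth_diff (smooth_derive _ fs) Ax.
Qed.

Lemma hess_linl x k a a' b : A x -> hess x (k *: a + a') b = k * hess x a b + hess x a' b.
Proof.
by move=> Ax; rewrite /hess linearP /= (derive_smooth_lin _ _ _ (smooth_derive _ fs)).
Qed.

Lemma dhess_sum x v a b : A x -> 'D_v (fun y => hess y a b) x =
  \sum_i \sum_j a ord0 i * b ord0 j * 'D_v (fun y => hess y (delta_mx 0 i) (delta_mx 0 j)) x.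
Proof.
move=> Ax.
pose h i j y := hess y (delta_mx 0 i) (delta_mx 0 j).
have dh i j : derivable (h i j) x v.
  by apply: diff_derivable; exact: smooth_diff (hess_smooth _ _) Ax.
have nE : \forall y \near x, hess y a b = (\sum_i \sum_j ((a ord0 i * b ord0 j) \*: h i j)) y.
  apply: (open_near oA Ax) => y Ay.
  by rewrite fct_sumE hess_sum //; apply: eq_bigr => i _; rewrite fct_sumE.
apply: etrans (near_eq_derive v nE) _.
apply: etrans (derive_sum _) _; first by move=> i; apply: derivable_sum => j; exact: derivableZ.
apply: eq_bigr => i _.
apply: etrans (derive_sum _) _; first by move=> j; exact: derivableZ.
by apply: eq_bigr => j _; exact: deriveZ.
Qed.

(** The form is a finite sum of coordinate products with smooth coefficients, so
    the product rule applies. *)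
Lemma hess_leibniz (Y Z : U -> 'rV[R]_n) x v : A x -> differentiable Y x -> differentiable Z x ->
  differentiable (fun y => hess y (Y y) (Z y)) x /\
  'D_v (fun y => hess y (Y y) (Z y)) x =
  'D_v (fun y => hess y (Y x) (Z x)) x + hess x ('D_v Y x) (Z x) + hess x (Y x) ('D_v Z x).
Proof.
move=> Ax dY dZ.
pose h i j y := hess y (delta_mx 0 i) (delta_mx 0 j).
have dh i j : differentiable (h i j) x by exact: smooth_diff (hess_smooth _ _) Ax.
pose Yi i y := Y y ord0 i; pose Zj j y := Z y ord0 j.
have dYi i : differentiable (Yi i) x by exact: diff_coord.
have dZj j : differentiable (Zj j) x by exact: diff_coord.
have DYi i : 'D_v (Yi i) x = ('D_v Y x) ord0 i.
  by rewrite derive_mx; [rewrite mxE|exact: diff_derivable].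
have DZj j : 'D_v (Zj j) x = ('D_v Z x) ord0 j.
  by rewrite derive_mx; [rewrite mxE|exact: diff_derivable].
(* The summands of the form in coordinates. *)
pose t i j := Yi i * Zj j * h i j.
have dt i j : differentiable (t i j) x.
  by apply: differentiableM => //; exact: differentiableM.
have nE : \forall y \near x, (\sum_i \sum_j t i j) y = hess y (Y y) (Z y).
  apply: (open_near oA Ax) => y Ay.
  by rewrite fct_sumE hess_sum //; apply: eq_bigr => i _; rewrite fct_sumE.
have ds : differentiable (\sum_i \sum_j t i j) x.
  by apply: differentiable_sum => i; exact: differentiable_sum.
have [d1 _] := near_eq_diff nE ds; split; first exact: d1.
have dsum i : differentiable (\sum_j t i j) x by exact: differentiable_sum.
apply: etrans (esym (near_eq_derive v nE)) _.
apply: etrans (derive_sum _) _; first by move=> i; exact: diff_derivable (dsum i).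
rewrite dhess_sum // (hess_sum ('D_v Y x)) // (hess_sum (Y x)) //.
rewrite -!big_split; apply: eq_bigr => i _.
apply: etrans (derive_sum _) _; first by move=> j; exact: diff_derivable (dt i j).
rewrite -!big_split; apply: eq_bigr => j _.
have dYx := diff_derivable (v := v) (dYi i); have dZx := diff_derivable (v := v) (dZj j).
have dhx := diff_derivable (v := v) (dh i j).
apply: etrans (deriveM (derivableM dYx dZx) dhx) _.
have E := deriveM dYx dZx; rewrite DYi DZj in E.
apply: etrans (congr1 (fun r : R => (Yi i * Zj j) x *: 'D_v (h i j) x + h i j x *: r) E) _.
by rewrite /GRing.scale /= /h /Yi /Zj fctE; ring.
Qed.

Lemma dhess_sym12 x a b c : A x ->
  'D_(l c) (fun y => hess y a b) x = 'D_(l a) (fun y => hess y c b) x.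
Proof.
move=> Ax; have bs := smooth_derive (l b) fs.
apply: derive_comm.
- by apply: (open_near oA Ax) => y Ay; exact: smooth_diff bs Ay.
- exact: smooth_diff (smooth_derive _ bs) Ax.
- exact: smooth_diff (smooth_derive _ bs) Ax.
Qed.

Lemma dhess_sym23 x v a b : A x ->
  'D_v (fun y => hess y a b) x = 'D_v (fun y => hess y b a) x.
Proof.
move=> Ax; apply: near_eq_derive; apply: (open_near oA Ax) => y Ay; exact: hess_sym.
Qed.

End SecondDerivatives.

(** * Derivatives of homogeneous functions *)

Section Homogeneity.
Context {R : realType} {n : nat}.
Local Notation V := 'rV[R]_n.

Definition nonzero : set V := [set y | y != 0].

Lemma nonzero_open : open nonzero.
Proof.
rewrite (_ : nonzero = ~` [set 0]); last first.
  by apply/seteqP; split => y /=; [move/eqP|move=> h; apply/eqP].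
apply: closed_openC; exact: (accessible_closed_set1 (hausdorff_accessible (@norm_hausdorff _ _))).
Qed.

Lemma derive_homogeneous (g : V -> R) (k : nat) b :
  (forall y, y != 0 -> differentiable g y) ->
  (forall y t, y != 0 -> 0 < t -> g (t *: y) = t ^+ k.+1 * g y) ->
  forall y t, y != 0 -> 0 < t -> 'D_b g (t *: y) = t ^+ k * 'D_b g y.
Proof.
move=> dg hg y t y0 t0; have tn : t != 0 by rewrite gt_eqF.
have ty : t *: y != 0 by rewrite scaler_eq0 negb_or tn.
have [s1 s2] := is_diff_scaler t y.
have E1 : 'd (g \o ( *:%R t)) y b = t * 'd g (t *: y) b.
  have h := diff_compE b s1 (dg _ ty); rewrite s2 in h.
  by apply: etrans h _; exact: linearZ.
have nE : \forall z \near y, (t ^+ k.+1 \*: g) z = (g \o ( *:%R t)) z.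
  by apply: (open_near nonzero_open y0) => z z0 /=; rewrite hg.
have dz : differentiable (t ^+ k.+1 \*: g) y by apply: differentiableZ; exact: dg.
have [_ E2] := near_eq_diff nE dz.
have E3 := congr1 (fun h : V -> R => h b) E2.
have E4 := congr1 (fun h : V -> R => h b) (diffZ (t ^+ k.+1) (dg _ y0)).
have E5 := etrans (esym E1) (etrans E3 E4).
apply: (mulfI tn); rewrite mulrA -exprS.
by rewrite (deriveE b (dg _ ty)) (deriveE b (dg _ y0)); exact: E5.
Qed.

(** The function t |-> g (t y) is constant near t = 1. *)
Lemma derive_homogeneous0 (g : V -> R) y :
  (forall y, y != 0 -> differentiable g y) ->
  (forall y t, y != 0 -> 0 < t -> g (t *: y) = g y) -> y != 0 -> 'D_y g y = 0.
Proof.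
move=> dg hg y0.
have [s1 s2] := is_diff_scalel 1 y.
have d1 : differentiable g (1 *: y) by rewrite scale1r; exact: dg.
have E1 : 'd (g \o ( *:%R ^~ y)) (1 : R) 1 = 'd g (1 *: y) (1 *: y).
  by have h := diff_compE (1 : R) s1 d1; rewrite s2 in h.
have nE : \forall t \near (1 : R), g y = (g \o ( *:%R ^~ y)) t.
  near=> t; rewrite /= hg //; near: t; exact: lt_nbhsr.
have [_ E2] := near_eq_diff nE (differentiable_cst _ _).
have E3 := congr1 (fun h : R -> R => h 1) E2.
have E4 := congr1 (fun h : R -> R => h 1) (diff_cst (g y) (1 : R)).
have E5 := etrans (esym E1) (etrans E3 E4); rewrite scale1r in E5.
by rewrite (deriveE y (dg _ y0)); exact: E5.
Unshelve. all: by end_near. Qed.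

End Homogeneity.

(** * Derivatives along the fibres *)

Section FibreCalculus.
Import Defs.
Context {R : realType} {n : nat} {M : manifold R n}.
Implicit Types (u : TM M) (w : TTM R n) (Y Z : TM M -> 'rV[R]_n).
Local Notation V := 'rV[R]_n.

Lemma tinv_fibre (p : M) (y : 'rV[R]_n) :
  tinv (chart_at p) (co (chart_at p) p, y) = (p, y) :> TM M.
Proof.
have := tinv_tco (u := (p, y)) (chart_at_atlas p) (chart_at_dom p).
by rewrite (tco_chart_at (p, y)).
Qed.

Lemma fibre_tran (p : M) (y : 'rV[R]_n) : y != 0 ->
  tran (chart_at p) (co (chart_at p) p, y).
Proof. by move=> y0; split=> //; exists p => //; exact: chart_at_dom. Qed.

Lemma affine_smooth (x : 'rV[R]_n) (A : set V) : smooth_on A (fun y : V => (x, y)).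
Proof.
apply: (@smooth_sub _ _ _ setT) => //.
apply: (@smooth_pair _ _ _ _ setT); first exact: openT.
  exact: smooth_cst.
by apply: (@smooth_linear _ _ _ _ idfun) => y; exact: cvg_id.
Qed.

Lemma fibre_smooth (F : TM M -> R) (p : M) : smooth_fun F ->
  smooth_on nonzero (fun y : 'rV[R]_n => F (p, y)).
Proof.
move=> Fs.
apply: (@smooth_ext _ _ _ nonzero_open _ ((F \o tinv (chart_at p)) \o (fun y => (co (chart_at p) p, y)))).
  by move=> y y0; rewrite /= tinv_fibre.
apply: (@smooth_comp _ _ _ _ _ (tran (chart_at p))).
- exact: nonzero_open.
- exact: fin_dim_prod (fin_dim_rV _) (fin_dim_rV _).
- by move=> y y0; exact: fibre_tran.
- exact: affine_smooth.
- by apply: Fs; exact: chart_at_atlas.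
Qed.

Lemma diff_fibre (W : normedModType R) (F : V * V -> W) u v :
  differentiable F (tco (chart_at u.1) u) ->
  differentiable (fun y => F (co (chart_at u.1) u.1, y)) u.2 /\
  'd F (tco (chart_at u.1) u) (gamma v) = 'D_v (fun y => F (co (chart_at u.1) u.1, y)) u.2.
Proof.
rewrite tco_chart_at => dF; have [d1 d2] := diff_vert v dF.
by split; [exact: d1|rewrite (deriveE v d1); exact: d2].
Qed.

Lemma tder_fibre (F : TM M -> R) u v :
  differentiable (F \o tinv (chart_at u.1)) (tco (chart_at u.1) u) ->
  tder u (gamma v) F = 'D_v (fun y => F (u.1, y)) u.2.
Proof.
move=> dF; have [_ E] := diff_fibre v dF; apply: etrans E _.
congr (derive _ _ _); apply/funext => y; exact: (congr1 F (tinv_fibre _ _)).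
Qed.

Lemma flat_deriv_fibre u v Y : slit u -> smooth_section Y ->
  differentiable (fun y => Y (u.1, y)) u.2 /\
  flat_deriv u (gamma v) Y = 'D_v (fun y => Y (u.1, y)) u.2.
Proof.
move=> u0 Ys; have [d1 d2] := diff_fibre v (home_components_diff u0 Ys).
have E : (fun y => home_components u Y (co (chart_at u.1) u.1, y)) = fun y => Y (u.1, y).
  apply/funext => y.
  exact: (etrans (congr1 (fun u' => components (chart_at u.1) u'.1 (Y u')) (tinv_fibre u.1 y))
    (components_chart_at u.1 (Y (u.1, y)))).
by rewrite E in d1 d2.
Qed.

End FibreCalculus.

(** * Scalar products *)

Section ScalarProduct.
Context {R : realType} {n : nat}.
Local Notation V := 'rV[R]_n.

Definition scalar_product (g : V -> V -> R) : Prop :=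
  [/\ forall a b, g a b = g b a,
      forall k a a' b, g (k *: a + a') b = k * g a b + g a' b &
      forall a, a != 0 -> 0 < g a a].

Variable g : V -> V -> R.
Hypothesis gsp : scalar_product g.

Lemma sp_sym a b : g a b = g b a. Proof. by case: gsp. Qed.

Lemma sp0l b : g 0 b = 0.
Proof.
case: gsp => _ /(_ 1 0 0 b) + _; rewrite scaler0 addr0 mul1r => /eqP.
by rewrite -[X in X == _]addr0 (inj_eq (addrI _)) eq_sym => /eqP.
Qed.

Lemma spDl a a' b : g (a + a') b = g a b + g a' b.
Proof. by case: gsp => _ /(_ 1 a a' b) + _; rewrite scale1r mul1r. Qed.

Lemma spZl k a b : g (k *: a) b = k * g a b.
Proof. by case: gsp => _ /(_ k a 0 b) + _; rewrite addr0 sp0l addr0. Qed.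

Lemma spNl a b : g (- a) b = - g a b.
Proof. by rewrite -scaleN1r spZl mulN1r. Qed.

Lemma spDr a b b' : g a (b + b') = g a b + g a b'.
Proof. by rewrite !(sp_sym a) spDl. Qed.

Lemma spZr k a b : g a (k *: b) = k * g a b.
Proof. by rewrite !(sp_sym a) spZl. Qed.

Lemma spNr a b : g a (- b) = - g a b.
Proof. by rewrite !(sp_sym a) spNl. Qed.

Lemma sp_def a : g a a = 0 -> a = 0.
Proof.
move=> a0; apply/eqP/negPn/negP => an.
by case: gsp => _ _ /(_ a an); rewrite a0 ltxx.
Qed.

Lemma sp_ge0 a : 0 <= g a a.
Proof. by have [->|an] := eqVneq a 0; [rewrite sp0l|apply: ltW; case: gsp => _ _; apply]. Qed.

End ScalarProduct.

(** * The Finsler metric and the Cartan tensor *)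

Section FinslerMetric.
Import Defs.
Context {R : realType} {n : nat} {M : manifold R n}.
Implicit Types (u : TM M) (w : TTM R n) (Y Z : TM M -> 'rV[R]_n).
Local Notation V := 'rV[R]_n.
Variable L : TM M -> R.
Hypothesis Lf : finsler L.

(** The function is L^2, without the customary factor 1/2, which fmetric carries. *)
Definition energy (p : M) (y : V) : R := L (p, y) ^+ 2.

Lemma smooth_sq (U : normedModType R) (A : set U) (f : U -> R) : open A ->
  smooth_on A f -> smooth_on A (fun x => f x ^+ 2).
Proof.
by move=> oA fs; apply: smooth_ext (smooth_smul oA fs fs) => // x _; rewrite expr2.
Qed.

Lemma energy_smooth p : smooth_on nonzero (energy p).
Proof.
apply: smooth_sq; first exact: nonzero_open.
by apply: fibre_smooth; case: Lf.
Qed.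

Local Notation id1 := (idfun : {linear V -> V}).

Lemma metric_scalar_product u : slit u -> scalar_product (fmetric L u).
Proof.
move=> u0; split.
- move=> a b.
  exact: (congr1 (fun r => 2^-1 * r) (hess_sym id1 nonzero_open (energy_smooth u.1) a b u0)).
- move=> k a a' b.
  have h := congr1 (fun r => 2^-1 * r) (hess_linl id1 (energy_smooth u.1) k a a' b u0).
  by apply: etrans h _; rewrite mulrDr mulrCA.
- by move=> a a0; case: Lf => _ _ _; apply.
Qed.

Lemma metric_nondeg u a : slit u ->
  (forall Z, smooth_section Z -> fmetric L u a (Z u) = 0) -> a = 0.
Proof. move=> u0 az; have [Z Zs Zu] := section_through u a.
by apply: (sp_def (metric_scalar_product u0)); have := az Z Zs; rewrite Zu. Qed.

(** The derivative of g_u (a, b) along the fibre, for fixed a and b. *)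
Definition cartan_tensor u v a b : R :=
  2^-1 * 'D_v (fun y => hess (energy u.1) id1 y a b) u.2.

Lemma cartan_tensor_sym12 u v a b : slit u -> cartan_tensor u v a b = cartan_tensor u a v b.
Proof.
move=> u0.
exact: (congr1 (fun r => 2^-1 * r)
  (dhess_sym12 id1 nonzero_open (energy_smooth u.1) a b v u0)).
Qed.

Lemma cartan_tensor_sym23 u v a b : slit u -> cartan_tensor u v a b = cartan_tensor u v b a.
Proof.
move=> u0.
exact: (congr1 (fun r => 2^-1 * r) (dhess_sym23 id1 nonzero_open (energy_smooth u.1) v a b u0)).
Qed.

(** The second derivatives of L^2 on a fibre are homogeneous of degree 0. *)
Lemma cartan_tensor_eta1 u a b : slit u -> cartan_tensor u u.2 a b = 0.
Proof.
move=> u0; have es := energy_smooth u.1.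
have e2 y t : y != 0 -> 0 < t -> energy u.1 (t *: y) = t ^+ 2 * energy u.1 y.
  by move=> y0 t0; rewrite /energy; case: Lf => _ _ hom _; rewrite hom // exprMn.
have dd (g : V -> R) : smooth_on nonzero g -> forall y, y != 0 -> differentiable g y.
  by move=> gs y; exact: smooth_diff gs.
have e1 := derive_homogeneous b (dd _ es) e2.
have e0 := derive_homogeneous a (dd _ (smooth_derive b es)) e1.
have h0 y t : y != 0 -> 0 < t -> hess (energy u.1) id1 (t *: y) a b = hess (energy u.1) id1 y a b.
  by move=> y0 t0; apply: etrans (e0 y t y0 t0) _; rewrite expr0 mul1r.
have h := derive_homogeneous0 (dd _ (smooth_derive a (smooth_derive b es))) h0 u0.
by apply: etrans (congr1 (fun r => 2^-1 * r) h) _; exact: mulr0.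
Qed.

Lemma cartan_tensor_eta2 u v b : slit u -> cartan_tensor u v u.2 b = 0.
Proof. by move=> u0; exact: etrans (cartan_tensor_sym12 v u.2 b u0) (cartan_tensor_eta1 v b u0). Qed.

Lemma derive_metric_fibre u v (Y Z : V -> V) : slit u ->
  differentiable Y u.2 -> differentiable Z u.2 ->
  differentiable (fun y => fmetric L (u.1, y) (Y y) (Z y)) u.2 /\
  'D_v (fun y => fmetric L (u.1, y) (Y y) (Z y)) u.2 =
  cartan_tensor u v (Y u.2) (Z u.2) + fmetric L u ('D_v Y u.2) (Z u.2)
   + fmetric L u (Y u.2) ('D_v Z u.2).
Proof.
move=> u0 dY dZ.
have [d1 d2] := hess_leibniz id1 nonzero_open (energy_smooth u.1) v u0 dY dZ.
have d3 := differentiableZ 2^-1 d1.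
split; first exact: d3.
have E : 'D_v (fun y => fmetric L (u.1, y) (Y y) (Z y)) u.2 =
    2^-1 * 'D_v (fun y => hess (energy u.1) id1 y (Y y) (Z y)) u.2.
  have E0 : (fun y => fmetric L (u.1, y) (Y y) (Z y)) =
      2^-1 \*: (fun y => hess (energy u.1) id1 y (Y y) (Z y)) by apply/funext.
  exact: (etrans (congr1 (fun h : V -> R => 'D_v h u.2) E0)
    (deriveZ 2^-1 (diff_derivable (v := v) d1))).
apply: etrans E _; apply: etrans (congr1 (fun r => 2^-1 * r) d2) _.
by apply: etrans (mulrDr _ _ _) _; apply: congr2 => //; exact: mulrDr.
Qed.

(** The chart c identifies the fibre with R^n by a linear map, so the second
    derivatives of L^2 along the fibre may be taken in c.  In this form the metric is
    differentiable in all variables, not only along the fibre. *)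
Lemma metric_chart c z a b : atlas c -> tran c z ->
  fmetric L (tinv c z) a b = 2^-1 * hess (fun z => (L \o tinv c) z ^+ 2)
    (@inj2 R V V : {linear V -> (V * V)%type}) z
    (components c (inv c z.1) a) (components c (inv c z.1) b).
Proof.
move=> ca cz; apply: (congr1 (fun r => 2^-1 * r)).
set p := inv c z.1; set y := (tinv c z).2.
have cp : dom c p by exact: dom_tinv cz.
have y0 : y != 0 by exact: slit_tinv.
set F := fun z => (L \o tinv c) z ^+ 2.
have Fs : smooth_on (tran c) F by apply: smooth_sq; [exact: tran_open|case: Lf => + _ _ _; exact].
have zE : z = (z.1, components c p y).
  by have := tcoK ca cz; rewrite /tco /= co_inv; [move=> <-|case: cz].
have x1 : (co c @` dom c) z.1 by case: cz.
pose B : {linear V -> V} := 'd (co c \o inv (chart_at p)) (co (chart_at p) p).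
have BE v : B v = components c p v by [].
have Bc : continuous B.
  apply: diff_continuous; apply: (@trans_diff _ _ _ (chart_at p) c).
  - exact: chart_at_atlas.
  - exact: ca.
  - by apply: overlap_co => //; exact: chart_at_dom.
have trB y' : y' != 0 -> tran c (z.1, B y').
  move=> y'0; split=> //=; apply: contra y'0 => /eqP.
  by rewrite BE => /(components_inj ca cp) ->.
have chain (H : V * V -> R) v y' : smooth_on (tran c) H -> y' != 0 ->
    'D_v (fun y => H (z.1, B y)) y' = 'D_(inj2 V (B v)) H (z.1, B y').
  move=> Hs y'0; have dH := smooth_diff Hs (trB y' y'0).
  have dB : differentiable (fun y => (z.1, B y)) y'.
    by apply: differentiable_pair; [exact: differentiable_cst|exact: linear_differentiable].
  have dHB := differentiable_comp dB dH.
  rewrite (deriveE _ dH); apply: etrans (deriveE v dHB) _.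
  apply: etrans (diff_compE v dB dH) _.
  exact: (congr1 ('d H (z.1, B y')) (diff_cst_lin_pair z.1 y' v Bc)).
have eE : energy p = fun y => F (z.1, B y).
  apply/funext => y'; rewrite /energy /F /=; congr (L _ ^+ 2).
  have := tinv_tco (u := (p, y')) ca cp; rewrite /tco /= /p co_inv //.
have nE : \forall y' \near y, 'D_b (fun y => F (z.1, B y)) y' =
    ('D_(inj2 V (B b)) F) (z.1, B y').
  by apply: (open_near nonzero_open y0) => y' y'0; exact: chain.
apply: etrans (congr1 (fun e => 'D_a ('D_b e) y) eE) _.
apply: etrans (near_eq_derive a nE) _.
apply: etrans (chain _ a y (smooth_derive _ Fs) y0) _.
exact: (congr1 (fun z => 'D_(inj2 V (B a)) ('D_(inj2 V (B b)) F) z) (esym zE)).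
Qed.

Lemma energy_chart_smooth c : atlas c -> smooth_on (tran c) (fun z => (L \o tinv c) z ^+ 2).
Proof. by move=> ca; apply: smooth_sq; [exact: tran_open|case: Lf => + _ _ _; exact]. Qed.

Lemma metric_chart_diff c z Y Z : atlas c -> tran c z -> smooth_section Y -> smooth_section Z ->
  differentiable ((fun u' => fmetric L u' (Y u') (Z u')) \o tinv c) z.
Proof.
move=> ca cz Ys Zs.
have [d1 _] := hess_leibniz (@inj2 R V V : {linear V -> (V * V)%type})
  (@tran_open _ _ _ c) (energy_chart_smooth ca) 0 cz (smooth_diff (Ys c ca) cz) (smooth_diff (Zs c ca) cz).
have nE : \forall x \near z, 2^-1 * hess (fun z => (L \o tinv c) z ^+ 2)
    (@inj2 R V V : {linear V -> (V * V)%type}) x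
    (components c (inv c x.1) (Y (tinv c x))) (components c (inv c x.1) (Z (tinv c x))) =
    ((fun u' => fmetric L u' (Y u') (Z u')) \o tinv c) x.
  exact: filterS (fun x cx => esym (metric_chart (Y (tinv c x)) (Z (tinv c x)) ca cx)) (near_tran cz).
by have [] := near_eq_diff nE (differentiableZ 2^-1 d1).
Qed.

Lemma metric_diff u Y Z : slit u -> smooth_section Y -> smooth_section Z ->
  differentiable ((fun u' => fmetric L u' (Y u') (Z u')) \o tinv (chart_at u.1))
    (tco (chart_at u.1) u).
Proof. by move=> u0; apply: metric_chart_diff; [exact: chart_at_atlas|exact: home_tran]. Qed.

(** The product rule for g(Y, Z) along the fibre; the derivative of g itself
    contributes the Cartan tensor. *)
Lemma tder_metric_vertical u v Y Z : slit u -> smooth_section Y -> smooth_section Z ->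
  tder u (gamma v) (fun u' => fmetric L u' (Y u') (Z u')) =
  cartan_tensor u v (Y u) (Z u) + fmetric L u (flat_deriv u (gamma v) Y) (Z u)
   + fmetric L u (Y u) (flat_deriv u (gamma v) Z).
Proof.
move=> u0 Ys Zs; have [dY EY] := flat_deriv_fibre v u0 Ys; have [dZ EZ] := flat_deriv_fibre v u0 Zs.
rewrite EY EZ; apply: etrans (tder_fibre v (metric_diff u0 Ys Zs)) _.
have [_ E] := derive_metric_fibre v u0 dY dZ; apply: etrans E _.
by case: u u0 Ys Zs dY EY dZ EZ.
Qed.

End FinslerMetric.

(** * The Cartan connection *)

Section CartanConnection.
Import Defs.
Context {R : realType} {n : nat} {M : manifold R n}.
Implicit Types (u : TM M) (w : TTM R n) (X Y Z : TM M -> 'rV[R]_n).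
Local Notation V := 'rV[R]_n.
Variables (L : TM M -> R) (D : cov_deriv M).
Hypotheses (Lf : finsler L) (Dcartan : is_cartan L D).

Let Dc : is_connection D. Proof. by case: Dcartan. Qed.
Let Dr : regular D. Proof. by case: Dcartan. Qed.

(** Y is kept as a section: the symmetry of hor_christoffel, which exchanges its
    vector with the value of its section, stands in for tensoriality in Y. *)
Definition christoffel u w Y : 'rV[R]_n := D u w Y - flat_deriv u w Y.

Lemma christoffelE u w Y : D u w Y = flat_deriv u w Y + christoffel u w Y.
Proof. by rewrite /christoffel addrC subrK. Qed.

Lemma christoffelD u w w' Y : slit u -> smooth_section Y ->
  christoffel u (w + w') Y = christoffel u w Y + christoffel u w' Y.
Proof. by move=> u0 Ys; rewrite /christoffel covDl // flat_derivD opprD addrACA. Qed.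

Lemma cartan_metrical u w Y Z : slit u -> smooth_section Y -> smooth_section Z ->
  tder u w (fun u' => fmetric L u' (Y u') (Z u')) =
  fmetric L u (D u w Y) (Z u) + fmetric L u (Y u) (D u w Z).
Proof. by case: Dcartan => _ _ + _ _; exact. Qed.

(** Compatibility of the metric along gamma v says that C(v, Y, Z) is the sum of
    g(T(v, Y), Z) and g(Y, T(v, Z)), and the last axiom of the Cartan connection makes
    these two terms equal. *)
Lemma cartan_tensorE u v Y Z : slit u -> smooth_section Y -> smooth_section Z ->
  cartan_tensor L u v (Y u) (Z u) = 2 * fmetric L u (christoffel u (gamma v) Y) (Z u).
Proof.
move=> u0 Ys Zs; have sp := metric_scalar_product Lf u0.
have h1 := cartan_metrical (gamma v) u0 Ys Zs.
have h2 := tder_metric_vertical Lf v u0 Ys Zs.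
have h3 : fmetric L u (christoffel u (gamma v) Y) (Z u) = fmetric L u (christoffel u (gamma v) Z) (Y u).
  have [X Xs Xu] := section_through u v.
  have tE W : smooth_section W -> torsion_hv D X W u = christoffel u (gamma v) W.
    by move=> Ws; rewrite (torsion_hvE Dc Dr u0 Xs Ws) Xu.
  rewrite -(tE Y Ys) -(tE Z Zs).
  by case: Dcartan => _ _ _ _; apply.
have := etrans (esym h2) h1; rewrite !christoffelE.
move: (flat_deriv u (gamma v) Y) (flat_deriv u (gamma v) Z) h3 => a b.
move: (christoffel u (gamma v) Y) (christoffel u (gamma v) Z) (Y u) (Z u) => c d y z.
move: (cartan_tensor L u v y z); move: (fmetric L u) sp => g sp r h3.
rewrite (spDl sp) (spDr sp) [g y d](sp_sym sp) -h3 => h.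
have -> : r = (r + g a z + g y b) - g a z - g y b by ring.
by rewrite h; ring.
Qed.

Lemma metric_nondeg_eq u a : slit u ->
  (forall Z, smooth_section Z -> 2 * fmetric L u a (Z u) = 0) -> a = 0.
Proof.
move=> u0 H; apply: (metric_nondeg Lf u0) => Z Zs.
by have /eqP := H Z Zs; rewrite mulf_eq0 pnatr_eq0 /= => /eqP.
Qed.

(** The Cartan tensor kills the fundamental field.  This makes K the identity on
    vertical vectors. *)
Lemma christoffel_fund u v : slit u -> christoffel u (gamma v) (@fund R n M) = 0.
Proof.
move=> u0; apply: (metric_nondeg_eq u0) => Z Zs.
by rewrite -(cartan_tensorE v u0 (@smooth_fund _ _ _) Zs); exact: cartan_tensor_eta2.
Qed.

Lemma conn_map_gamma u v : slit u -> conn_map D u (gamma v) = v.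
Proof. by move=> u0; rewrite /conn_map christoffelE christoffel_fund // addr0 flat_deriv_fund. Qed.

Lemma conn_mapD u w w' : slit u -> conn_map D u (w + w') = conn_map D u w + conn_map D u w'.
Proof. by move=> u0; apply: covDl => //; exact: smooth_fund. Qed.

Lemma gammaN (v : V) : - gamma v = gamma (- v).
Proof. by congr pair; rewrite /= oppr0. Qed.

Lemma hor_decomp u w : slit u -> hor_map D u (rho w) = w - gamma (conn_map D u w).
Proof.
move=> u0; apply: (hor_map_unique Dc Dr u0).
  by rewrite conn_mapD // gammaN conn_map_gamma // subrr.
by rewrite /rho /= oppr0 addr0.
Qed.

Lemma hor_add u w : slit u -> w = hor_map D u (rho w) + gamma (conn_map D u w).
Proof. by move=> u0; rewrite hor_decomp // subrK. Qed.

Definition hor_christoffel u v Y : 'rV[R]_n := christoffel u (hor_map D u v) Y.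

Lemma christoffel_decomp u w Y : slit u -> smooth_section Y ->
  christoffel u w Y = hor_christoffel u (rho w) Y + christoffel u (gamma (conn_map D u w)) Y.
Proof. by move=> u0 Ys; rewrite {1}(hor_add w u0) christoffelD. Qed.

(** Split X into its horizontal part and gamma (K X): on the latter, christoffel is
    the torsion that the Chern connection subtracts. *)
Lemma chernE (X : TM M -> TTM R n) Y u : slit u -> smooth_section Y ->
  smooth_section (fun u' => conn_map D u' (X u')) ->
  chern D X Y u = flat_deriv u (X u) Y + hor_christoffel u (rho (X u)) Y.
Proof.
move=> u0 Ys Ks; rewrite /chern (torsion_hvE Dc Dr u0 Ks Ys) -/(christoffel _ _ _).
by rewrite christoffelE (christoffel_decomp (X u) u0 Ys) addrA addrK.
Qed.

Lemma hor_christoffel_sym u X Y : slit u -> smooth_section X -> smooth_section Y ->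
  hor_christoffel u (X u) Y = hor_christoffel u (Y u) X.
Proof.
move=> u0 Xs Ys; apply/eqP; rewrite -subr_eq0; apply/eqP.
have h := torsion_hhE Dc Dr u0 Xs Ys; apply: etrans (esym h) _.
by case: Dcartan => _ _ _ + _; exact.
Qed.

Lemma conn_mapE u w : slit u -> conn_map D u w = w.2 + hor_christoffel u (rho w) (@fund R n M).
Proof.
move=> u0; rewrite {1}/conn_map christoffelE flat_deriv_fund // (christoffel_decomp w u0 (@smooth_fund _ _ _)).
by rewrite christoffel_fund // addr0.
Qed.

(** The values of hor_christoffel on the fundamental field determine the horizontal
    map, so that comparing them for two connections compares the lifts. *)
Lemma hor_mapE u v : slit u -> hor_map D u v = (v, - hor_christoffel u v (@fund R n M)).
Proof.
move=> u0; have [h0 h1] := hor_map_spec Dr v u0.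
have := conn_mapE (hor_map D u v) u0; rewrite h0 h1 => /esym/eqP; rewrite addr_eq0 => /eqP h2.
by rewrite [LHS]surjective_pairing h2 -[(hor_map D u v).1]/(rho _) h1.
Qed.

(** * Concurrent fields *)

Section Concurrent.
Variable zeta : TM M -> 'rV[R]_n.
Hypothesis zc : concurrent D zeta.

Let zs : smooth_section zeta. Proof. by case: zc. Qed.

(** Horizontal and vertical vectors span. *)
Lemma cov_zeta u w : slit u -> D u w zeta = - rho w.
Proof.
move=> u0; have [X Xs Xu] := section_through u (rho w).
have [Y Ys Yu] := section_through u (conn_map D u w).
case: zc => _ H; have [h1 _] := H X u u0 Xs; have [_ h2] := H Y u u0 Ys.
move: h1 h2; rewrite /lift_h /lift_v Xu Yu => h1 h2.
by rewrite (hor_add w u0) covDl // h1 h2 addr0 -(hor_add w u0).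
Qed.

Lemma tder_p2 u w : slit u ->
  tder u w (fun u' => fmetric L u' (zeta u') (zeta u')) = - 2 * fmetric L u (rho w) (zeta u).
Proof.
move=> u0; have sp := metric_scalar_product Lf u0.
apply: etrans (cartan_metrical w u0 zs zs) _.
apply: etrans (congr2 (fun a b => fmetric L u a (zeta u) + fmetric L u (zeta u) b)
  (cov_zeta w u0) (cov_zeta w u0)) _.
move: (fmetric L u) sp => g sp.
rewrite (sp_sym sp (zeta u)) (spNl sp); ring.
Qed.

Let c0 u := chart_at u.1.
Let phi u := (fun u' => fmetric L u' (zeta u') (zeta u')) \o tinv (c0 u).

Lemma phi_diff u z : tran (c0 u) z -> differentiable (phi u) z.
Proof. by move=> cz; apply: metric_chart_diff => //; exact: chart_at_atlas. Qed.

Lemma dphi_along u z w : tran (c0 u) z ->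
  'd (phi u) z (tder (tinv (c0 u) z) w (tco (c0 u))) =
  - 2 * fmetric L (tinv (c0 u) z) (rho w) (zeta (tinv (c0 u) z)).
Proof.
move=> cz; have ca : atlas (c0 u) by exact: chart_at_atlas.
have sz := slit_tinv ca cz; have dz := dom_tinv cz.
have dphi := phi_diff cz; have zK := tcoK ca cz.
have dphi' : differentiable (phi u) (tco (c0 u) (tinv (c0 u) z)) by rewrite zK.
have [_ E] := tder_chart w ca dz dphi'.
apply: etrans (esym _) (tder_p2 w sz); apply: etrans E _.
exact: (congr1 (fun y => 'd (phi u) y (tder (tinv (c0 u) z) w (tco (c0 u)))) zK).
Qed.

Lemma dphi_vert u z b : tran (c0 u) z -> 'd (phi u) z (0, b) = 0.
Proof.
move=> cz; have ca : atlas (c0 u) by exact: chart_at_atlas.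
have sz := slit_tinv ca cz; have dz := dom_tinv cz.
have [v vb] := components_surj b ca dz.
have := dphi_along (gamma v) cz.
have E := tder_tcoV v ca dz; rewrite vb in E.
move=> h; apply: etrans (congr1 ('d (phi u) z) (esym E)) _; apply: etrans h _.
by rewrite (_ : rho (gamma v) = 0) // (sp0l (metric_scalar_product Lf sz)) mulr0.
Qed.

(** The field with constant base components a in the chart has rho equal to the
    vector of components a, and its vertical part contributes nothing by dphi_vert. *)
Lemma dphi_hor u z a : tran (c0 u) z ->
  'd (phi u) z (a, 0) = - hess (fun z => (L \o tinv (c0 u)) z ^+ 2)
    (@inj2 R V V : {linear V -> (V * V)%type}) z a (home_components u zeta z).
Proof.
move=> cz; have ca : atlas (c0 u) by exact: chart_at_atlas.
have sz := slit_tinv ca cz; have dz := dom_tinv cz.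
have [a' aa] := components_surj a ca dz.
(* A change of charts may add a vertical part t.2 to (a', 0). *)
set t := tder (tinv (c0 u) z) (a', 0 : V) (tco (c0 u)).
have t1 : t.1 = a by rewrite -aa; exact: (tder_tco1 (a', 0 : V) ca dz).
have tE : (a, 0 : V) = t - (0, t.2) by congr pair; rewrite /= ?subr0 ?subrr.
have E1 : 'd (phi u) z (a, 0) = 'd (phi u) z t - 'd (phi u) z (0, t.2).
  by rewrite tE; exact: linearB.
apply: etrans E1 _; rewrite dphi_vert // subr0.
apply: etrans (dphi_along (a', 0 : V) cz) _.
have E2 := metric_chart Lf a' (zeta (tinv (c0 u) z)) ca cz.
apply: etrans (congr1 (fun r => - 2 * r) E2) _.
have key (r s : R) : r = s -> - 2 * (2^-1 * r) = - s by move=> ->; field.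
apply: key; exact: (congr1 (fun a => hess _ _ z a (home_components u zeta z)) aa).
Qed.

(** The vertical derivatives of p^2 vanish identically, so the mixed ones do, and
    by dphi_hor the mixed derivatives are the vertical derivatives of - 2 g(a, zeta). *)
Lemma zeta_mixed u a b : slit u ->
  'd (fun z => hess (fun z => (L \o tinv (c0 u)) z ^+ 2)
    (@inj2 R V V : {linear V -> (V * V)%type}) z a (home_components u zeta z))
    (tco (c0 u) u) (0, b) = 0.
Proof.
move=> u0; have cz := home_tran u0; have ca : atlas (c0 u) by exact: chart_at_atlas.
set h := fun z => hess _ _ z a _; set z0 := tco _ u.
have dh : differentiable h z0.
  by have [] := hess_leibniz (@inj2 R V V : {linear V -> (V * V)%type}) (@tran_open _ _ _ (c0 u))
    (energy_chart_smooth Lf ca) 0 cz (differentiable_cst a z0) (home_components_diff u0 zs).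
have n1 : \forall z \near z0, (- h) z = 'D_((a, 0) : V * V) (phi u) z.
  by apply: near_slit => // z zt; rewrite (deriveE _ (phi_diff zt)) dphi_hor.
have n2 : \forall z \near z0, (cst 0 : V * V -> R) z = 'D_((0, b) : V * V) (phi u) z.
  by apply: near_slit => // z zt; rewrite (deriveE _ (phi_diff zt)) dphi_vert.
have [d1 e1] := near_eq_diff n1 (differentiableN dh).
have [d2 e2] := near_eq_diff n2 (differentiable_cst 0 z0).
have n3 : \forall z \near z0, differentiable (phi u) z.
  by apply: near_slit => // z zt; exact: phi_diff.
have C := derive_comm n3 d1 d2.
have C1 := etrans (esym (deriveE ((0, b) : V * V) d1)) C.
have C2 := etrans C1 (deriveE ((a, 0) : V * V) d2).
have C3 : 'd ('D_((a, 0) : V * V) (phi u)) z0 ((0, b) : V * V) = 0.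
  apply: etrans C2 _; have := congr1 (fun k : V * V -> R => k ((a, 0) : V * V)) e2.
  by move=> /= ->; rewrite diff_cst.
have E4 := congr1 (fun k : V * V -> R => k ((0, b) : V * V)) e1.
have E5 := congr1 (fun k : V * V -> R => k ((0, b) : V * V)) (diffN dh).
have := etrans (esym E5) (etrans (esym E4) C3).
by move=> /= /eqP; rewrite oppr_eq0 => /eqP.
Qed.

(** The vertical derivative of g(a, zeta) is 0 by zeta_mixed.  By the product rule
    it is C(b, a, zeta) + g(a, d_b zeta), and d_b zeta is minus the vertical
    christoffel of zeta since zeta is concurrent; hence it is also C(b, a, zeta) / 2. *)
Lemma cartan_tensor_zeta u a b : slit u -> cartan_tensor L u b a (zeta u) = 0.
Proof.
move=> u0; have sp := metric_scalar_product Lf u0.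
have ca : atlas (c0 u) by exact: chart_at_atlas.
set h := fun z => hess (fun z => (L \o tinv (c0 u)) z ^+ 2)
    (@inj2 R V V : {linear V -> (V * V)%type}) z a (home_components u zeta z).
have dh : differentiable h (tco (c0 u) u).
  by have [] := hess_leibniz (@inj2 R V V : {linear V -> (V * V)%type}) (@tran_open _ _ _ (c0 u))
    (energy_chart_smooth Lf ca) 0 (home_tran u0) (differentiable_cst a _) (home_components_diff u0 zs).
have [d1 E1] := diff_fibre b dh.
have E2 := etrans (esym E1) (zeta_mixed a b u0).
have [dz Ez] := flat_deriv_fibre b u0 zs.
have [d3 E3] := derive_metric_fibre Lf b u0 (differentiable_cst a u.2) dz.
have nE : \forall y \near u.2, (fun y => 2 * fmetric L (u.1, y) a (zeta (u.1, y))) y =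
    h (co (c0 u) u.1, y).
  apply: (open_near nonzero_open u0) => y y0.
  have E := metric_chart Lf a (zeta (tinv (c0 u) (co (c0 u) u.1, y))) ca (fibre_tran u.1 y0).
  have e1 := congr1 (fun u' => 2 * fmetric L u' a (zeta u')) (tinv_fibre u.1 y).
  have aE : components (c0 u) (inv (c0 u) (co (c0 u) u.1)) a = a.
    by rewrite coK; [exact: components_chart_at|exact: chart_at_dom].
  have key (r s : R) : r = s -> 2 * (2^-1 * r) = s by move=> ->; field.
  apply: etrans (esym e1) _; apply: etrans (congr1 (fun r => 2 * r) E) _.
  apply: key.
  exact: (congr1 (fun a => hess _ _ _ a (home_components u zeta (co (c0 u) u.1, y))) aE).
have E4 := near_eq_derive b nE.
have E5 : 2 * 'D_b (fun y => fmetric L (u.1, y) a (zeta (u.1, y))) u.2 = 0.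
  have := deriveZ 2 (diff_derivable (v := b) d3) => E; apply: etrans (esym E) _.
  exact: etrans E4 E2.
have {E5}E5 : 'D_b (fun y => fmetric L (u.1, y) a (zeta (u.1, y))) u.2 = 0.
  by move/eqP: E5; rewrite mulf_eq0 pnatr_eq0 /= => /eqP.
have := etrans (esym E3) E5.
have -> : 'D_b (cst a) u.2 = 0 by rewrite derive_cst.
rewrite /= (sp0l sp) addr0 -surjective_pairing -Ez.
have -> : flat_deriv u (gamma b) zeta = - christoffel u (gamma b) zeta.
  by rewrite /christoffel (cov_zeta _ u0) (_ : rho (gamma b) = 0) // oppr0 sub0r opprK.
have [Z Zs Zu] := section_through u a.
rewrite (spNr sp) (sp_sym sp a) -Zu.
have E6 := cartan_tensorE b u0 zs Zs.
have E7 := cartan_tensor_sym23 Lf b (Z u) (zeta u) u0.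
move=> E8; rewrite E7; move: E6 E8; rewrite E7.
move: (cartan_tensor _ _ _ _ _) (fmetric _ _ _ _) => r s -> h8.
have -> : s = 2 * s - s by ring.
by rewrite h8 mulr0.
Qed.

Lemma christoffel_zeta u b : slit u -> christoffel u (gamma b) zeta = 0.
Proof.
move=> u0; apply: (metric_nondeg_eq u0) => Z Zs.
rewrite -(cartan_tensorE b u0 zs Zs); apply: etrans (cartan_tensor_sym23 Lf b _ _ u0) _.
exact: cartan_tensor_zeta.
Qed.

(** So a concurrent field depends on the base point only. *)
Lemma flat_deriv_zeta u b : slit u -> flat_deriv u (gamma b) zeta = 0.
Proof.
move=> u0; have := christoffel_zeta b u0; rewrite /christoffel cov_zeta // => /eqP.
by rewrite subr_eq0 => /eqP <-; rewrite (_ : rho (gamma b) = 0) // oppr0.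
Qed.

End Concurrent.

End CartanConnection.

(** * The metric of the changed energy *)

Section EnergyChange.
Import Defs.
Context {R : realType} {n : nat} {M : manifold R n}.
Implicit Types (u : TM M) (w : TTM R n) (X Y Z : TM M -> 'rV[R]_n).
Local Notation V := 'rV[R]_n.
Variables (L Lt : TM M -> R) (D : cov_deriv M) (zeta : TM M -> 'rV[R]_n).
Hypotheses (Lf : finsler L) (Dcartan : is_cartan L D) (zc : concurrent D zeta).
Let zs : smooth_section zeta. Proof. by case: zc. Qed.
Hypothesis LtE : forall u, slit u ->
  Lt u ^+ 2 = L u ^+ 2 + (fmetric L u (zeta u) (fund u)) ^+ 2.

Let zeta_fibre (p : M) (y : V) : V := zeta (p, y).

Lemma zeta_fibre_derive p y v : y != 0 -> differentiable (zeta_fibre p) y /\ 'D_v (zeta_fibre p) y = 0.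
Proof.
move=> y0; have u0 : slit ((p, y) : TM M) by [].
have [d1 E] := flat_deriv_fibre v u0 zs; split; first exact: d1.
exact: etrans (esym E) (flat_deriv_zeta Lf Dcartan zc v u0).
Qed.

Let Bfib (p : M) (y : V) : R := fmetric L (p, y) (zeta_fibre p y) y.
Let zeta_form (p : M) (a y : V) : R := fmetric L (p, y) (zeta_fibre p y) a.

Let sum3_eq (x1 x2 x3 x4 : R) : x1 = 0 -> x2 = 0 -> x3 = x4 -> x1 + x2 + x3 = x4.
Proof. by move=> -> -> ->; rewrite !add0r. Qed.

(** The form g(zeta, a) is constant along the fibre: neither zeta nor, as C kills
    zeta, the metric contributes. *)
Lemma zeta_form_derive p a y v : y != 0 ->
  differentiable (zeta_form p a) y /\ 'D_v (zeta_form p a) y = 0.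
Proof.
move=> y0; have u0 : slit ((p, y) : TM M) by [].
have sp := metric_scalar_product Lf u0.
have [dz Dz] := zeta_fibre_derive p v y0.
have [d1 E] := derive_metric_fibre Lf v u0 dz (differentiable_cst a y).
split; first exact: d1.
apply: etrans E _.
have E1 := etrans (cartan_tensor_sym23 Lf v (zeta_fibre p y) a u0) (cartan_tensor_zeta Lf Dcartan zc a v u0).
have E2 : 'D_v (cst a) y = 0 by exact: derive_cst.
have E3 : fmetric L (p, y) ('D_v (zeta_fibre p) y) a = 0.
  by apply: etrans (congr1 (fun b => fmetric L (p, y) b a) Dz) (sp0l sp a).
have E4 : fmetric L (p, y) (zeta_fibre p y) ('D_v (cst a) y) = 0.
  apply: etrans (congr1 (fun b => fmetric L (p, y) (zeta_fibre p y) b) E2) _.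
  exact: etrans (sp_sym sp _ _) (sp0l sp _).
exact: (sum3_eq E1 E3 E4).
Qed.

Lemma Bfib_derive p y v : y != 0 ->
  differentiable (Bfib p) y /\ 'D_v (Bfib p) y = zeta_form p v y.
Proof.
move=> y0; have u0 : slit ((p, y) : TM M) by [].
have sp := metric_scalar_product Lf u0.
have [dz Dz] := zeta_fibre_derive p v y0.
have did : differentiable (id : V -> V) y by exact: ex_diff.
have [d1 E] := derive_metric_fibre Lf v u0 dz did.
split; first exact: d1.
apply: etrans E _.
have E1 := etrans (cartan_tensor_sym23 Lf v (zeta_fibre p y) y u0) (cartan_tensor_zeta Lf Dcartan zc y v u0).
have E3 : fmetric L (p, y) ('D_v (zeta_fibre p) y) y = 0.
  by apply: etrans (congr1 (fun b => fmetric L (p, y) b y) Dz) (sp0l sp y).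
have E2 : 'D_v (id : V -> V) y = v by exact: derive_id.
have E4 := congr1 (fun b => fmetric L (p, y) (zeta_fibre p y) b) E2.
exact: (sum3_eq E1 E3 E4).
Qed.

Lemma energy_change_derive p y a : y != 0 ->
  'D_a (energy Lt p) y = 'D_a (energy L p) y + 2 * (Bfib p y * zeta_form p a y).
Proof.
move=> y0.
have nE : \forall y \near y, (energy L p + Bfib p * Bfib p) y = energy Lt p y.
  apply: (open_near nonzero_open y0) => x x0; rewrite /energy.
  by rewrite (LtE (u := (p, x)) x0) /= expr2.
apply: etrans (esym (near_eq_derive a nE)) _.
have [db Db] := Bfib_derive p a y0.
have dvb := diff_derivable (v := a) db.
have dve := diff_derivable (v := a) (smooth_diff (energy_smooth Lf p) y0).
apply: etrans (deriveD dve (derivableM dvb dvb)) _; congr (_ + _).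
apply: etrans (deriveM dvb dvb) _.
apply: etrans (congr1 (fun r : R => Bfib p y *: r + Bfib p y *: r) Db) _.
by rewrite mulr2n mulrDl mul1r.
Qed.

(** Differentiate L^2 + B^2 twice along the fibre: dB = g(zeta, .) is constant there,
    so only the square of dB appears. *)
Lemma changed_metric u a b : slit u ->
  fmetric Lt u a b = fmetric L u a b + fmetric L u (zeta u) a * fmetric L u (zeta u) b.
Proof.
case: u => p y0 u0.
have nE : \forall y \near y0,
    ('D_b (energy L p) + 2 \*: (Bfib p * zeta_form p b)) y = 'D_b (energy Lt p) y.
  apply: (open_near nonzero_open u0) => x x0; exact/esym/energy_change_derive.
have [db Db] := Bfib_derive p a u0; have [dk Dk] := zeta_form_derive p b a u0.
have dvb := diff_derivable (v := a) db; have dvk := diff_derivable (v := a) dk.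
have dve := diff_derivable (v := a)
  (smooth_diff (smooth_derive b (energy_smooth Lf p)) u0).
have E1 := deriveD dve (derivableZ (k := 2) (derivableM dvb dvk)).
have E2 := deriveZ 2 (derivableM dvb dvk).
have E3 : 'D_a (Bfib p * zeta_form p b) y0 = Bfib p y0 * 0 + zeta_form p b y0 * zeta_form p a y0 :=
  etrans (deriveM dvb dvk) (congr2 (fun r s : R => Bfib p y0 * r + zeta_form p b y0 * s) Dk Db).
have E : 'D_a ('D_b (energy Lt p)) y0 =
    'D_a ('D_b (energy L p)) y0 + 2 * (Bfib p y0 * 0 + zeta_form p b y0 * zeta_form p a y0).
  apply: etrans (esym (near_eq_derive a nE)) _; apply: etrans E1 _.
  exact: (congr1 (fun r => _ + r) (etrans E2 (congr1 (fun r : R => 2 * r) E3))).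
apply: etrans (congr1 (fun r => 2^-1 * r) E) _.
have key (r b' k k' : R) : 2^-1 * (r + 2 * (b' * 0 + k * k')) = 2^-1 * r + k' * k by field.
exact: key.
Qed.

End EnergyChange.

(** * Uniqueness of a symmetric metric difference *)

Section UniquenessAlgebra.
Context {R : realType} {n : nat} (Sec : Type) (good : Sec -> Prop).
Local Notation V := 'rV[R]_n.
Variables (ev : Sec -> V) (eta : Sec) (h : V -> V -> R) (C : V -> V -> V -> R).
Variable S : V -> Sec -> V.
Hypotheses (hsp : scalar_product h) (eta_good : good eta).
Hypothesis ev_onto : forall v, exists2 X, good X & ev X = v.
Hypothesis C0 : forall a b, C 0 a b = 0.
Hypothesis Ceta : forall v a, C v (ev eta) a = 0.
Hypothesis S_sym : forall X Y, good X -> good Y -> S (ev X) Y = S (ev Y) X.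
Hypothesis S_metric : forall v Y Z, good Y -> good Z ->
  h (S v Y) (ev Z) + h (ev Y) (S v Z) = - C (S v eta) (ev Y) (ev Z).

Lemma double_eq0 (r : R) : r = - r -> r = 0.
Proof. by move=> E; lra. Qed.

Lemma h_nondeg a : (forall Z, good Z -> h a (ev Z) = 0) -> a = 0.
Proof. by move=> H; have [Z Zg Za] := ev_onto a; apply: (sp_def hsp); rewrite -{2}Za H. Qed.

(** Applied to the fundamental field, on which C vanishes, the metric identity
    gives S(eta, eta) = 0; inserting v = eta then gives S(v, eta) = 0 for all v, and the
    right-hand side disappears.  What remains is a map symmetric in its first two
    arguments and skew in the last two. *)
Lemma torsion_free_metric_unique v Y : good Y -> S v Y = 0.
Proof.
(* The metric identity with Y = Z = eta. *)
have P1 w : h (S w eta) (ev eta) = 0.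
  apply: double_eq0; have := S_metric w eta_good eta_good.
  rewrite Ceta oppr0 (sp_sym hsp (ev eta)) => /eqP.
  by rewrite addr_eq0 => /eqP.
have P2 w Z : good Z -> h (S w eta) (ev Z) = - h (ev eta) (S w Z).
  by move=> Zg; have := S_metric w eta_good Zg; rewrite Ceta oppr0 => /eqP; rewrite addr_eq0 => /eqP.
(* S(eta, eta) is orthogonal to every Z, since P2 and symmetry reduce it to P1. *)
have P3 : S (ev eta) eta = 0.
  apply: h_nondeg => Z Zg; rewrite P2 // S_sym // (sp_sym hsp) P1; exact: oppr0.
(* h(S(X, eta), Z) is symmetric in X and Z by P2 and skew by the identity with v = eta. *)
have P4 X : good X -> S (ev X) eta = 0.
  move=> Xg; apply: h_nondeg => Z Zg; apply: double_eq0.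
  have e1 : h (S (ev X) eta) (ev Z) = h (S (ev Z) eta) (ev X).
    by rewrite !P2 // [S (ev X) Z]S_sym.
  have := S_metric (ev eta) Xg Zg; rewrite P3 C0 oppr0 => /eqP; rewrite addr_eq0 => /eqP.
  by rewrite ![S (ev eta) _]S_sym // => e2; rewrite {1}e2 (sp_sym hsp) -e1.
have P5 w : S w eta = 0 by have [X Xg <-] := ev_onto w; exact: P4.
have P6 w A B : good A -> good B -> h (S w A) (ev B) = - h (ev A) (S w B).
  by move=> Ag Bg; have := S_metric w Ag Bg; rewrite P5 C0 oppr0 => /eqP; rewrite addr_eq0 => /eqP.
(* Three rounds of skewness and symmetry permute X, Y, Z cyclically and change the sign. *)
move=> Yg; have [X Xg <-] := ev_onto v; apply: h_nondeg => Z Zg; apply: double_eq0.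
rewrite {1}P6 // [S (ev X) Z]S_sym // (sp_sym hsp) P6 // opprK [S (ev Z) Y]S_sym //.
by rewrite (sp_sym hsp) P6 // [S (ev Y) X]S_sym // (sp_sym hsp).
Qed.

End UniquenessAlgebra.

(** * The algebra of the two metric conditions *)

Section MetricAlgebra.
Context {R : realType} {n : nat}.
Local Notation V := 'rV[R]_n.
Variables (g : V -> V -> R) (z : V).
Hypothesis gsp : scalar_product g.
Let h a b := g a b + g z a * g z b.

(** Here cY is the flat derivative of Y, GY and tY its two hor_christoffel, and eY the
    vertical christoffel that corrects for the difference of the horizontal lifts; primes
    refer to the second section.  The hypothesis equates the derivative of the new metric
    computed with the new connection and with the old one, for which - v is the
    derivative of zeta.  The term g / (1 + p^2) zeta is the one whose product with the new metric is g(v, y) g(zeta, .), as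
    h(zeta, .) = (1 + p^2) g(zeta, .). *)
Lemma koszul_difference (v y y' cY cY' GY GY' eY eY' tY tY' : V) (r : R) :
  g eY y' = r -> g y eY' = r -> g z eY = 0 -> g z eY' = 0 ->
  h (cY + tY) y' + h y (cY' + tY') =
  g (cY + (GY + eY)) y' + g y (cY' + (GY' + eY'))
  + ((g (- v) y + g z (cY + (GY + eY))) * g z y'
     + g z y * (g (- v) y' + g z (cY' + (GY' + eY')))) ->
  h (tY - GY + (g v y / (1 + g z z)) *: z) y' +
  h y (tY' - GY' + (g v y' / (1 + g z z)) *: z) = 2 * r.
Proof.
move=> e1 e2 e3 e4.
have k0 : 1 + g z z != 0 by rewrite gt_eqF // ltr_pwDl // (sp_ge0 gsp).
rewrite /h !(spDl gsp, spDr gsp, spZl gsp, spZr gsp, spNl gsp, spNr gsp) e1 e2 e3 e4.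
rewrite ![g y z](sp_sym gsp).
set a1 := g cY y'; set a2 := g tY y'; set a3 := g GY y'; set a4 := g z cY.
set a5 := g z tY; set a6 := g z GY; set b1 := g y cY'; set b2 := g y tY'.
set b3 := g y GY'; set b4 := g z cY'; set b5 := g z tY'; set b6 := g z GY'.
set k := g z z; set s := g z y; set s' := g z y'; set t := g v y; set t' := g v y'.
move=> E.
(* By h(z, .) = (1 + k) g(z, .) the denominators cancel. *)
have F : t / (1 + k) * s' + t / (1 + k) * k * s' = t * s' by field.
have F' : t' / (1 + k) * s + s * (t' / (1 + k) * k) = s * t' by field.
have -> : a2 - a3 + t / (1 + k) * s' + (a5 - a6 + t / (1 + k) * k) * s' +
  (b2 - b3 + t' / (1 + k) * s + s * (b5 - b6 + t' / (1 + k) * k)) =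
  (a2 - a3 + (a5 - a6) * s' + (b2 - b3) + s * (b5 - b6)) +
  (t / (1 + k) * s' + t / (1 + k) * k * s') + (t' / (1 + k) * s + s * (t' / (1 + k) * k)).
  by ring.
rewrite F F'; move/eqP: E; rewrite -subr_eq0 => /eqP E.
by apply/eqP; rewrite -subr_eq0; apply/eqP; rewrite -[RHS]E; ring.
Qed.

End MetricAlgebra.

(** * The change of the Chern connection *)

Section ChernChange.
Import Defs.
Context {R : realType} {n : nat} {M : manifold R n}.
Implicit Types (u : TM M) (w : TTM R n) (X Y Z : TM M -> 'rV[R]_n).
Local Notation V := 'rV[R]_n.
Variables (L Lt : TM M -> R) (D Dt : cov_deriv M) (zeta : TM M -> 'rV[R]_n).
Hypotheses (Lf : finsler L) (Dcartan : is_cartan L D) (zc : concurrent D zeta).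
Hypotheses (Ltf : finsler Lt) (Dtcartan : is_cartan Lt Dt).
Hypothesis LtE : forall u, slit u ->
  Lt u ^+ 2 = L u ^+ 2 + (fmetric L u (zeta u) (fund u)) ^+ 2.

Let zs : smooth_section zeta. Proof. by case: zc. Qed.
Let Dc : is_connection D. Proof. by case: Dcartan. Qed.
Let Dr : regular D. Proof. by case: Dcartan. Qed.
Let Dtc : is_connection Dt. Proof. by case: Dtcartan. Qed.
Let Dtr : regular Dt. Proof. by case: Dtcartan. Qed.
Local Notation g := (fmetric L).
Local Notation k u := (1 + fmetric L u (zeta u) (zeta u)).

Lemma tder_changed u w Y Z : slit u -> smooth_section Y -> smooth_section Z ->
  tder u w (fun u' => fmetric Lt u' (Y u') (Z u')) =
  tder u w (fun u' => g u' (Y u') (Z u')) +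
  (tder u w (fun u' => g u' (zeta u') (Y u')) * g u (zeta u) (Z u) +
   g u (zeta u) (Y u) * tder u w (fun u' => g u' (zeta u') (Z u'))).
Proof.
move=> u0 Ys Zs.
have d1 := metric_diff Lf u0 Ys Zs; have d2 := metric_diff Lf u0 zs Ys; have d3 := metric_diff Lf u0 zs Zs.
set f1 := (_ \o _) in d1; set f2 := (_ \o _) in d2; set f3 := (_ \o _) in d3.
have d23 := differentiableM d2 d3; have d := differentiableD d1 d23.
have ca := chart_at_atlas u.1.
have nE : \forall z \near tco (chart_at u.1) u, (f1 + f2 * f3) z =
    ((fun u' => fmetric Lt u' (Y u') (Z u')) \o tinv (chart_at u.1)) z.
  apply: near_slit => // z cz.
  exact: (esym (changed_metric Lf Dcartan zc LtE _ _ (slit_tinv ca cz))).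
have [_ E] := near_eq_diff nE d.
have E1 := congr1 (fun h : V * V -> R => h w) E.
have E2 := congr1 (fun h : V * V -> R => h w) (diffD d1 d23).
have E3 := congr1 (fun h : V * V -> R => h w) (diffM d2 d3).
apply: etrans E1 _; apply: etrans E2 _.
apply: (congr1 (fun r => _ + r)); apply: etrans E3 _.
have hu : tinv (chart_at u.1) (tco (chart_at u.1) u) = u.
  by apply: tinv_tco => //; exact: chart_at_dom.
have v2 : f2 (tco (chart_at u.1) u) = g u (zeta u) (Y u).
  exact: (congr1 (fun u' => g u' (zeta u') (Y u')) hu).
have v3 : f3 (tco (chart_at u.1) u) = g u (zeta u) (Z u).
  exact: (congr1 (fun u' => g u' (zeta u') (Z u')) hu).
have key (r1 r2 r3 r4 q1 q2 : R) : r1 = q1 -> r2 = q2 -> r1 * r3 + r2 * r4 = r4 * q2 + q1 * r3.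
  by move=> -> ->; rewrite addrC [q2 * r4]mulrC.
exact: key.
Qed.

(** It vanishes, by hor_christoffel_change. *)
Let S u (v : V) Y : V :=
  hor_christoffel Dt u v Y - hor_christoffel D u v Y + (g u v (Y u) / k u) *: zeta u.

Lemma S_sym u X Y : slit u -> smooth_section X -> smooth_section Y ->
  S u (X u) Y = S u (Y u) X.
Proof.
move=> u0 Xs Ys; rewrite /S (hor_christoffel_sym Dtcartan u0 Xs Ys) (hor_christoffel_sym Dcartan u0 Xs Ys).
exact: (congr1 (fun r => _ + (r / k u) *: zeta u) (sp_sym (metric_scalar_product Lf u0) _ _)).
Qed.

Lemma cartan_tensor_lin1 u c v v' a b : slit u ->
  cartan_tensor L u (c *: v + v') a b = c * cartan_tensor L u v a b + cartan_tensor L u v' a b.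
Proof.
move=> u0; have hs := hess_smooth (idfun : {linear V -> V}) (energy_smooth Lf u.1) a b.
have E := derive_smooth_lin v c v' hs u0.
by apply: etrans (congr1 (fun r => 2^-1 * r) E) _; rewrite mulrDr mulrCA.
Qed.

Lemma cartan_tensor01 u a b : slit u -> cartan_tensor L u 0 a b = 0.
Proof.
move=> u0; have := cartan_tensor_lin1 1 0 0 a b u0; rewrite scaler0 addr0 mul1r => /eqP.
by rewrite -[X in X == _]addr0 (inj_eq (addrI _)) eq_sym => /eqP.
Qed.

(** Both metric conditions are written along the horizontal lift of v for the new
    connection, which differs from the old lift by gamma s, where s is - S(v, eta) up to a
    multiple of zeta.  The vertical christoffel along gamma s is half the Cartan tensor,
    and the multiple of zeta is invisible to it. *)
Lemma S_metric u v Y Z : slit u -> smooth_section Y -> smooth_section Z ->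
  fmetric Lt u (S u v Y) (Z u) + fmetric Lt u (Y u) (S u v Z) =
  - cartan_tensor L u (S u v (@fund R n M)) (Y u) (Z u).
Proof.
move=> u0 Ys Zs; have sp := metric_scalar_product Lf u0.
have Es := @smooth_fund R n M.
pose w := hor_map Dt u v; pose s := hor_christoffel D u v (@fund R n M) - hor_christoffel Dt u v (@fund R n M).
have wE : w = hor_map D u v + gamma s.
  rewrite /w (hor_mapE Ltf Dtcartan v u0) (hor_mapE Lf Dcartan v u0).
  by congr pair; rewrite /= ?addr0 // /s addrA addNr add0r.
have wv : rho w = v by exact: (hor_map_spec Dtr v u0).2.
have DE W : smooth_section W ->
    D u w W = flat_deriv u w W + (hor_christoffel D u v W + christoffel D u (gamma s) W).
  by move=> Ws; rewrite christoffelE {2}wE (christoffelD Dcartan _ _ u0 Ws).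
have DtE W : Dt u w W = flat_deriv u w W + hor_christoffel Dt u v W by exact: christoffelE.
have met W Q : smooth_section W -> smooth_section Q ->
    tder u w (fun u' => g u' (W u') (Q u')) = g u (D u w W) (Q u) + g u (W u) (D u w Q).
  by move=> Ws Qs; have h := cartan_metrical Dcartan w u0 Ws Qs; exact h.
have metz W : smooth_section W ->
    tder u w (fun u' => g u' (zeta u') (W u')) = g u (- v) (W u) + g u (zeta u) (D u w W).
  move=> Ws; apply: etrans (met _ _ zs Ws) _.
  by have E := cov_zeta Lf Dcartan zc w u0; rewrite wv in E; rewrite E.
have half (r r' c : R) : c = 2 * r -> r' = r -> r' = 2^-1 * c by move=> -> ->; field.
have c1 : g u (christoffel D u (gamma s) Y) (Z u) = 2^-1 * cartan_tensor L u s (Y u) (Z u).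
  exact: half (cartan_tensorE Lf Dcartan s u0 Ys Zs) erefl.
have c2 : g u (Y u) (christoffel D u (gamma s) Z) = 2^-1 * cartan_tensor L u s (Y u) (Z u).
  apply: half (sp_sym sp _ _).
  exact: etrans (cartan_tensor_sym23 Lf s (Y u) (Z u) u0) (cartan_tensorE Lf Dcartan s u0 Zs Ys).
have cz W : smooth_section W -> g u (zeta u) (christoffel D u (gamma s) W) = 0.
  move=> Ws; have E := cartan_tensorE Lf Dcartan s u0 Ws zs.
  have E2 := etrans (esym E) (cartan_tensor_zeta Lf Dcartan zc (W u) s u0).
  move/eqP: E2; rewrite mulf_eq0 pnatr_eq0 /= => /eqP E3.
  exact: etrans (sp_sym sp _ _) E3.
have hE a b : fmetric Lt u a b = g u a b + g u (zeta u) a * g u (zeta u) b.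
  by have h := changed_metric Lf Dcartan zc LtE a b u0; exact h.
have tE := tder_changed w u0 Ys Zs.
have ctm := cartan_metrical Dtcartan w u0 Ys Zs.
have R1 := etrans (met _ _ Ys Zs)
  (congr2 (fun a b => g u a (Z u) + g u (Y u) b) (DE Y Ys) (DE Z Zs)).
have R2 W (Ws : smooth_section W) := etrans (metz W Ws)
  (congr1 (fun a => g u (- v) (W u) + g u (zeta u) a) (DE W Ws)).
have R3 := congr2 (fun a b => a * g u (zeta u) (Z u) + g u (zeta u) (Y u) * b)
  (R2 Y Ys) (R2 Z Zs).
have T1 := etrans tE (congr2 +%R R1 R3).
have T2 := etrans ctm (etrans
  (congr2 (fun a b => fmetric Lt u a (Z u) + fmetric Lt u (Y u) b) (DtE Y) (DtE Z))
  (congr2 +%R (hE _ _) (hE _ _))).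
have E := koszul_difference sp c1 c2 (cz Y Ys) (cz Z Zs) (etrans (esym T2) T1).
apply: etrans (etrans (congr2 +%R (hE _ _) (hE _ _)) E) _.
have two (c : R) : 2 * (2^-1 * c) = c by field.
rewrite two.
have sE : s = (-1) *: S u v (@fund R n M) + ((g u v (fund u) / k u) *: zeta u + 0).
  by rewrite scaleN1r addr0 /S opprD opprB subrK.
have cz0 : cartan_tensor L u (zeta u) (Y u) (Z u) = 0.
  apply: etrans (cartan_tensor_sym12 Lf _ _ _ u0) _; apply: etrans (cartan_tensor_sym23 Lf _ _ _ u0) _.
  exact: (cartan_tensor_zeta Lf Dcartan zc).
apply: etrans (congr1 (fun a => cartan_tensor L u a (Y u) (Z u)) sE) _.
apply: etrans (cartan_tensor_lin1 _ _ _ _ _ u0) _.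
have E2 := cartan_tensor_lin1 (g u v (fund u) / k u) (zeta u) 0 (Y u) (Z u) u0.
have E3 := cartan_tensor01 (Y u) (Z u) u0.
have comb (c r q : R) : r = 0 -> q = 0 -> c * r + q = 0 by move=> -> ->; rewrite mulr0 addr0.
have opp (r q : R) : q = 0 -> -1 * r + q = - r by move=> ->; rewrite mulN1r addr0.
exact: (opp _ _ (etrans E2 (comb _ _ _ cz0 E3))).
Qed.

Lemma hor_christoffel_change u v Y : slit u -> smooth_section Y ->
  hor_christoffel Dt u v Y = hor_christoffel D u v Y - (g u v (Y u) / k u) *: zeta u.
Proof.
move=> u0 Ys; have S0 : S u v Y = 0.
  have H1 := metric_scalar_product Ltf u0.
  have H2 v' : exists2 X : TM M -> 'rV[R]_n, smooth_section X & X u = v'.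
    exact: section_through.
  have H3 a b : cartan_tensor L u 0 a b = 0 by exact: cartan_tensor01.
  have H4 v' a : cartan_tensor L u v' (fund u) a = 0 by exact: (cartan_tensor_eta2 Lf v' a u0).
  have H5 X Z : smooth_section X -> smooth_section Z -> S u (X u) Z = S u (Z u) X.
    by move=> Xs Zs; exact: S_sym.
  have H6 v' Z W : smooth_section Z -> smooth_section W ->
      fmetric Lt u (S u v' Z) (W u) + fmetric Lt u (Z u) (S u v' W) =
      - cartan_tensor L u (S u v' (@fund R n M)) (Z u) (W u).
    by move=> Zs Ws; exact: S_metric.
  exact: (@torsion_free_metric_unique R n (TM M -> 'rV[R]_n) (@smooth_section R n M)
    (fun Y => Y u) (@fund R n M) (fmetric Lt u) (cartan_tensor L u) (S u)
    H1 (@smooth_fund R n M) H2 H3 H4 H5 H6 v Y Ys).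
move/eqP: S0; rewrite /S addr_eq0 subr_eq => /eqP ->.
by rewrite addrC.
Qed.

(** The right-hand side involves no connection: part (a). *)
Lemma chern_lift_v_formula (E : cov_deriv M) K X Y u : is_cartan K E -> finsler K ->
  slit u -> smooth_section X -> smooth_section Y ->
  chern E (lift_v X) Y u = flat_deriv u (gamma (X u)) Y.
Proof.
move=> Ec Kf u0 Xs Ys; have Econ : is_connection E by case: Ec.
have Ereg : regular E by case: Ec.
rewrite (chernE Kf Ec u0 Ys); last exact: (cov_smooth Econ (smooth_lift_v Xs) (@smooth_fund R n M)).
have h0 : hor_map E u 0 = 0.
  apply: (hor_map_unique Econ Ereg u0) => //; exact: (cov0l Econ u0 (@smooth_fund R n M)).
by rewrite (_ : rho (lift_v X u) = 0) // /hor_christoffel h0 /christoffel (cov0l Econ u0 Ys)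
  (_ : flat_deriv u 0 Y = 0) ?subrr ?addr0 //; exact: linear0.
Qed.

Lemma chern_lift_h_formula (E : cov_deriv M) K X Y u : is_cartan K E -> finsler K ->
  slit u -> smooth_section X -> smooth_section Y ->
  chern E (lift_h E X) Y u = flat_deriv u (hor_map E u (X u)) Y + hor_christoffel E u (X u) Y.
Proof.
move=> Ec Kf u0 Xs Ys; have Econ : is_connection E by case: Ec.
have Ereg : regular E by case: Ec.
rewrite (chernE Kf Ec u0 Ys).
  by rewrite /lift_h (hor_map_spec Ereg (X u) u0).2.
apply: smooth_section_ext smooth_section0 => u' u'0.
exact: esym (hor_map_spec Ereg (X u') u'0).1.
Qed.

Lemma chern_change (X Y : TM M -> TTM R n) u : smooth_vfield X -> smooth_vfield Y -> slit u ->
  chern Dt X (@rho R n \o Y) u = chern D X (@rho R n \o Y) u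
   - (g u (rho (X u)) (rho (Y u)) / k u) *: zeta u.
Proof.
move=> Xs Ys u0; have rYs := smooth_rho Ys.
rewrite (chernE Ltf Dtcartan u0 rYs); last exact: (cov_smooth Dtc Xs (@smooth_fund R n M)).
rewrite (chernE Lf Dcartan u0 rYs); last exact: (cov_smooth Dc Xs (@smooth_fund R n M)).
by rewrite hor_christoffel_change // addrA.
Qed.

(** By hor_mapE the two horizontal lifts differ by a multiple of gamma zeta, and along
    gamma zeta the Chern derivative is the flat one. *)
Lemma chern_change_h X Y u : smooth_section X -> smooth_section Y -> slit u ->
  chern Dt (lift_h Dt X) Y u = chern D (lift_h D X) Y u
   - ((g u (X u) (Y u) / k u) *: zeta u
      - (g u (X u) (fund u) / k u) *: chern D (lift_v zeta) Y u).
Proof.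
move=> Xs Ys u0.
rewrite (chern_lift_h_formula Dtcartan Ltf u0 Xs Ys) (chern_lift_h_formula Dcartan Lf u0 Xs Ys).
rewrite (chern_lift_v_formula Dcartan Lf u0 zs Ys) hor_christoffel_change //.
have hE : hor_map Dt u (X u) =
    (g u (X u) (fund u) / k u) *: gamma (zeta u) + hor_map D u (X u).
  apply: etrans (hor_mapE Ltf Dtcartan (X u) u0) _.
  rewrite (hor_christoffel_change (X u) u0 (@smooth_fund R n M)).
  apply: etrans _ (congr1 (fun w => _ + w) (esym (hor_mapE Lf Dcartan (X u) u0))).
  by congr pair; rewrite /= ?scaler0 ?add0r // opprB.
have cE := etrans (congr1 (fun w => flat_deriv u w Y) hE) (flat_deriv_lin u _ _ _ Y).
have key (a b q r : V) : (b + a) + (q - r) = a + q - (r - b).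
  by rewrite opprB [RHS]addrACA [b + a]addrC.
exact: etrans (congr1 (fun x => x + _) cE) (key _ _ _ _).
Qed.

End ChernChange.

(** * The theorem *)

Theorem theorem5p11 (R : realType) (n : nat) (M : manifold R n)
    (L Lt : TM M -> R) (nabla nablat : cov_deriv M) (zeta : TM M -> 'rV[R]_n)
    (B p2 : TM M -> R)
    (hB : B = fun u => fmetric L u (zeta u) (fund u))
    (hp2 : p2 = fun u => fmetric L u (zeta u) (zeta u))
    (hL : finsler L) (hnabla : is_cartan L nabla)
    (hzeta : concurrent nabla zeta)
    (hLt : finsler Lt)
    (hchange : forall u, slit u -> Lt u ^+ 2 = L u ^+ 2 + B u ^+ 2)
    (hnablat : is_cartan Lt nablat) :
  (forall (X Y : TM M -> TTM R n) (u : TM M),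
     smooth_vfield X -> smooth_vfield Y -> slit u ->
     chern nablat X (@rho R n \o Y) u =
     chern nabla X (@rho R n \o Y) u
     - (fmetric L u (rho (X u)) (rho (Y u)) / (1 + p2 u)) *: zeta u)
  /\
  (forall (X Y : TM M -> 'rV[R]_n) (u : TM M),
     smooth_section X -> smooth_section Y -> slit u ->
     chern nablat (lift_v X) Y u = chern nabla (lift_v X) Y u)
  /\
  (forall (X Y : TM M -> 'rV[R]_n) (u : TM M),
     smooth_section X -> smooth_section Y -> slit u ->
     chern nablat (lift_h nablat X) Y u =
     chern nabla (lift_h nabla X) Y u
     - ((fmetric L u (X u) (Y u) / (1 + p2 u)) *: zeta u
        - (fmetric L u (X u) (fund u) / (1 + p2 u)) *:
            chern nabla (lift_v zeta) Y u)).
Proof.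
move: hchange; rewrite hB hp2 => LtE; split; [|split].
- exact: (chern_change hL hnabla hzeta hLt hnablat LtE).
- move=> X Y u Xs Ys u0.
  rewrite (chern_lift_v_formula hnablat hLt u0 Xs Ys).
  by rewrite (chern_lift_v_formula hnabla hL u0 Xs Ys).
- exact: (chern_change_h hL hnabla hzeta hLt hnablat LtE).
Qed.
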